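(* Let $m$ and $\varepsilon_0$ be the constants defined in the context. Let $\varepsilon\in(0,\varepsilon_0)$, let $\theta\in(0,\pi)$ be given by $\varepsilon=\cos\frac{\theta}{2}$, and set $$Q=\{(x,t)\mid x\in\mathcal{C}_\theta,\ x_1>1,\ t\in(0,1)\}.$$ Then there exist $\alpha=\alpha(\varepsilon)\in(1,2)$ and $K=K(\varepsilon)>0$ such that, with $$\varphi(x)=r^\alpha\Bigl[\Bigl(\frac{x_1}{r}\Bigr)^m-\varepsilon^m\Bigr],\qquad r=|x|,$$ the following inequality holds for every $u\in C_0^\infty(Q)$ and every real number $a>0$: $$ \int_Q e^{2a(t^{-K}-1)\varphi(x)-\frac{|x|^2+K}{8t}}\bigl(|u|^2+|\nabla u|^2\bigr)\,dx\,dt \le \int_Q e^{2a(t^{-K}-1)\varphi(x)-\frac{|x|^2+K}{8t}}\,|\partial_t u+\Delta u|^2\,dx\,dt . $$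
   Context: Points of $\mathbb{R}^n$ are written $x=(x_1,x')$ with $x'\in\mathbb{R}^{n-1}$. For an opening angle $\theta\in(0,\pi)$, the cone $\mathcal{C}_\theta$ is $$\mathcal{C}_\theta=\{x=(x_1,x')\in\mathbb{R}^n \mid x'\in\mathbb{R}^{n-1},\ x_1>|x|\cos\tfrac{\theta}{2}\}.$$ $\nabla$ and $\Delta$ denote the gradient and Laplacian in the space variable $x$; $C_0^\infty(Q)$ is the space of smooth functions with compact support in $Q$. Definition of $m$ and $\varepsilon_0$: the numbers $\varepsilon_0>0$ and $m$ are the largest numbers such that, with $\frac12<\gamma\le 1$ and $2.36\le m<3$, the following three equations hold: $$ \text{(i)}\ 4(2\gamma-1)=\gamma^2\Bigl(4-\gamma^2\tfrac{m-1}{4}\Bigr);\qquad \text{(ii)}\ \tfrac{m-1}{m+1}-\varepsilon_0^2=0; $$ $$ \text{(iii)}\ \Bigl(4-\gamma^2\tfrac{m-1}{4}-m\Bigr)-\Bigl(4-\gamma^2\tfrac{m-1}{4}\Bigr)\varepsilon_0^m=0 . $$ Numerically $m\approx 2.4600$, $\varepsilon_0\approx 0.6495$ and $2\arccos\varepsilon_0\approx 98.99^\circ$. *)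

(* Defs.v *)
From HB Require Import structures.
From mathcomp Require Import all_boot all_order all_algebra.
From mathcomp Require Import all_classical all_reals all_analysis.

Set Implicit Arguments.
Unset Strict Implicit.
Unset Printing Implicit Defensive.

Import Order.TTheory GRing.Theory Num.Theory.
Import numFieldNormedType.Exports.

Local Open Scope classical_set_scope.
Local Open Scope ring_scope.

(* Row vectors carry the sigma-algebra generated by the coordinates, that is,
   the Borel sigma-algebra of [R^n]. *)

Definition rV_display : measure_display.
Proof. exact: default_measure_display. Qed.

Section measurable_rV.
Context {R : realType} (n : nat).

Let coord (i : 'I_n) (x : 'rV[R]_n) : measurableTypeR R := x ord0 i.

Let rV_set0 : g_sigma_preimage coord set0.
Proof. exact: sigma_algebra0. Qed.

Let rV_setC A : g_sigma_preimage coord A -> g_sigma_preimage coord (~` A).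
Proof. exact: sigma_algebraC. Qed.

Let rV_bigcup (F : (set 'rV[R]_n)^nat) :
  (forall i, g_sigma_preimage coord (F i)) ->
  g_sigma_preimage coord (\bigcup_i (F i)).
Proof. exact: sigma_algebra_bigcup. Qed.

HB.instance Definition _ := @isMeasurable.Build rV_display 'rV[R]_n
  (g_sigma_preimage coord) rV_set0 rV_setC rV_bigcup.

Lemma measurable_rV_coord (i : 'I_n) :
  measurable_fun [set: 'rV[R]_n]
    (fun x : 'rV[R]_n => x ord0 i : measurableTypeR R).
Proof.
move=> _ Y mY; rewrite setTI; apply: sub_sigma_algebra => /=.
rewrite -bigcup_seq/=; exists i => /=; first by rewrite mem_index_enum.
by exists Y => //; rewrite setTI.
Qed.

Lemma measurable_fun_rVP d (T : measurableType d) (f : T -> 'rV[R]_n) :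
  (forall i, measurable_fun [set: T]
     (fun x => f x ord0 i : measurableTypeR R)) ->
  measurable_fun [set: T] f.
Proof.
move=> mf _ A mA; rewrite setTI.
apply: (mA [set B | measurable (f @^-1` B)]); split => /=.
  split => /=.
  - by rewrite preimage_set0.
  - by move=> B mB; rewrite setTD preimage_setC; exact: measurableC.
  - by move=> F mF; rewrite preimage_bigcup; exact: bigcup_measurable.
rewrite -bigcup_seq => B /= [i _ [C mC <-]] /=.
by rewrite setTI -[X in measurable X]setTI; exact: (mf i).
Qed.

End measurable_rV.

Section lebesgue_rV.
Context {R : realType}.

Section cons.
Variable n : nat.

Definition consrV (p : measurableTypeR R * 'rV[R]_n) : 'rV[R]_n.+1 :=
  row_mx (const_mx p.1 : 'rV[R]_1) p.2.

Definition unconsrV (x : 'rV[R]_n.+1) : measurableTypeR R * 'rV[R]_n :=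
  (x ord0 ord0, \row_i x ord0 (lift ord0 i)).

Lemma consrV0 p : consrV p ord0 ord0 = p.1.
Proof.
have e : (ord0 : 'I_(1 + n)) = lshift n (ord0 : 'I_1) by exact: val_inj.
transitivity (consrV p ord0 (lshift n (ord0 : 'I_1))); first by rewrite -e.
by apply: etrans (row_mxEl _ _ _ _) _; rewrite mxE.
Qed.

Lemma consrVS p i : consrV p ord0 (lift ord0 i) = p.2 ord0 i.
Proof.
have e : (lift ord0 i : 'I_(1 + n)) = rshift 1 i by exact: val_inj.
transitivity (consrV p ord0 (rshift 1 i)); first by rewrite -e.
exact: row_mxEr.
Qed.

Lemma consrVK : cancel consrV unconsrV.
Proof.
move=> [a x]; rewrite /unconsrV consrV0; congr pair.
by apply/rowP => i; rewrite mxE consrVS.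
Qed.

Lemma unconsrVK : cancel unconsrV consrV.
Proof.
move=> x; apply/rowP => i; case: (unliftP ord0 i) => [j ->|->].
  by rewrite consrVS mxE.
by rewrite consrV0.
Qed.

Lemma measurable_consrV : measurable_fun setT consrV.
Proof.
apply: measurable_fun_rVP => i; case: (unliftP ord0 i) => [j ->|->].
  under eq_fun do rewrite consrVS.
  exact: (measurableT_comp (measurable_rV_coord j) measurable_snd).
under eq_fun do rewrite consrV0.
exact: measurable_fst.
Qed.

Lemma measurable_unconsrV : measurable_fun setT unconsrV.
Proof.
apply: measurable_fun_pair => /=; first exact: measurable_rV_coord.
apply: measurable_fun_rVP => i; under eq_fun do rewrite mxE.
exact: measurable_rV_coord.
Qed.

Variable mu : {sigma_finite_measure set 'rV[R]_n -> \bar R}.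

Definition lebesgue_cons : set 'rV[R]_n.+1 -> \bar R :=
  pushforward (lebesgue_measure \x mu)%E consrV.

Let lebesgue_cons0 : lebesgue_cons set0 = 0%E.
Proof. by rewrite /lebesgue_cons /pushforward preimage_set0 measure0. Qed.

Let lebesgue_cons_ge0 A : (0 <= lebesgue_cons A)%E.
Proof. by rewrite /lebesgue_cons /pushforward measure_ge0. Qed.

Let lebesgue_cons_sigma_additive : semi_sigma_additive lebesgue_cons.
Proof.
move=> F mF tF mUF; rewrite /lebesgue_cons /pushforward preimage_bigcup.
have mC B : measurable B -> measurable (consrV @^-1` B).
  by move=> mB; rewrite -[X in measurable X]setTI; exact: measurable_consrV.
apply: measure_semi_sigma_additive.
- by move=> k; exact: mC.
- apply/trivIsetP => /= i j _ _ ij; rewrite -preimage_setI.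
  by move/trivIsetP : tF => /(_ _ _ _ _ ij) ->//; rewrite preimage_set0.
- by rewrite -preimage_bigcup; exact: mC.
Qed.

HB.instance Definition _ := isMeasure.Build _ _ _ lebesgue_cons
  lebesgue_cons0 lebesgue_cons_ge0 lebesgue_cons_sigma_additive.

Lemma lebesgue_cons_setX (A : set (measurableTypeR R)) (B : set 'rV[R]_n) :
  measurable A -> measurable B ->
  lebesgue_cons (unconsrV @^-1` (A `*` B)) = (lebesgue_measure A * mu B)%E.
Proof.
move=> mA mB; rewrite -product_measure1E//.
rewrite /lebesgue_cons /pushforward -comp_preimage.
rewrite (_ : unconsrV \o consrV = id) ?preimage_id//.
by apply/funext => p /=; rewrite consrVK.
Qed.

Let lebesgue_cons_sigma_finite : sigma_finite setT lebesgue_cons.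
Proof.
have /sigma_finiteP[F [TF ndF Foo]] :=
  sigma_finiteT (@lebesgue_measure R : {sigma_finite_measure set _ -> \bar R}).
have /sigma_finiteP[G [TG ndG Goo]] := sigma_finiteT mu.
exists (fun k => unconsrV @^-1` (F k `*` G k)).
  rewrite -preimage_bigcup (_ : \bigcup_k (F k `*` G k) = setT) ?preimage_setT//.
  apply/seteqP; split => // -[x y] _.
  have [i _ Fx] : (\bigcup_k F k) x by rewrite -TF.
  have [j _ Gy] : (\bigcup_k G k) y by rewrite -TG.
  exists (maxn i j) => //; split => /=.
  - by move: x Fx; exact/subsetPset/ndF/leq_maxl.
  - by move: y Gy; exact/subsetPset/ndG/leq_maxr.
move=> k; have [mF Fk] := Foo k; have [mG Gk] := Goo k; split.
  rewrite -[X in measurable X]setTI; apply: measurable_unconsrV => //.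
  exact: measurableX.
rewrite [ltLHS](_ : _ = (lebesgue_measure (F k) * mu (G k))%E).
  by rewrite lte_mul_pinfty// ge0_fin_numE.
exact: lebesgue_cons_setX.
Qed.

HB.instance Definition _ := Measure_isSigmaFinite.Build _ _ _ lebesgue_cons
  lebesgue_cons_sigma_finite.

End cons.

(* Lebesgue measure on [R^n], as the n-fold product of [lebesgue_measure];
   see [lebesgue_rV_box]. *)
Fixpoint lebesgue_rV (n : nat) :
    {sigma_finite_measure set 'rV[R]_n -> \bar R} :=
  match n with
  | 0 => \d_(0 : 'rV[R]_0)
  | k.+1 => lebesgue_cons (lebesgue_rV k)
  end.

Lemma lebesgue_rV_box n (A : 'I_n -> set (measurableTypeR R)) :
  (forall i, measurable (A i)) ->
  lebesgue_rV n [set x | forall i, A i (x ord0 i)] =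
    (\prod_(i < n) lebesgue_measure (A i))%E.
Proof.
elim: n A => [|n IH] A mA.
  rewrite big_ord0 /= diracE mem_set//=.
  by case.
rewrite big_ord_recl -IH; last by move=> i; exact: mA.
rewrite -(lebesgue_cons_setX (lebesgue_rV n)) => [||]; last 2 first.
- exact: mA.
- rewrite [X in measurable X](_ : _ = \big[setI/setT]_(i < n)
    [set x : 'rV[R]_n | A (lift ord0 i) (x ord0 i)]).
    apply: bigsetI_measurable => i _.
    rewrite -[X in measurable X]setTI.
    exact: (measurable_rV_coord _ measurableT (mA (lift ord0 i))).
  rewrite -bigcap_seq; apply/seteqP; split=> x /= Ax i.
    by move=> _; exact: Ax.
  by apply: Ax => /=; rewrite mem_index_enum.
congr (lebesgue_cons _ _); apply/seteqP; split=> [x Ax|x [A0 Ax] i] /=.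
  by split=> [|i] /=; rewrite ?mxE; exact: Ax.
case: (unliftP ord0 i) => [j ->|->]; last exact: A0.
by have := Ax j; rewrite /= mxE.
Qed.

End lebesgue_rV.

Section smooth.
Context {R : realType} {V : normedModType R}.

(* [Ck k f] says that [f] is of class C^k on the whole of [V] *)
Fixpoint Ck (k : nat) (f : V -> R) : Prop :=
  match k with
  | 0 => continuous f
  | k'.+1 => (forall x, differentiable f x) /\ forall v, Ck k' ('D_v f)
  end.

Definition smooth (f : V -> R) : Prop := forall k, Ck k f.

(* [C_0^oo(Q)]: elements are identified with their extension by 0 to [V] *)
Definition test_function (Q : set V) (f : V -> R) : Prop :=
  [/\ smooth f, compact (closure [set x | f x != 0])
    & closure [set x | f x != 0] `<=` Q].

End smooth.

Section spacetime.
Context {R : realType} {n : nat}.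
Implicit Types (x : 'rV[R]_n) (u : 'rV[R]_n * R -> R) (z : 'rV[R]_n * R).

(* the library norm on ['rV[R]_n] is the sup norm *)
Definition enorm x : R := Num.sqrt (\sum_i x ord0 i ^+ 2).

Definition dx (i : 'I_n) u : 'rV[R]_n * R -> R := 'D_(delta_mx ord0 i, 0) u.

Definition dt u : 'rV[R]_n * R -> R := 'D_(0, 1) u.

Definition gradient u z : 'rV[R]_n := \row_i dx i u z.

Definition laplacian u z : R := \sum_i dx i (dx i u) z.

Definition lebesgue_spacetime : set ('rV[R]_n * measurableTypeR R) -> \bar R :=
  (lebesgue_rV n \x lebesgue_measure)%E.

HB.instance Definition _ := Measure.on lebesgue_spacetime.

End spacetime.

(* The ambient space is [R^n] with [n = d.+1], so that the distinguished
   coordinate [x_1] exists; it is [x ord0 ord0]. *)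

Section cone.
Context {R : realType} {d : nat}.
Implicit Types (x : 'rV[R]_d.+1) (z : 'rV[R]_d.+1 * R).

Definition cone (theta : R) : set 'rV[R]_d.+1 :=
  [set x | enorm x * cos (theta / 2) < x ord0 ord0].

Definition cylinder (theta : R) : set ('rV[R]_d.+1 * R) :=
  [set z | [/\ cone theta z.1, 1 < z.1 ord0 ord0 & 0 < z.2 < 1]].

Definition phi (m eps alpha : R) x : R :=
  enorm x `^ alpha * ((x ord0 ord0 / enorm x) `^ m - eps `^ m).

Definition weight (m eps alpha K a : R) z : R :=
  expR (2 * a * (z.2 `^ (- K) - 1) * phi m eps alpha z.1
        - (enorm z.1 ^+ 2 + K) / (8 * z.2)).

End cone.

Section constants.
Context {R : realType}.

Definition cone_system (gamma m eps0 : R) : Prop :=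
  [/\ 1 / 2 < gamma <= 1, 236 / 100 <= m < 3 & 0 < eps0] /\
  [/\ 4 * (2 * gamma - 1) = gamma ^+ 2 * (4 - gamma ^+ 2 * ((m - 1) / 4)),
      (m - 1) / (m + 1) - eps0 ^+ 2 = 0
    & (4 - gamma ^+ 2 * ((m - 1) / 4) - m)
      - (4 - gamma ^+ 2 * ((m - 1) / 4)) * eps0 `^ m = 0].

(* [m] and [eps0] are simultaneously the largest among all solutions; by the
   second equation [eps0] is an increasing function of [m]. *)
Definition cone_constants (m eps0 : R) : Prop :=
  (exists gamma, cone_system gamma m eps0) /\
  forall gamma' m' eps0', cone_system gamma' m' eps0' ->
    m' <= m /\ eps0' <= eps0.

End constants.

(* Main.v *)
Require Import Defs.
From HB Require Import structures.
From mathcomp Require Import all_boot all_order all_algebra.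
From mathcomp Require Import all_classical all_reals all_analysis.
From mathcomp Require Import measurable_realfun ring lra.

Set Implicit Arguments.
Unset Strict Implicit.
Unset Printing Implicit Defensive.

Import Order.TTheory GRing.Theory Num.Theory.
Import numFieldNormedType.Exports.

Local Open Scope classical_set_scope.
Local Open Scope ring_scope.

(** The inequality is a Carleman estimate obtained by conjugation.  Write
    [Phi = a (t^-K - 1) phi - (|x|^2 + K) / (16 t)], so that the weight is
    [e^(2 Phi)], and put [v = e^Phi u].  Then [e^Phi (d_t + Lap) u = S v + A v]
    where [S v = Lap v + G v], [G = |grad Phi|^2 - Phi_t], is symmetric and
    [A v = v_t - 2 grad Phi . grad v - (Lap Phi) v] is antisymmetric.  For every
    function [F],
      [|S v + A v|^2 >= 2 S v (A v + F v) - F^2 v^2],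
    and the right-hand side equals, up to the divergence of a flux which is
    quadratic in [v] and its first derivatives ([divergence_identity]),
      [4 D^2 Phi(grad v, grad v) - 2 F |grad v|^2 + W v^2].
    Fluxes of compactly supported functions integrate to zero
    ([integral_divergence]), so the theorem follows once, for a suitable [F],
    the gradient form dominates [2 |grad v|^2] and [W] dominates
    [1 + 2 |grad Phi|^2] pointwise ([carleman_pointwise]): these are the bounds
    that are needed to return from [v] to [u].

    The choice of [F] is dictated by the geometry.  Since [phi] depends only on
    [x_1] and [|x|], its Hessian is [D] times the identity plus a quadratic form
    in [xi_1] and [x . xi]; here [D] is the eigenvalue in the directions
    orthogonal to both.  For [1 < alpha < 2 < m] the remaining form is
    nonnegative ([phase_hessian_psd]), so [F = 2 a (t^-K - 1) D - 2 / t] leaves a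
    gradient form at least [(7/2) |grad v|^2 / t].  With this choice the leading
    part of [W], of order [a^3], is a positive multiple of
    [D^2 phi(grad phi, grad phi) + D |grad phi|^2], and the part of order [a^2]
    contains [4 K] times [|grad phi|^2 + D phi].  If the first quantity is
    nonnegative and the second one is at least [c |x|^(2 alpha - 2)], all the
    remaining terms are absorbed for [K] large, uniformly in [a]
    ([zeroth_coef_lower]).

    In the variables [y = 1 - (eps / c)^m], [tau = 1 / c^2 - 1], [c = x_1 / |x|],
    the first quantity is, up to a positive factor, the polynomial
    [angular_form (alpha^2) m y tau] ([phase_principal]).  At the limiting values
    [alpha = 2], [eps = eps0] the function [y] of [tau] is concave, hence lies
    above the chord joining the two ends [c = 1] and [c = eps0] of the cone; equations (ii) and (iii) locate these
    ends, and equation (i) says that the restriction of the form to the chord is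
    a nonnegative function times a perfect square ([angular_form_chord]).  The
    form increases with [y] where it is nonnegative
    ([angular_form_increasing]), so it is positive on the whole cone when
    [eps < eps0] ([angular_form_gt0]).  By compactness it stays nonnegative for
    some [alpha < 2] ([exponent_choice]). *)

(** * Measurability of continuous functions of space and time *)

Section measurability.
Context {R : realType}.

(** The sigma-algebra of ['rV[R]_n] is generated by the coordinates, not by the
    topology, so that measurability of continuous functions has to be proved:
    they are pointwise limits of functions that factor through a countable grid
    whose cells are boxes. *)
Lemma measurable_fun_countable_approx d (T : measurableType d) (C : countType)
    (N : nat -> T -> C) (F : nat -> C -> R) (f : T -> R) :
  (forall k c, measurable (N k @^-1` [set c])) ->
  (forall x, F k (N k x) @[k --> \oo] --> f x) ->
  measurable_fun [set: T] f.
Proof.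
move=> mN cF.
apply: (@measurable_fun_cvg _ _ _ _ (fun k x => F k (N k x))) => [k|x _]; last exact: cF.
move=> _ Y mY; rewrite setTI.
rewrite (_ : _ @^-1` Y =
    \bigcup_(c : C) (N k @^-1` [set c] `&` [set _ | Y (F k c)])).
  apply: countable_bigcupT_measurable => [|c]; first exact: countableP.
  apply: measurableI => //.
  have [h|h] := pselect (Y (F k c)).
    by rewrite (_ : [set _ | _] = setT)//; apply/seteqP; split.
  by rewrite (_ : [set _ | _] = set0)//; apply/seteqP; split.
apply/seteqP; split=> x /=; first by move=> h; exists (N k x).
by move=> [c _ [/= <-]].
Qed.

Definition grid_index k (x : R) : int := Num.floor (k.+1%:R * x).
Definition grid_point k (z : int) : R := z%:~R / k.+1%:R.

Lemma grid_point_near k x : `|x - grid_point k (grid_index k x)| <= k.+1%:R^-1.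
Proof.
have k0 : 0 < k.+1%:R :> R by rewrite ltr0n.
have /andP[h1 h2] := floor_itv (k.+1%:R * x).
rewrite /grid_point /grid_index.
set z := Num.floor _ in h1 h2 *; rewrite ler_norml; apply/andP; split.
  rewrite lerBrDr addrC -lerBrDr opprK addrC.
  apply: (@le_trans _ _ x); last by rewrite lerDr// invr_ge0 ltW.
  by rewrite ler_pdivrMr// mulrC.
rewrite lerBlDr -[X in X + _]mul1r -mulrDl ler_pdivlMr// mulrC.
by move: h2; rewrite intrD addrC => /ltW.
Qed.

Lemma measurable_grid_index k (c : int) :
  measurable (grid_index k @^-1` [set c] : set (measurableTypeR R)).
Proof.
have k0 : 0 < k.+1%:R :> R by rewrite ltr0n.
rewrite (_ : _ @^-1` _ = `[c%:~R / k.+1%:R, (c + 1)%:~R / k.+1%:R[%classic).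
  exact: measurable_itv.
apply/seteqP; split=> x /=.
  move=> <-; rewrite in_itv/= ler_pdivrMr// ltr_pdivlMr// ![x * _]mulrC.
  exact: floor_itv.
rewrite in_itv/= ler_pdivrMr// ltr_pdivlMr// ![x * _]mulrC => h.
by apply/eqP; rewrite /grid_index floor_eq.
Qed.

Lemma cvg_grid (x : R) : grid_point k (grid_index k x) @[k --> \oo] --> x.
Proof.
apply/cvgrPdist_le => e e0.
have h : harmonic k @[k --> \oo] --> (0 : R) by exact: cvg_harmonic.
have /cvgrPdist_le /(_ e e0) := h; apply: filterS => k.
rewrite sub0r normrN => he; apply: le_trans (grid_point_near _ _) _.
by apply: le_trans he; rewrite ler_norm.
Qed.

Lemma cvg_rV (T : Type) (F : set_system T) n (f : T -> 'rV[R]_n) (y : 'rV[R]_n) :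
  Filter F -> (forall i, f x ord0 i @[x --> F] --> y ord0 i) -> f @ F --> y.
Proof.
move=> FF cf; apply/cvgrPdist_le => e e0.
have : \forall x \near F, forall i, `|y ord0 i - f x ord0 i| <= e.
  by apply: filter_forall => i; move/cvgrPdist_le : (cf i) => /(_ e e0).
apply: filterS => x h; rewrite -[leLHS]/(mx_norm _) mx_normrE.
apply: bigmax_le => [|[i j] _ /=]; first exact: ltW.
by rewrite !mxE !ord1.
Qed.

Lemma cvg_grid_rV n (x : 'rV[R]_n) :
  (\row_i grid_point k (grid_index k (x ord0 i))) @[k --> \oo] --> x.
Proof.
by apply: cvg_rV => i; under eq_fun do rewrite mxE; exact: cvg_grid.
Qed.

Lemma continuous_measurable_rV n (f : 'rV[R]_n -> R) :
  continuous f -> measurable_fun [set: 'rV[R]_n] f.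
Proof.
move=> cf; apply: (@measurable_fun_countable_approx _ 'rV[R]_n 'rV[int]_n
  (fun k x => \row_i grid_index k (x ord0 i))
  (fun k w => f (\row_i grid_point k (w ord0 i)))) => [k c|x].
  rewrite (_ : _ @^-1` _ = \big[setI/setT]_(i < n)
      [set x : 'rV[R]_n | grid_index k (x ord0 i) = c ord0 i]).
    apply: bigsetI_measurable => i _.
    rewrite -[X in measurable X]setTI.
    exact: (measurable_rV_coord _ measurableT (measurable_grid_index k (c ord0 i))).
  rewrite -bigcap_seq; apply/seteqP; split=> x /=.
    by move=> <- i _ /=; rewrite mxE.
  move=> h; apply/rowP => i; rewrite mxE; apply: h => /=.
  by rewrite mem_index_enum.
apply: (@continuous_cvg _ _ _ _ _ _ f); first exact: cf.
rewrite (_ : (fun k => _) = (fun k => \row_i grid_point k (grid_index k (x ord0 i)))).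
  exact: cvg_grid_rV.
by apply/funext => k; apply/rowP => i; rewrite !mxE.
Qed.

Lemma continuous_measurable_spacetime n (f : 'rV[R]_n * R -> R) :
  continuous f ->
  measurable_fun [set: 'rV[R]_n * measurableTypeR R] f.
Proof.
move=> cf; apply: (@measurable_fun_countable_approx _
  ('rV[R]_n * measurableTypeR R)%type ('rV[int]_n * int)%type
  (fun k z => (\row_i grid_index k (z.1 ord0 i), grid_index k z.2))
  (fun k w => f (\row_i grid_point k (w.1 ord0 i), grid_point k w.2))) => [k c|z].
  rewrite (_ : _ @^-1` _ = (\big[setI/setT]_(i < n)
      [set x : 'rV[R]_n | grid_index k (x ord0 i) = c.1 ord0 i]) `*`
      (grid_index k @^-1` [set c.2])).
    apply: measurableX; last exact: measurable_grid_index.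
    apply: bigsetI_measurable => i _.
    rewrite -[X in measurable X]setTI.
    exact: (measurable_rV_coord _ measurableT (measurable_grid_index k (c.1 ord0 i))).
  rewrite -bigcap_seq; apply/seteqP; split=> -[x t] /=.
    by move=> <- /=; split=> // i _ /=; rewrite mxE.
  move=> [h ht]; rewrite [RHS]surjective_pairing; congr pair; last exact: ht.
  by apply/rowP => i; rewrite mxE; apply: h => /=; rewrite mem_index_enum.
apply: (@continuous_cvg _ _ _ _ _ _ f); first exact: cf.
rewrite (_ : (fun k => _) = (fun k =>
  (\row_i grid_point k (grid_index k (z.1 ord0 i)), grid_point k (grid_index k z.2)))).
  case: z => x t /=; apply: (@cvg_pair _ _ _ _ (nbhs x) (nbhs t)).
    exact: cvg_grid_rV.
  exact: cvg_grid.
apply/funext => k; congr pair; apply/rowP => i; by rewrite !mxE.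
Qed.

End measurability.

(** * Integrals of derivatives of compactly supported functions *)

Section derivative_integral.
Context {R : realType}.

Lemma is_derive_line (V : normedModType R) (f h : V -> R) (e x : V) :
  (forall y, is_derive y e f (h y)) ->
  forall s : R, is_derive s 1 (fun s => f (s *: e + x)) (h (s *: e + x)).
Proof.
move=> df s; have [Df <-] := df (s *: e + x).
have E : (fun r : R => r^-1 *: (((fun s => f (s *: e + x)) \o shift s) (r *: 1)
             - f (s *: e + x))) =
         (fun r : R => r^-1 *: ((f \o shift (s *: e + x)) (r *: e)
             - f (s *: e + x))).
  by apply/funext => r /=; rewrite [r *: 1]mulr1 scalerDl addrA.
by apply: DeriveDef; [rewrite /derivable E|rewrite /derive E].
Qed.

Lemma integral_derive_compact (f h : R -> R) (M : R) : 0 <= M ->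
  (forall s : R, is_derive s 1 f (h s)) -> continuous h ->
  (forall s, M < `|s| -> f s = 0) -> (forall s, M < `|s| -> h s = 0) ->
  (\int[lebesgue_measure]_s (h s)%:E = 0)%E.
Proof.
move=> M0 df ch f0 h0; pose a := M + 1.
have a0 : 0 < a by rewrite ltr_wpDl.
have -> : (\int[lebesgue_measure]_s (h s)%:E =
    \int[lebesgue_measure]_(s in `[(- a)%R, a]) (h s)%:E)%E.
  rewrite [RHS]integral_mkcond; apply: eq_integral => s _.
  rewrite patchE; case: ifPn => // /negP; rewrite inE /= in_itv/= -ler_norml => ns.
  rewrite h0// (lt_le_trans (_ : M < a))// ?ltrDl// leNgt.
  by apply/negP => /ltW.
have cf : continuous f.
  move=> s; apply: differentiable_continuous; apply/derivable1_diffP.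
  by case: (df s).
rewrite (@continuous_FTC2 _ _ f).
- rewrite !f0 ?subee// ?normrN ger0_norm ?ltrDl// ltW//.
- by rewrite gtrN.
- exact: continuous_subspaceT.
- split=> [s _||]; first by case: (df s).
  + by apply: cvg_at_right_filter; exact: cf.
  + by apply: cvg_at_left_filter; exact: cf.
- by move=> s _; rewrite derive1E; case: (df s).
Qed.

Definition box_supported n (M : R) (f : 'rV[R]_n -> R) :=
  forall x, f x != 0 -> forall i, `|x ord0 i| <= M.

Definition box n (M : R) : set 'rV[R]_n := [set x | forall i, `|x ord0 i| <= M].

Lemma boxE n (M : R) : @box n M =
  [set x | forall i, `[(- M)%R, M]%classic (x ord0 i)].
Proof.
by apply/seteqP; split=> x /= h i; have := h i; rewrite /= in_itv/= ler_norml.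
Qed.

Lemma measurable_box n (M : R) : measurable (@box n M).
Proof.
rewrite (_ : @box n M = \big[setI/setT]_(i < n)
    [set x : 'rV[R]_n | `[(- M)%R, M]%classic (x ord0 i)]).
  apply: bigsetI_measurable => i _; rewrite -[X in measurable X]setTI.
  exact: (measurable_rV_coord _ measurableT (measurable_itv _)).
rewrite boxE -bigcap_seq; apply/seteqP; split=> x /= h i.
  by move=> _; exact: h.
by apply: h => /=; rewrite mem_index_enum.
Qed.

Lemma lebesgue_box_lty n (M : R) : (lebesgue_rV n (@box n M) < +oo)%E.
Proof.
rewrite boxE.
have -> := @lebesgue_rV_box R n (fun=> `[(- M)%R, M]%classic).
  suff /andP[] : (0 <= \prod_(i < n) lebesgue_measure (`[(- M)%R, M]%classic
      : set (measurableTypeR R)) < +oo)%E by [].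
  elim/big_ind: _ => [|x y /andP[x0 xoo] /andP[y0 yoo]|i _].
  - by rewrite lee01 ltry.
  - by rewrite mule_ge0//= lte_mul_pinfty// ge0_fin_numE.
  - rewrite measure_ge0/= lebesgue_measure_itv/=.
    by case: ifP => _; rewrite -?EFinB ltry.
by move=> i; exact: measurable_itv.
Qed.

Lemma compact_box n (M : R) : compact (@box n M).
Proof.
rewrite boxE; apply: (@rV_compact _ _ (fun=> `[(- M)%R, M]%classic)) => i.
exact: segment_compact.
Qed.

Lemma continuous_compact_bounded (T : topologicalType) (f : T -> R) (A : set T) :
  compact A -> continuous f -> [bounded f x | x in A].
Proof.
move=> cA cf; have : compact (f @` A).
  by apply: continuous_compact => //; exact: continuous_subspaceT.
by move/compact_bounded => [M [Mr hM]]; exists M; split => // x Mx y Ay; apply: hM => //; exists y.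
Qed.

Lemma integrable_box_supported n M (h : 'rV[R]_n -> R) :
  continuous h -> box_supported M h ->
  (lebesgue_rV n).-integrable [set: 'rV[R]_n] (EFin \o h).
Proof.
move=> ch sh.
have mh := continuous_measurable_rV ch.
have mB := @measurable_box n M.
have : (lebesgue_rV n).-integrable (@box n M) (EFin \o h).
  apply: measurable_bounded_integrable => //.
  - exact: lebesgue_box_lty.
  - exact: measurable_funTS.
  - by apply: continuous_compact_bounded => //; exact: compact_box.
move/(integrable_mkcond _ mB); apply: eq_integrable => // x _.
rewrite patchE; case: ifPn => //= /negP xB.
have [->//|hx] := eqVneq (h x) 0.
by exfalso; apply: xB; rewrite inE; exact: sh.
Qed.

(** The step of an induction on the dimension: [lebesgue_rV n.+1] is by
    definition the image of a product measure, to which Fubini applies. *)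
Lemma integral_rV_cons n (h : 'rV[R]_n.+1 -> R) M :
  continuous h -> box_supported M h ->
  (\int[lebesgue_rV n.+1]_x (h x)%:E =
   \int[lebesgue_measure \x lebesgue_rV n]_p (h (consrV p))%:E)%E /\
  (lebesgue_measure \x lebesgue_rV n)%E.-integrable setT
     (fun p => (h (consrV p))%:E).
Proof.
move=> ch sh.
have mh := continuous_measurable_rV ch.
have ih := integrable_box_supported ch sh.
have iC : (lebesgue_measure \x lebesgue_rV n)%E.-integrable setT
     (fun p => (h (consrV p))%:E).
  apply/integrableP; split.
    by apply/measurable_EFinP; apply: (measurableT_comp mh); exact: measurable_consrV.
  move/integrableP : ih => [_]; apply: le_lt_trans.
  rewrite [leRHS](_ : _ = \int[pushforward (lebesgue_measure \x lebesgue_rV n)%E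
     (@consrV R n)]_x (`|(h x)%:E|)%E)%E; last first.
    by apply: eq_measure_integral => //; exact: measurable_consrV.
  rewrite ge0_integral_pushforward//.
  - exact: measurable_consrV.
  - by apply: measurableT_comp => //; apply/measurable_EFinP.
split=> //.
rewrite [LHS](_ : _ = \int[pushforward (lebesgue_measure \x lebesgue_rV n)%E
     (@consrV R n)]_x ((h x)%:E)%E)%E; last first.
  by apply: eq_measure_integral => //; exact: measurable_consrV.
rewrite integral_pushforward//; first exact: measurable_consrV.
exact/measurable_EFinP.
Qed.

End derivative_integral.

Section divergence.
Context {R : realType}.

Lemma continuous_line (V : normedModType R) (e x : V) :
  continuous (fun s : R => s *: e + x).
Proof.
move=> s; apply: (@cvgD _ _ _ (nbhs s)); last exact: cvg_cst.
by apply: cvgZr_tmp; exact: cvg_id.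
Qed.

Lemma continuous_consrV n (s : R) : continuous (fun y : 'rV[R]_n => consrV (s, y)).
Proof.
move=> y; apply: (@cvg_rV _ _ (nbhs y)) => i; case: (unliftP ord0 i) => [j ->|->].
  by under eq_fun do rewrite consrVS; rewrite consrVS; exact: coord_continuous.
by under eq_fun do rewrite consrV0; rewrite consrV0; exact: cvg_cst.
Qed.

Lemma consrV_line0 n (s : R) (y : 'rV[R]_n) :
  consrV (s, y) = s *: delta_mx ord0 ord0 + consrV (0, y).
Proof.
apply/rowP => i; rewrite [RHS]mxE [X in _ = X + _]mxE [X in _ = _ * X + _]mxE.
case: (unliftP ord0 i) => [j ->|->].
  by rewrite !consrVS !eqE/= mulr0 add0r.
by rewrite !consrV0 eqxx mulr1 addr0.
Qed.

Lemma consrV_lineS n (s r : R) (x y : 'rV[R]_n) j :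
  consrV (s, r *: delta_mx ord0 j + y) =
  r *: delta_mx ord0 (lift ord0 j) + consrV (s, y).
Proof.
apply/rowP => i; rewrite [RHS]mxE [X in _ = X + _]mxE [X in _ = _ * X + _]mxE.
case: (unliftP ord0 i) => [k ->|->].
  by rewrite !consrVS !mxE (inj_eq lift_inj).
by rewrite !consrV0 !eqE/= mulr0 add0r.
Qed.

Lemma is_derive_consrV n (f : 'rV[R]_n.+1 -> R) s (y : 'rV[R]_n) j l :
  is_derive (consrV (s, y)) (delta_mx ord0 (lift ord0 j)) f l ->
  is_derive y (delta_mx ord0 j) (fun y => f (consrV (s, y))) l.
Proof.
case=> Df <-.
have E : (fun r : R => r^-1 *: (((fun y => f (consrV (s, y))) \o shift y)
      (r *: delta_mx ord0 j) - f (consrV (s, y)))) =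
   (fun r : R => r^-1 *: ((f \o shift (consrV (s, y)))
      (r *: delta_mx ord0 (lift ord0 j)) - f (consrV (s, y)))).
  by apply/funext => r /=; rewrite consrV_lineS.
by apply: DeriveDef; [rewrite /derivable E|rewrite /derive E].
Qed.

(** By induction on [n]: derivatives along the first coordinate are integrated
    by the fundamental theorem of calculus on the lines of that direction,
    the other ones by the induction hypothesis on hyperplanes. *)
Lemma integral_derive_rV n (i : 'I_n) (f h : 'rV[R]_n -> R) M : 0 <= M ->
  continuous h -> (forall x, is_derive x (delta_mx ord0 i) f (h x)) ->
  box_supported M f -> box_supported M h ->
  (\int[lebesgue_rV n]_x (h x)%:E = 0)%E.
Proof.
move=> M0; elim: n i f h => [[]//|n IH] i f h ch df sf sh.
have [-> ih] := integral_rV_cons ch sh.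
case: (unliftP ord0 i) df => [j ->|->] df.
  rewrite -(integral12_prod_meas1 ih); apply: integral0_eq => s _.
  rewrite /fubini_F; apply: (IH j (fun y => f (consrV (s, y)))).
  - by move=> y; apply: continuous_comp; [exact: continuous_consrV|exact: ch].
  - by move=> y; apply: is_derive_consrV; exact: df.
  - by move=> y fy k; have := sf _ fy (lift ord0 k); rewrite consrVS.
  - by move=> y fy k; have := sh _ fy (lift ord0 k); rewrite consrVS.
rewrite -(integral21_prod_meas1 ih); apply: integral0_eq => y _.
rewrite /fubini_G.
have E (g : 'rV[R]_n.+1 -> R) s : g (consrV (s, y)) =
    g (s *: delta_mx ord0 ord0 + consrV (0, y)) by rewrite -consrV_line0.
under eq_integral do rewrite E.
have z0 (g : 'rV[R]_n.+1 -> R) s : box_supported M g -> M < `|s| ->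
    g (s *: delta_mx ord0 ord0 + consrV (0, y)) = 0.
  move=> sg Ms; apply/eqP; apply: contraTT Ms => gs; rewrite -leNgt.
  by have := sg _ gs ord0; rewrite -consrV_line0 consrV0.
apply: (@integral_derive_compact _
  (fun s => f (s *: delta_mx ord0 ord0 + consrV (0, y))) _ M) => //.
- by move=> s; apply: is_derive_line.
- by move=> s; apply: continuous_comp; [exact: continuous_line|exact: ch].
- by move=> s; exact: z0.
- by move=> s; exact: z0.
Qed.

Definition spacetime_supported n (M : R) (f : 'rV[R]_n * R -> R) :=
  forall z, f z != 0 -> (forall i, `|z.1 ord0 i| <= M) /\ `|z.2| <= M.

Lemma compact_spacetime_supported n (S : set ('rV[R]_n * R)) : compact S ->
  exists2 M, 0 <= M & forall f : 'rV[R]_n * R -> R, (forall z, ~ S z -> f z = 0) ->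
    spacetime_supported M f.
Proof.
move=> /compact_bounded [M0 [_ hM]].
have h z : S z -> `|z| <= `|M0| + 1.
  by apply: hM; rewrite ltr_pwDr// ler_norm.
exists (`|M0| + 1); first by rewrite addr_ge0.
move=> f fS z fz.
have Sz : S z by apply/not_notP => /fS fz0; rewrite fz0 eqxx in fz.
have {h} := h z Sz; rewrite prod_normE ge_max => /andP[h1 h2].
split=> // i; apply: le_trans h1.
rewrite -[leRHS]/(mx_norm _) mx_normrE.
exact: (@le_bigmax _ _ _ _ (fun ij => `|z.1 ij.1 ij.2|) (ord0, i)).
Qed.

Lemma integrable_spacetime n M (h : 'rV[R]_n * R -> R) :
  continuous h -> spacetime_supported M h ->
  (@lebesgue_spacetime R n).-integrable setT (EFin \o h).
Proof.
move=> ch sh.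
have mh := continuous_measurable_spacetime ch.
pose B : set ('rV[R]_n * measurableTypeR R) :=
  @box R n M `*` (`[(- M)%R, M]%classic : set (measurableTypeR R)).
have mB : measurable B.
  by apply: measurableX; [exact: measurable_box|exact: measurable_itv].
have : (@lebesgue_spacetime R n).-integrable B (EFin \o h).
  apply: measurable_bounded_integrable => //.
  - rewrite [ltLHS](_ : _ = (lebesgue_rV n) (@box R n M) *
       lebesgue_measure (`[(- M)%R, M]%classic : set (measurableTypeR R)))%E;
      last by apply: product_measure1E; [exact: measurable_box|exact: measurable_itv].
    rewrite lte_mul_pinfty//.
    + by rewrite ge0_fin_numE//; exact: lebesgue_box_lty.
    + by rewrite lebesgue_measure_itv/=; case: ifP => _; rewrite -?EFinB ltry.
  - exact: measurable_funTS.
  - apply: continuous_compact_bounded => //.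
    by apply: compact_setX; [exact: compact_box|exact: segment_compact].
move/(integrable_mkcond _ mB); apply: eq_integrable => // z _.
rewrite patchE; case: ifPn => //= /negP zB.
have [->//|hz] := eqVneq (h z) 0.
exfalso; apply: zB; rewrite inE; have [h1 h2] := sh _ hz.
by split => //=; rewrite in_itv/= -ler_norml.
Qed.

Lemma is_derive_slice_x n (f : 'rV[R]_n * R -> R) x t e l :
  is_derive (x, t) (e, 0) f l -> is_derive x e (fun x => f (x, t)) l.
Proof.
case=> Df <-.
have E : (fun r : R => r^-1 *: (((fun x => f (x, t)) \o shift x) (r *: e)
      - f (x, t))) =
   (fun r : R => r^-1 *: ((f \o shift (x, t)) (r *: (e, 0 : R)) - f (x, t))).
  apply/funext => r /=; congr (_ *: (f _ - _)).
  by congr pair; rewrite /= [_ *: 0]mulr0 add0r.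
by apply: DeriveDef; [rewrite /derivable E|rewrite /derive E].
Qed.

Lemma is_derive_slice_t n (f : 'rV[R]_n * R -> R) x (t l : R) :
  is_derive (x, t) (0, 1) f l -> is_derive t 1 (fun t => f (x, t)) l.
Proof.
case=> Df <-.
have E : (fun r : R => r^-1 *: (((fun t => f (x, t)) \o shift t) (r *: 1)
      - f (x, t))) =
   (fun r : R => r^-1 *: ((f \o shift (x, t)) (r *: (0, 1 : R)) - f (x, t))).
  apply/funext => r /=; congr (_ *: (f _ - _)).
  by congr pair; rewrite /= scaler0 add0r.
by apply: DeriveDef; [rewrite /derivable E|rewrite /derive E].
Qed.

Lemma integral_derive_x n (i : 'I_n) (f h : 'rV[R]_n * R -> R) M : 0 <= M ->
  continuous h -> (forall z : 'rV[R]_n * R, is_derive z (delta_mx ord0 i, 0) f (h z)) ->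
  spacetime_supported M f -> spacetime_supported M h ->
  (\int[lebesgue_spacetime]_z (h z)%:E = 0)%E.
Proof.
move=> M0 ch df sf sh; have ih := integrable_spacetime ch sh.
rewrite -(integral21_prod_meas1 ih); apply: integral0_eq => t _.
apply: (@integral_derive_rV _ i (fun x => f (x, t)) _ M) => //.
- move=> x; apply: (@continuous_comp _ _ _ (fun x => (x, t))); last exact: ch.
  by apply: (@cvg_pair _ _ _ (nbhs x) (nbhs x) (nbhs t)); [exact: cvg_id|exact: cvg_cst].
- by move=> x; apply: is_derive_slice_x; exact: df.
- by move=> x /sf[].
- by move=> x /sh[].
Qed.

Lemma integral_derive_t n (f h : 'rV[R]_n * R -> R) (M : R) : 0 <= M ->
  continuous h -> (forall z : 'rV[R]_n * R, is_derive z (0, 1) f (h z)) ->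
  spacetime_supported M f -> spacetime_supported M h ->
  (\int[lebesgue_spacetime]_z (h z)%:E = 0)%E.
Proof.
move=> M0 ch df sf sh; have ih := integrable_spacetime ch sh.
rewrite -(integral12_prod_meas1 ih); apply: integral0_eq => x _.
apply: (@integral_derive_compact _ (fun t => f (x, t)) _ M) => //.
- by move=> t; apply: is_derive_slice_t; exact: df.
- move=> t; apply: (@continuous_comp _ _ _ (fun t => (x, t))); last exact: ch.
  by apply: (@cvg_pair _ _ _ (nbhs t) (nbhs x) (nbhs t)); [exact: cvg_cst|exact: cvg_id].
- move=> t Mt; apply/eqP; apply: contraTT Mt => /sf[_ /=]; by rewrite leNgt.
- move=> t Mt; apply/eqP; apply: contraTT Mt => /sh[_ /=]; by rewrite leNgt.
Qed.

End divergence.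

(** * Calculus of directional derivatives *)

Lemma subrACA (R : zmodType) (p q r s : R) : p - q - (r - s) = p - r - (q - s).
Proof. by rewrite !opprB addrACA [- q - r]addrC -addrACA. Qed.

Lemma close_trans (R : realFieldType) (e p q r : R) :
  `|p - r| < e / 2 -> `|q - r| < e / 2 -> `|p - q| <= e.
Proof.
by rewrite !ltr_norml ler_norml => /andP[? ?] /andP[? ?]; apply/andP; split; lra.
Qed.

Section directional_calculus.
Context {R : realType} {V : normedModType R}.
Implicit Types (f g : V -> R) (x y z e v w : V).

Lemma is_derive_translate f (a y e : V) l :
  is_derive (a + y) e f l -> is_derive y e (fun y => f (a + y)) l.
Proof.
case=> Df <-.
have E : (fun r : R => r^-1 *: (((fun y => f (a + y)) \o shift y) (r *: e)
      - f (a + y))) =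
   (fun r : R => r^-1 *: ((f \o shift (a + y)) (r *: e) - f (a + y))).
  by apply/funext => r /=; rewrite addrCA.
by apply: DeriveDef; [rewrite /derivable E|rewrite /derive E].
Qed.

Lemma is_derive_add f g z e l l' : is_derive z e f l -> is_derive z e g l' ->
  is_derive z e (fun y => f y + g y) (l + l').
Proof. by move=> df dg; exact: is_deriveD. Qed.

Lemma is_derive_opp f z e l : is_derive z e f l ->
  is_derive z e (fun y => - f y) (- l).
Proof. by move=> df; exact: is_deriveN. Qed.

Lemma is_derive_mul f g z e l l' : is_derive z e f l -> is_derive z e g l' ->
  is_derive z e (fun y => f y * g y) (f z * l' + g z * l).
Proof. by move=> df dg; exact: is_deriveM. Qed.

Lemma is_derive_const (c : R) z e : is_derive z e (fun=> c) 0.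
Proof. exact: is_derive_cst. Qed.

Lemma is_derive_bigsum (I : Type) (r : seq I) (F : I -> V -> R) (l : I -> R) z e :
  (forall i, is_derive z e (F i) (l i)) ->
  is_derive z e (fun y => \sum_(i <- r) F i y) (\sum_(i <- r) l i).
Proof.
move=> dF; elim: r => [|i r IH].
  under eq_fun do rewrite big_nil; rewrite big_nil; exact: is_derive_const.
under eq_fun do rewrite big_cons; rewrite big_cons.
exact: is_derive_add.
Qed.

Lemma is_derive_chain f (k : R -> R) z e l l' : is_derive z e f l ->
  is_derive (f z) 1 k l' -> is_derive z e (fun y => k (f y)) (l * l').
Proof.
case=> /derivable1P Df <- [Dk <-].
pose F (h : R) := f (h *: e + z).
have F0 : F 0 = f z by rewrite /F scale0r add0r.
have E (q : V -> R) : (fun h : R => h^-1 *: ((q \o shift z) (h *: e) - q z)) =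
    (fun h : R => h^-1 *: (((fun h : R => q (h *: e + z)) \o shift 0) (h *: 1)
       - q (0 *: e + z))).
  by apply/funext => h /=; rewrite [h *: 1]mulr1 addr0 scale0r add0r.
have DF : is_derive (0 : R) 1 F ('D_e f z).
  apply: DeriveDef; [exact: Df|]; exact: (congr1 (fun k => lim (k @ 0^')) (esym (E f))).
have Dk' : is_derive (F 0) 1 k ('D_1 k (f z)) by rewrite F0; exact: DeriveDef.
have [DkF DkFE] := @is_derive1_comp _ k F 0 _ _ Dk' DF.
apply: DeriveDef; first exact/derivable1P.
by rewrite mulrC -DkFE /derive E.
Qed.

(** The formulas for the fluxes are only meaningful where [x_1 > 0] and [t > 0];
    this extends them to the whole space, where they vanish off the support. *)
Lemma is_derive_zero_off (S : set V) f (h : V -> R) e : closed S ->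
  (forall z, ~ S z -> f z = 0) -> (forall z, ~ S z -> h z = 0) ->
  (forall z, S z -> is_derive z e f (h z)) -> forall z, is_derive z e f (h z).
Proof.
move=> cS f0 h0 df z; have [/df//|Sz] := pselect (S z).
rewrite h0//; apply: near_eq_is_derive (is_derive_const 0 z e).
have : nbhs z (~` S) by apply: open_nbhs_nbhs; split => //; exact: closed_openC.
by apply: filterS => y /f0 ->.
Qed.

Lemma continuous_zero_off (S : set V) f : closed S ->
  (forall z, ~ S z -> f z = 0) ->
  (forall z, S z -> continuous_at z f) -> continuous f.
Proof.
move=> cS f0 cf z; have [/cf//|Sz] := pselect (S z).
apply: (@near_cst_continuous _ _ 0).
have : nbhs z (~` S) by apply: open_nbhs_nbhs; split => //; exact: closed_openC.
by apply: filterS => y /f0.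
Qed.

Lemma mean_value_line f (h : V -> R) e x (b : R) : 0 < b ->
  (forall y, is_derive y e f (h y)) ->
  exists2 c, 0 < c < b & f (b *: e + x) - f x = h (c *: e + x) * b.
Proof.
move=> b0 df.
have dg s := is_derive_line x df s.
have [|c cb E] := MVT b0 (fun s _ => dg s).
  apply: continuous_subspaceT => s; apply: differentiable_continuous.
  by apply/derivable1_diffP; case: (dg s).
exists c; first by move: cb; rewrite in_itv.
by move: E; rewrite scale0r add0r subr0.
Qed.

(** Two applications of the mean value theorem to a quantity that is symmetric
    in [v] and [w]; comparing both ways of doing it gives [derive_commute]. *)
Lemma second_difference f v w x (h : R) : 0 < h ->
  (forall y, derivable f y v) -> (forall y, derivable ('D_v f) y w) ->
  exists c c', [/\ 0 < c < h, 0 < c' < h &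
   f (h *: w + (h *: v + x)) - f (h *: v + x) - (f (h *: w + x) - f x) =
   'D_w ('D_v f) (c' *: w + (c *: v + x)) * h * h].
Proof.
move=> h0 dv dwv.
have df y : is_derive y v (fun y => f (h *: w + y) - f y)
    ('D_v f (h *: w + y) - 'D_v f y).
  apply: is_derive_add; first by apply: is_derive_translate; exact: derivableP.
  by apply: is_derive_opp; exact: derivableP.
have [c c0 ->] := mean_value_line x h0 df.
have [c' c'0 ->] := mean_value_line (c *: v + x) h0 (fun y => derivableP (dwv y)).
by exists c, c'.
Qed.

Lemma derive_commute f v w x :
  (forall y, derivable f y v) -> (forall y, derivable f y w) ->
  (forall y, derivable ('D_v f) y w) -> (forall y, derivable ('D_w f) y v) ->
  continuous ('D_w ('D_v f)) -> continuous ('D_v ('D_w f)) ->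
  'D_w ('D_v f) x = 'D_v ('D_w f) x.
Proof.
move=> dv dw dwv dvw cwv cvw; apply/eqP; rewrite -subr_eq0 -normr_le0.
apply/ler_addgt0Pl => e e0; rewrite addr0.
have e2 : 0 < e / 2 by rewrite divr_gt0.
have [d1 /= d10 H1] : nbhs_ball x [set y | `|'D_w ('D_v f) x - 'D_w ('D_v f) y| < e / 2].
  by apply/nbhs_ballP; move/cvgrPdist_lt : (cwv x) => /(_ _ e2).
have [d2 /= d20 H2] : nbhs_ball x [set y | `|'D_v ('D_w f) x - 'D_v ('D_w f) y| < e / 2].
  by apply/nbhs_ballP; move/cvgrPdist_lt : (cvw x) => /(_ _ e2).
pose d := Num.min d1 d2; have d0 : 0 < d by rewrite lt_min d10 d20.
pose k := `|v| + `|w| + 1.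
have k0 : 0 < k by rewrite ltr_wpDl// addr_ge0.
pose h := d / k; have h0 : 0 < h by rewrite divr_gt0.
have near (c c' : R) (p q : V) : 0 < c < h -> 0 < c' < h -> `|p| + `|q| + 1 = k ->
    `|x - (c' *: q + (c *: p + x))| < d.
  move=> /andP[c0 ch] /andP[c'0 c'h] pq.
  rewrite addrA opprD addrCA subrr addr0 normrN.
  apply: (le_lt_trans (ler_normD _ _)); rewrite !normrZ !gtr0_norm//.
  have -> : d = h * `|q| + h * `|p| + h.
    by rewrite -[d](divfK (lt0r_neq0 k0)) -/h -[in LHS]pq; ring.
  rewrite ltr_pwDr// lerD// ler_wpM2r// ltW//.
have [c [c' [c0 c'0 E1]]] := second_difference x h0 dv dwv.
have [g [g' [g0 g'0 E2]]] := second_difference x h0 dw dvw.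
have E : 'D_w ('D_v f) (c' *: w + (c *: v + x)) = 'D_v ('D_w f) (g' *: v + (g *: w + x)).
  apply: (mulIf (lt0r_neq0 h0)); apply: (mulIf (lt0r_neq0 h0)).
  apply: etrans (esym E1) _; apply: etrans E2; apply: etrans (subrACA _ _ _ _) _.
  by congr (f _ - _ - _); exact: addrCA.
have /= B1 := H1 (c' *: w + (c *: v + x)).
have /= B2 := H2 (g' *: v + (g *: w + x)).
have {}B1 : `|'D_w ('D_v f) x - 'D_w ('D_v f) (c' *: w + (c *: v + x))| < e / 2.
  by apply: B1; rewrite -ball_normE /=; apply: (@lt_le_trans _ _ d);
    [exact: near|rewrite ge_min lexx].
have {}B2 : `|'D_v ('D_w f) x - 'D_v ('D_w f) (g' *: v + (g *: w + x))| < e / 2.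
  apply: B2; rewrite -ball_normE /=; apply: (@lt_le_trans _ _ d).
    exact: (near g g' w v g0 g'0 (congr1 (fun r : R => r + 1) (addrC `|w| `|v|))).
  by rewrite ge_min lexx orbT.
rewrite E in B1; exact: close_trans B1 B2.
Qed.

End directional_calculus.

Section pointwise_calculus.
Context {R : realType} {V : normedModType R}.
Implicit Types (f g : V -> R) (z e : V).

Lemma is_derive_affine f z e (l : R) :
  (forall r : R, f (r *: e + z) = f z + r * l) -> is_derive z e f l.
Proof.
move=> fE.
have L : (fun r : R => r^-1 *: ((f \o shift z) (r *: e) - f z)) @ 0^' --> l.
  apply: cvg_near_cst; near=> r.
  rewrite /= fE addrC addKr [_ *: _]mulKf//.
  by near: r; exact: nbhs_dnbhs_neq.
apply: DeriveDef; first by apply/cvg_ex; exists l.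
exact/cvg_lim.
Unshelve. all: by end_near. Qed.

Lemma is_derive_expR_comp f z e l : is_derive z e f l ->
  is_derive z e (fun y => expR (f y)) (expR (f z) * l).
Proof. by move=> df; rewrite mulrC; apply: is_derive_chain. Qed.

Lemma is_derive_powR_comp f p z e l : 0 < f z -> is_derive z e f l ->
  is_derive z e (fun y => f y `^ p) (p * f z `^ (p - 1) * l).
Proof.
move=> f0 df; rewrite mulrC.
by apply: (@is_derive_chain _ _ f (fun r => r `^ p)) => //; exact: is_derive1_powR.
Qed.

Lemma is_derive_inv f z e l : f z != 0 -> is_derive z e f l ->
  is_derive z e (fun y => (f y)^-1) (- (f z)^-1 ^+ 2 * l).
Proof.
move=> f0 [df <-]; apply: DeriveDef; first exact: derivableV.
by rewrite deriveV// exprVn.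
Qed.

Lemma for_continuousD f g z : continuous_at z f -> continuous_at z g ->
  continuous_at z (fun y => f y + g y).
Proof. by move=> cf cg; exact: (@cvgD _ _ _ (nbhs z) _ f g). Qed.

Lemma for_continuousM f g z : continuous_at z f -> continuous_at z g ->
  continuous_at z (fun y => f y * g y).
Proof. by move=> cf cg; exact: (@cvgM _ _ (nbhs z) _ f g). Qed.

Lemma for_continuousN f z : continuous_at z f ->
  continuous_at z (fun y => - f y).
Proof. by move=> cf; exact: (@cvgN _ _ _ (nbhs z) _ f). Qed.

Lemma for_continuous_cst (c : R) z : continuous_at z (fun _ : V => c).
Proof. exact: cvg_cst. Qed.

Lemma for_continuousX f z k : continuous_at z f ->
  continuous_at z (fun y => f y ^+ k).
Proof.
move=> cf; elim: k => [|k IH]; first exact: for_continuous_cst.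
by under eq_fun do rewrite exprS; exact: for_continuousM.
Qed.

Lemma for_continuous_sum (I : Type) (r : seq I) (F : I -> V -> R) z :
  (forall i, continuous_at z (F i)) ->
  continuous_at z (fun y => \sum_(i <- r) F i y).
Proof.
move=> cF; elim: r => [|i r IH].
  by under eq_fun do rewrite big_nil; exact: for_continuous_cst.
by under eq_fun do rewrite big_cons; exact: for_continuousD.
Qed.

Lemma for_continuous_powR f p z : 0 < f z -> continuous_at z f ->
  continuous_at z (fun y => f y `^ p).
Proof.
move=> f0 cf; apply: (@continuous_comp _ _ _ f (fun r => r `^ p) z cf).
apply: differentiable_continuous; apply/derivable1_diffP.
by case: (@is_derive1_powR _ p (f z) f0).
Qed.

Lemma for_continuous_expR f z : continuous_at z f ->
  continuous_at z (fun y => expR (f y)).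
Proof.
move=> cf; apply: (@continuous_comp _ _ _ f expR z cf); exact: continuous_expR.
Qed.

Lemma for_continuousV f z : f z != 0 -> continuous_at z f ->
  continuous_at z (fun y => (f y)^-1).
Proof. by move=> f0 cf; exact: (@cvgV _ _ (nbhs z) _ f _ f0 cf). Qed.

End pointwise_calculus.

(** The rule is selected by the syntax of the function, because unification up
    to conversion would unfold numerals and definitions. *)
Ltac continuity leaf := lazymatch goal with
  | |- continuous_at _ (fun _ => ?c) => exact: for_continuous_cst
  | |- continuous_at _ (fun y => @GRing.add _ (@?f y) (@?g y)) =>
      apply: for_continuousD; continuity leaf
  | |- continuous_at _ (fun y => @GRing.opp _ (@?f y)) =>
      apply: for_continuousN; continuity leaf
  | |- continuous_at _ (fun y => @GRing.mul _ (@?f y) (@?g y)) =>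
      apply: for_continuousM; continuity leaf
  | |- continuous_at _ (fun y => @GRing.exp _ (@?f y) _) =>
      apply: for_continuousX; continuity leaf
  | |- _ => leaf
  end.

(** * Combinations of x_1^k |x|^(2p) *)

Section monomials.
Context {R : realType} {d : nat}.
Local Notation n := d.+1.
Local Notation V := ('rV[R]_n * R)%type.
Implicit Types (x : 'rV[R]_n) (z e : V) (l : seq (R * R * R)).

Definition sqnorm x : R := \sum_i x ord0 i ^+ 2.

(** The triple [(c, k, p)] stands for [c x_1^k |x|^(2p)].  The span of these
    functions is stable under the Laplacian, which makes derivatives of any
    order of the phase explicit. *)
Definition mono_eval l x : R :=
  \sum_(u <- l) u.1.1 * x ord0 ord0 `^ u.1.2 * sqnorm x `^ u.2.

(** The formal derivative with respect to [x_1] and twice the one with respect to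
    [|x|^2], taken as independent variables: the gradient of [mono_eval l] is
    [mono_eval (mono_dx1 l) e_1 + mono_eval (mono_dsq l) x]. *)
Definition mono_dx1 l := [seq (u.1.1 * u.1.2, u.1.2 - 1, u.2) | u <- l].
Definition mono_dsq l := [seq (2 * u.1.1 * u.2, u.1.2, u.2 - 1) | u <- l].
Definition mono_lap l :=
  mono_dx1 (mono_dx1 l)
  ++ [seq (2 * u.1.1, u.1.2 + 1, u.2) | u <- mono_dx1 (mono_dsq l)]
  ++ [seq (n%:R * u.1.1, u.1.2, u.2) | u <- mono_dsq l]
  ++ [seq (u.1.1, u.1.2, u.2 + 1) | u <- mono_dsq (mono_dsq l)].

Definition dir_x (i : 'I_n) : V := (delta_mx ord0 i, 0).
Definition dir_t : V := (0, 1).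

Definition kdelta (i j : 'I_n) : R := (i == j)%:R.

Lemma is_derive_coord z e i : is_derive z e (fun y : V => y.1 ord0 i) (e.1 ord0 i).
Proof. by apply: is_derive_affine => r; rewrite /= !mxE addrC. Qed.

Lemma is_derive_time z e : is_derive z e (fun y : V => y.2) e.2.
Proof. by apply: is_derive_affine => r; rewrite /= addrC. Qed.

Lemma is_derive_sqnorm z e : is_derive z e (fun y : V => sqnorm y.1)
  (2 * \sum_i z.1 ord0 i * e.1 ord0 i).
Proof.
rewrite /sqnorm mulr_sumr.
apply: (@is_derive_bigsum _ _ _ _ (fun i (y : V) => y.1 ord0 i ^+ 2)) => i.
apply: is_derive_eq; first by apply: is_derive_mul; exact: is_derive_coord.
by rewrite mulr2n mulrDl mul1r.
Qed.

Lemma sqnorm_gt0 x : 0 < x ord0 ord0 -> 0 < sqnorm x.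
Proof.
move=> x0; rewrite /sqnorm big_ord_recl ltr_pwDl ?exprn_gt0//.
by apply: sumr_ge0 => i _; exact: sqr_ge0.
Qed.

Lemma is_derive_mono_eval l z e : 0 < z.1 ord0 ord0 ->
  is_derive z e (fun y : V => mono_eval l y.1)
    (e.1 ord0 ord0 * mono_eval (mono_dx1 l) z.1
     + (\sum_i z.1 ord0 i * e.1 ord0 i) * mono_eval (mono_dsq l) z.1).
Proof.
move=> x0; have r0 := sqnorm_gt0 x0.
rewrite /mono_eval !big_map !mulr_sumr -big_split /=.
apply: (@is_derive_bigsum _ _ _ _ (fun (u : R * R * R) (y : V) =>
  u.1.1 * y.1 ord0 ord0 `^ u.1.2 * sqnorm y.1 `^ u.2)) => -[[c k] p] /=.
apply: is_derive_eq.
  apply: is_derive_mul; last first.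
    by apply: is_derive_powR_comp => //; exact: is_derive_sqnorm.
  apply: is_derive_mul.
  by apply: is_derive_powR_comp => //; exact: is_derive_coord.
by rewrite /=; ring.
Qed.

Lemma dir_xE i j : (dir_x i).1 ord0 j = kdelta j i.
Proof. by rewrite /= mxE eqxx. Qed.

Lemma sum_dir_xE x i : \sum_j x ord0 j * (dir_x i).1 ord0 j = x ord0 i.
Proof.
rewrite (bigD1 i)//= dir_xE /kdelta eqxx mulr1 big1 ?addr0// => j ji.
by rewrite mxE eqxx (negbTE ji) mulr0.
Qed.

Lemma is_derive_mono_eval_x l z i : 0 < z.1 ord0 ord0 ->
  is_derive z (dir_x i) (fun y : V => mono_eval l y.1)
    (kdelta ord0 i * mono_eval (mono_dx1 l) z.1 + z.1 ord0 i * mono_eval (mono_dsq l) z.1).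
Proof.
by move=> x0; apply: is_derive_eq; [exact: is_derive_mono_eval|rewrite sum_dir_xE dir_xE].
Qed.

Lemma is_derive_mono_eval_t l z : 0 < z.1 ord0 ord0 ->
  is_derive z dir_t (fun y : V => mono_eval l y.1) 0.
Proof.
move=> x0; apply: is_derive_eq; first exact: is_derive_mono_eval.
rewrite /= mxE mul0r add0r big1 ?mul0r// => i _.
by rewrite mxE mulr0.
Qed.

Lemma continuous_coord z i : continuous_at z (fun y : V => y.1 ord0 i).
Proof.
apply: (@continuous_comp _ _ _ (fun y : V => y.1) (fun x => x ord0 i)).
  exact: cvg_fst.
exact: coord_continuous.
Qed.

Lemma continuous_time z : continuous_at z (fun y : V => y.2).
Proof. exact: cvg_snd. Qed.

Lemma continuous_sqnorm z : continuous_at z (fun y : V => sqnorm y.1).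
Proof.
apply: (@for_continuous_sum _ _ _ _ (fun i (y : V) => y.1 ord0 i ^+ 2)) => i.
by apply: for_continuousX; exact: continuous_coord.
Qed.

Lemma continuous_mono_eval l z : 0 < z.1 ord0 ord0 ->
  continuous_at z (fun y : V => mono_eval l y.1).
Proof.
move=> x0; have r0 := sqnorm_gt0 x0.
apply: (@for_continuous_sum _ _ _ _ (fun (u : R * R * R) (y : V) =>
  u.1.1 * y.1 ord0 ord0 `^ u.1.2 * sqnorm y.1 `^ u.2)) => -[[c k] p] /=.
apply: for_continuousM; last by apply: for_continuous_powR => //; exact: continuous_sqnorm.
apply: for_continuousM; first exact: for_continuous_cst.
by apply: for_continuous_powR => //; exact: continuous_coord.
Qed.

Lemma mono_dC l : mono_dx1 (mono_dsq l) = mono_dsq (mono_dx1 l).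
Proof.
rewrite /mono_dx1 /mono_dsq -!map_comp; apply: eq_map => -[[c k] p] /=.
by congr (_, _, _); ring.
Qed.

Lemma mono_eval_cat l l' x : mono_eval (l ++ l') x = mono_eval l x + mono_eval l' x.
Proof. by rewrite /mono_eval big_cat. Qed.

Lemma mono_eval_scale (c : R) l x :
  mono_eval [seq (c * u.1.1, u.1.2, u.2) | u <- l] x = c * mono_eval l x.
Proof.
by rewrite /mono_eval big_map mulr_sumr; apply: eq_bigr => u _ /=; rewrite !mulrA.
Qed.

Lemma mono_eval_lap l x : 0 < x ord0 ord0 ->
  mono_eval (mono_lap l) x = mono_eval (mono_dx1 (mono_dx1 l)) x
    + 2 * x ord0 ord0 * mono_eval (mono_dx1 (mono_dsq l)) x
    + n%:R * mono_eval (mono_dsq l) x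
    + sqnorm x * mono_eval (mono_dsq (mono_dsq l)) x.
Proof.
move=> x0; have r0 := sqnorm_gt0 x0.
rewrite /mono_lap !mono_eval_cat mono_eval_scale !addrA; congr (_ + _ + _ + _).
  rewrite /mono_eval big_map mulr_sumr; apply: eq_bigr => u _ /=.
  rewrite (@powRD _ (x ord0 ord0) u.1.2 1) ?(lt0r_neq0 x0) ?implybT//.
  by rewrite powRr1 ?ltW//; ring.
rewrite /mono_eval big_map mulr_sumr; apply: eq_bigr => u _ /=.
rewrite (@powRD _ (sqnorm x) u.2 1) ?(lt0r_neq0 r0) ?implybT//.
by rewrite powRr1 ?ltW//; ring.
Qed.

Definition homog (D : R) l := all (fun u : R * R * R => u.1.2 + 2 * u.2 == D) l.

Lemma homog_dx1 D l : homog D l -> homog (D - 1) (mono_dx1 l).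
Proof.
rewrite /homog /mono_dx1 all_map; apply: sub_all => -[[c k] p] /= /eqP <-.
by apply/eqP; ring.
Qed.

Lemma homog_dsq D l : homog D l -> homog (D - 2) (mono_dsq l).
Proof.
rewrite /homog /mono_dsq all_map; apply: sub_all => -[[c k] p] /= /eqP <-.
by apply/eqP; ring.
Qed.

Lemma homog_scale D c l : homog D l ->
  homog D [seq (c * u.1.1, u.1.2, u.2) | u <- l].
Proof. by rewrite /homog all_map; apply: sub_all. Qed.

Lemma homog_cat D l l' : homog D l -> homog D l' -> homog D (l ++ l').
Proof. by rewrite /homog all_cat => -> ->. Qed.

Lemma homog_lap D l : homog D l -> homog (D - 2) (mono_lap l).
Proof.
move=> hl; rewrite /mono_lap; apply: homog_cat.
  have -> : D - 2 = D - 1 - 1 by ring.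
  by do 2 apply: homog_dx1.
apply: homog_cat.
  have : homog (D - 2 - 1) (mono_dx1 (mono_dsq l)) by apply/homog_dx1/homog_dsq.
  rewrite {2}/homog all_map; apply: sub_all => -[[c k] p] /= /eqP h.
  by apply/eqP; lra.
apply: homog_cat; first exact/homog_scale/homog_dsq.
have : homog (D - 2 - 2) (mono_dsq (mono_dsq l)) by do 2 apply: homog_dsq.
rewrite {2}/homog all_map; apply: sub_all => -[[c k] p] /= /eqP h.
by apply/eqP; lra.
Qed.

Lemma sqnormE x : sqnorm x = enorm x ^+ 2.
Proof.
by rewrite /enorm sqr_sqrtr//; apply: sumr_ge0 => i _; exact: sqr_ge0.
Qed.

Lemma enorm_ge0 x : 0 <= enorm x. Proof. exact: sqrtr_ge0. Qed.

Lemma le_enorm x i : x ord0 i <= enorm x.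
Proof.
apply: (le_trans (ler_norm _)); rewrite -sqrtr_sqr ler_wsqrtr//.
by rewrite (bigD1 i)//= lerDl; apply: sumr_ge0 => j _; exact: sqr_ge0.
Qed.

(** In the cone [x_1 / |x|] stays in [[eps, 1]], so that a homogeneous
    combination is controlled by the corresponding power of [|x|], whatever the
    signs of the exponents. *)
Lemma mono_eval_bound (D eps : R) l : 0 < eps <= 1 -> homog D l ->
  exists2 C, 0 <= C & forall x, 0 < x ord0 ord0 -> eps * enorm x <= x ord0 ord0 ->
    `|mono_eval l x| <= C * enorm x `^ D.
Proof.
move=> /andP[e0 e1]; elim: l => [|[[c k] p] l IH].
  by move=> _; exists 0 => // x _ _; rewrite /mono_eval big_nil normr0 mul0r.
rewrite /homog /= => /andP[/eqP hD /IH[C C0 HC]].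
exists (`|c| * (1 + eps `^ k) + C).
  by rewrite addr_ge0// mulr_ge0// addr_ge0// powR_ge0.
move=> x x0 xcone; rewrite /mono_eval big_cons /=; apply: le_trans (ler_normD _ _) _.
rewrite mulrDl lerD//; last exact: HC.
have r0 : 0 < enorm x by apply: lt_le_trans x0 (le_enorm x ord0).
rewrite sqnormE -powR_mulrn ?enorm_ge0// -powRrM -hD.
rewrite (@powRD _ (enorm x)) ?(lt0r_neq0 r0) ?implybT//.
rewrite !normrM [`|enorm x `^ _|]ger0_norm ?powR_ge0// mulrA ler_wpM2r ?powR_ge0//.
rewrite -mulrA ler_wpM2l// ger0_norm ?powR_ge0//.
have -> : x ord0 ord0 = (x ord0 ord0 / enorm x) * enorm x by rewrite divfK ?gt_eqF.
set q := _ / _; have q1 : q <= 1 by rewrite /q ler_pdivrMr// mul1r le_enorm.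
have qe : eps <= q by rewrite /q ler_pdivlMr.
have q0 : 0 < q by apply: lt_le_trans qe.
rewrite powRM ?(ltW q0) ?(ltW r0)// ler_wpM2r ?powR_ge0//.
have [k0|k0] := leP 0 k.
  rewrite (le_trans (_ : _ <= 1)) ?lerDl ?powR_ge0//.
  have := @ge0_ler_powR R k k0 q 1; rewrite !nnegrE powR1; apply => //; exact: ltW.
rewrite (le_trans (_ : _ <= eps `^ k)) ?lerDr//.
rewrite -[k]opprK !(powRN _ (- k)) lef_pV2 ?posrE ?powR_gt0//.
by apply: ge0_ler_powR => //; rewrite ?nnegrE ?oppr_ge0; exact: ltW.
Qed.

End monomials.

(** * The divergence identity *)

Section divergence_algebra.
Context {R : comRingType} (n : nat).
Implicit Types (p xi xt gx mx mxx : 'I_n -> R) (H Z : 'I_n -> 'I_n -> R).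

Lemma sum_flux_derivatives p xi xt gx mx mxx (tx nx : 'I_n -> R) H Z (v vt G M T N : R) :
  \sum_i (2 * (Z i i * vt + xi i * xt i) - 4 * (Z i i * T + xi i * tx i)
      + 2 * (H i i * N + p i * nx i)
      - 2 * (gx i * p i * v ^+ 2 + G * H i i * v ^+ 2 + 2 * G * p i * v * xi i)
      + 2 * (mx i * v * xi i + M * xi i * xi i + M * v * Z i i)
      - (mxx i * v ^+ 2 + 2 * mx i * v * xi i)) =
  (2 * vt - 4 * T + 2 * M * v) * (\sum_i Z i i) + 2 * (\sum_i xi i * xt i)
  + (- 4) * (\sum_i xi i * tx i) + (2 * N - 2 * G * v ^+ 2) * (\sum_i H i i)
  + 2 * (\sum_i p i * nx i) + (- 2 * v ^+ 2) * (\sum_i gx i * p i)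
  + (- 4 * G * v) * (\sum_i p i * xi i) + 2 * M * (\sum_i xi i * xi i)
  + (- v ^+ 2) * (\sum_i mxx i).
Proof.
by rewrite !mulr_sumr -!big_split; apply: eq_bigr => i _ /=; ring.
Qed.

(** The pointwise form of the commutator computation.  At a given point [p] and
    [H] are the gradient and Hessian of the phase, [xi] and [Z] those of [v],
    [xt] the time derivative of [xi], and [M = F - tr H].  The subtracted sum is
    the divergence of the flux, expanded by the Leibniz rule ([dspace_flux] and
    [dtime_flux] below). *)
Lemma divergence_identity p xi xt gx mx mxx H Z (v vt G Gt M : R) :
  (forall i j, H i j = H j i) -> (forall i j, Z i j = Z j i) ->
  let T := \sum_j p j * xi j in
  let N := \sum_j xi j * xi j in
  let tx i := \sum_j (p j * Z j i + xi j * H j i) in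
  let nx i := 2 * \sum_j xi j * Z j i in
  let nt := 2 * \sum_j xi j * xt j in
  let F := \sum_i H i i + M in
  2 * (\sum_i Z i i + G * v) * (vt - 2 * T + M * v)
  - (\sum_i (2 * (Z i i * vt + xi i * xt i) - 4 * (Z i i * T + xi i * tx i)
      + 2 * (H i i * N + p i * nx i)
      - 2 * (gx i * p i * v ^+ 2 + G * H i i * v ^+ 2 + 2 * G * p i * v * xi i)
      + 2 * (mx i * v * xi i + M * xi i * xi i + M * v * Z i i)
      - (mxx i * v ^+ 2 + 2 * mx i * v * xi i))
     + (Gt * v ^+ 2 + 2 * G * v * vt - nt))
  = 4 * (\sum_i \sum_j H i j * xi i * xi j) - 2 * F * N
    + v ^+ 2 * (2 * G * F + 2 * (\sum_i gx i * p i) - Gt + \sum_i mxx i).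
Proof.
move=> Hs Zs T N tx nx nt F.
have hT : \sum_i xi i * tx i =
    \sum_i \sum_j p i * (xi j * Z j i) + \sum_i \sum_j H i j * xi i * xi j.
  under eq_bigr => i _ do rewrite mulr_sumr; rewrite [in RHS]exchange_big -big_split.
  apply: eq_bigr => i _; rewrite -big_split; apply: eq_bigr => j _ /=.
  by rewrite (Hs j i) (Zs j i); ring.
have hN : \sum_i p i * nx i = 2 * \sum_i \sum_j p i * (xi j * Z j i).
  rewrite mulr_sumr; apply: eq_bigr => i _; rewrite /nx mulrCA -mulr_sumr.
  by congr (_ * _).
rewrite sum_flux_derivatives.
by rewrite hT hN -/T -/N /nt /F; ring.
Qed.

End divergence_algebra.

(** * The phase and the conjugated function *)

Section flux_calculus.
Context {R : realType} {V : normedModType R}.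
Implicit Types (f g : V -> R) (z e : V).

Lemma is_derive_weighted (P f : V -> R) z e dP df :
  is_derive z e P dP -> is_derive z e f df ->
  is_derive z e (fun y => expR (P y) * f y) (expR (P z) * (df + dP * f z)).
Proof.
move=> hP hf; apply: is_derive_eq.
  by apply: is_derive_mul => //; exact: is_derive_expR_comp.
by rewrite /=; ring.
Qed.

Lemma is_derive_twisted (f p u : V -> R) z e df dp du :
  is_derive z e f df -> is_derive z e p dp -> is_derive z e u du ->
  is_derive z e (fun y => f y + p y * u y) (df + p z * du + dp * u z).
Proof.
move=> hf hp hu.
apply: is_derive_eq (is_derive_add hf (is_derive_mul hp hu)) _.
by rewrite /=; ring.
Qed.

Lemma is_derive_flux_form_x (xi w T p N G v M Mx : V -> R) z e
    dxi dw dT dp dN dG dv dM dMx :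
  is_derive z e xi dxi -> is_derive z e w dw -> is_derive z e T dT ->
  is_derive z e p dp -> is_derive z e N dN -> is_derive z e G dG ->
  is_derive z e v dv -> is_derive z e M dM -> is_derive z e Mx dMx ->
  is_derive z e (fun y => 2 * (xi y * w y) + - (4 * (xi y * T y))
    + 2 * (p y * N y) + - (2 * (G y * (p y * (v y * v y))))
    + 2 * (M y * (v y * xi y)) + - (Mx y * (v y * v y)))
  (2 * (dxi * w z + xi z * dw) - 4 * (dxi * T z + xi z * dT)
   + 2 * (dp * N z + p z * dN)
   - 2 * (dG * p z * v z ^+ 2 + G z * dp * v z ^+ 2 + 2 * G z * p z * v z * dv)
   + 2 * (dM * v z * xi z + M z * dv * xi z + M z * v z * dxi)
   - (dMx * v z ^+ 2 + 2 * Mx z * v z * dv)).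
Proof.
move=> h1 h2 h3 h4 h5 h6 h7 h8 h9; apply: is_derive_eq.
  repeat first [eassumption | exact: is_derive_const | apply: is_derive_add
    | apply: is_derive_opp | apply: is_derive_mul].
by rewrite /GRing.scale /=; ring.
Qed.

Lemma is_derive_flux_form_t (N G v : V -> R) z e dN dG dv :
  is_derive z e N dN -> is_derive z e G dG -> is_derive z e v dv ->
  is_derive z e (fun y => G y * (v y * v y) + - N y)
    (dG * v z ^+ 2 + 2 * G z * v z * dv - dN).
Proof.
move=> h1 h2 h3; apply: is_derive_eq.
  repeat first [eassumption | apply: is_derive_add
    | apply: is_derive_opp | apply: is_derive_mul].
by rewrite /GRing.scale /=; ring.
Qed.

End flux_calculus.

Section phase.
Context {R : realType} {d : nat}.
Local Notation n := d.+1.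
Local Notation V := ('rV[R]_n * R)%type.
Local Notation kdelta := (@kdelta R d).
Local Notation dir_x := (@dir_x R d).
Local Notation dir_t := (@dir_t R d).
Local Notation mono_lap := (@mono_lap R d).
Implicit Types (x : 'rV[R]_n) (z e : V) (l : seq (R * R * R)) (i j : 'I_n) (t : R).

Definition mono_grad l i x : R :=
  kdelta ord0 i * mono_eval (mono_dx1 l) x + x ord0 i * mono_eval (mono_dsq l) x.

(** Apart from the multiple [mono_eval (mono_dsq l) x] of the identity, this
    Hessian only involves [e_1] and [x]. *)
Definition mono_hess l i j x : R :=
  kdelta ord0 i * (kdelta ord0 j * mono_eval (mono_dx1 (mono_dx1 l)) x
    + x ord0 j * mono_eval (mono_dx1 (mono_dsq l)) x)
  + x ord0 i * (kdelta ord0 j * mono_eval (mono_dx1 (mono_dsq l)) x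
    + x ord0 j * mono_eval (mono_dsq (mono_dsq l)) x)
  + kdelta i j * mono_eval (mono_dsq l) x.

Lemma kdeltaii i : kdelta i i = 1.
Proof. by rewrite /kdelta eqxx. Qed.

Lemma kdeltaC i j : kdelta i j = kdelta j i.
Proof. by rewrite /kdelta eq_sym. Qed.

Lemma mono_hessC l i j x : mono_hess l i j x = mono_hess l j i x.
Proof. by rewrite /mono_hess (kdeltaC i j); ring. Qed.

Lemma sum_kdelta i (F : 'I_n -> R) : \sum_j kdelta i j * F j = F i.
Proof.
rewrite (bigD1 i)//= /kdelta eqxx mul1r big1 ?addr0// => j ji.
by rewrite eq_sym (negbTE ji) mul0r.
Qed.

Lemma mono_hess_trace l x : 0 < x ord0 ord0 ->
  \sum_i mono_hess l i i x = mono_eval (mono_lap l) x.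
Proof.
move=> x0; rewrite mono_eval_lap//.
set A := mono_eval (mono_dx1 (mono_dx1 l)) x; set B := mono_eval (mono_dx1 (mono_dsq l)) x.
set C := mono_eval (mono_dsq (mono_dsq l)) x; set D := mono_eval (mono_dsq l) x.
have -> : n%:R * D = \sum_(i < n) D by rewrite sumr_const card_ord mulr_natl.
have -> : A + 2 * x ord0 ord0 * B =
    \sum_i kdelta ord0 i * (kdelta ord0 i * A + 2 * x ord0 i * B).
  by rewrite sum_kdelta kdeltaii mul1r.
rewrite /sqnorm mulr_suml -!big_split /=; apply: eq_bigr => i _.
by rewrite /mono_hess -/A -/B -/C -/D kdeltaii; ring.
Qed.

Lemma sum_hess l x (F : 'I_n -> R) :
  \sum_i \sum_j mono_hess l i j x * F i * F j =
  mono_eval (mono_dx1 (mono_dx1 l)) x * F ord0 ^+ 2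
  + 2 * mono_eval (mono_dx1 (mono_dsq l)) x * F ord0 * (\sum_i x ord0 i * F i)
  + mono_eval (mono_dsq (mono_dsq l)) x * (\sum_i x ord0 i * F i) ^+ 2
  + mono_eval (mono_dsq l) x * \sum_i F i * F i.
Proof.
rewrite /mono_hess; move: (mono_eval (mono_dx1 (mono_dx1 l)) x)
  (mono_eval (mono_dx1 (mono_dsq l)) x) (mono_eval (mono_dsq (mono_dsq l)) x)
  (mono_eval (mono_dsq l) x) => A B C D.
pose S := \sum_i x ord0 i * F i.
have h i : \sum_j (kdelta ord0 i * (kdelta ord0 j * A + x ord0 j * B)
      + x ord0 i * (kdelta ord0 j * B + x ord0 j * C) + kdelta i j * D) * F i * F j =
    kdelta ord0 i * (F i * (A * F ord0 + B * S)) + (B * F ord0 + C * S) * (x ord0 i * F i)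
    + D * (F i * F i).
  transitivity (kdelta ord0 i * A * F i * (\sum_j kdelta ord0 j * F j) + kdelta ord0 i * B * F i * S
    + x ord0 i * B * F i * (\sum_j kdelta ord0 j * F j) + x ord0 i * C * F i * S
    + D * F i * (\sum_j kdelta i j * F j)).
    by rewrite /S !mulr_sumr -!big_split; apply: eq_bigr => j _ /=; ring.
  by rewrite !sum_kdelta; ring.
under eq_bigr => i _ do rewrite h.
by rewrite !big_split /= sum_kdelta -!mulr_sumr -/S; ring.
Qed.

Variables (l : seq (R * R * R)) (a K : R).

(** [time_factor1] and [time_factor2] are, up to sign, the first and second
    derivatives of [time_factor]. *)
Definition time_factor t : R := a * (t `^ (- K) - 1).
Definition time_factor1 t : R := a * K * t `^ (- K - 1).
Definition time_factor2 t : R := a * K * (K + 1) * t `^ (- K - 2).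

(** In all the names below a suffix [x] or [t] stands for a derivative in space
    or time: [Phixt i] is [d_t d_i Phi]. *)
Definition Phi z : R := time_factor z.2 * mono_eval l z.1 + - ((sqnorm z.1 + K) / 16 * (z.2)^-1).
Definition Phix i z : R :=
  time_factor z.2 * mono_grad l i z.1 + - (z.1 ord0 i / 8 * (z.2)^-1).
Definition Phit z : R :=
  - (time_factor1 z.2 * mono_eval l z.1) + (sqnorm z.1 + K) / 16 * ((z.2)^-1 * (z.2)^-1).
Definition Phixx i j z : R :=
  time_factor z.2 * mono_hess l i j z.1 + - (kdelta i j / 8 * (z.2)^-1).
Definition Phixt i z : R :=
  - (time_factor1 z.2 * mono_grad l i z.1) + z.1 ord0 i / 8 * ((z.2)^-1 * (z.2)^-1).
Definition Phitt z : R :=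
  time_factor2 z.2 * mono_eval l z.1
  + - ((sqnorm z.1 + K) / 8 * ((z.2)^-1 * (z.2)^-1 * (z.2)^-1)).

(** [Mf] is [F - Lap Phi], where [F] is the multiplier of the introduction.  Only
    this difference has to be differentiated, and up to a multiple of [1 / t] it
    is again a combination of monomials. *)
Definition multiplier_monomials := [seq (2 * u.1.1, u.1.2, u.2) | u <- mono_dsq l]
  ++ [seq (- 1 * u.1.1, u.1.2, u.2) | u <- mono_lap l].
Definition Mf z : R :=
  time_factor z.2 * mono_eval multiplier_monomials z.1 + (n%:R / 8 - 2) * (z.2)^-1.
Definition Mx i z : R := time_factor z.2 * mono_grad multiplier_monomials i z.1.
Definition Mxx i z : R := time_factor z.2 * mono_hess multiplier_monomials i i z.1.

Definition dom z := 0 < z.1 ord0 ord0 /\ 0 < z.2.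

Lemma is_derive_grad l' z i j : dom z ->
  is_derive z (dir_x j) (fun y => mono_grad l' i y.1) (mono_hess l' i j z.1).
Proof.
case=> x0 t0; apply: is_derive_eq.
  apply: is_derive_add; first by apply: is_derive_mul; exact: is_derive_mono_eval_x.
  by apply: is_derive_mul; [exact: is_derive_coord|exact: is_derive_mono_eval_x].
rewrite dir_xE /mono_hess mono_dC; ring.
Qed.

Lemma is_derive_grad_t l' z i : dom z ->
  is_derive z dir_t (fun y => mono_grad l' i y.1) 0.
Proof.
case=> x0 t0; apply: is_derive_eq.
  apply: is_derive_add; first by apply: is_derive_mul; exact: is_derive_mono_eval_t.
  by apply: is_derive_mul; [exact: is_derive_coord|exact: is_derive_mono_eval_t].
by rewrite /= mxE; ring.
Qed.

Lemma is_derive_time_factor z e : dom z ->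
  is_derive z e (fun y => time_factor y.2) (- time_factor1 z.2 * e.2).
Proof.
case=> x0 t0; apply: is_derive_eq.
  apply: is_derive_mul; apply: is_derive_add.
  by apply: is_derive_powR_comp => //; exact: is_derive_time.
by rewrite /time_factor1; ring.
Qed.

Lemma is_derive_time_factor1 z e : dom z ->
  is_derive z e (fun y => time_factor1 y.2) (- time_factor2 z.2 * e.2).
Proof.
case=> x0 t0; apply: is_derive_eq.
  apply: is_derive_mul.
  by apply: is_derive_powR_comp => //; exact: is_derive_time.
have -> : - K - 1 - 1 = - K - 2 by ring.
by rewrite /time_factor2; ring.
Qed.

Lemma is_derive_tinv z e : dom z ->
  is_derive z e (fun y => (y.2)^-1) (- ((z.2)^-1 * (z.2)^-1) * e.2).
Proof.
case=> x0 t0; apply: is_derive_eq.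
  by apply: is_derive_inv; [exact: lt0r_neq0|exact: is_derive_time].
by rewrite expr2.
Qed.

Lemma is_derive_sqnorm_x z i : is_derive z (dir_x i) (fun y => sqnorm y.1)
  (2 * z.1 ord0 i).
Proof. by apply: is_derive_eq; [exact: is_derive_sqnorm|rewrite sum_dir_xE]. Qed.

Lemma is_derive_sqnorm_t z : is_derive z dir_t (fun y => sqnorm y.1) 0.
Proof.
apply: is_derive_eq; first exact: is_derive_sqnorm.
by rewrite big1 ?mulr0// => i _; rewrite mxE mulr0.
Qed.

Lemma dir_x2 i : (dir_x i).2 = 0. Proof. by []. Qed.
Lemma dir_t2 : dir_t.2 = 1. Proof. by []. Qed.
Lemma dir_t1 i : dir_t.1 ord0 i = 0. Proof. exact: mxE. Qed.

Ltac derive_step := first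
  [ exact: is_derive_time_factor | exact: is_derive_time_factor1 | exact: is_derive_tinv
  | exact: is_derive_sqnorm_x | exact: is_derive_sqnorm_t
  | exact: is_derive_grad | exact: is_derive_grad_t
  | (apply: is_derive_mono_eval_x; by []) | (apply: is_derive_mono_eval_t; by [])
  | exact: is_derive_coord | exact: is_derive_const
  | apply: is_derive_add | apply: is_derive_opp | apply: is_derive_mul ].
Ltac derive_all := apply: is_derive_eq; [solve [repeat derive_step]|].

Lemma is_derive_Phi_x z i : dom z -> is_derive z (dir_x i) Phi (Phix i z).
Proof.
move=> dz; have [x0 t0] := dz; derive_all.
by rewrite /Phix /mono_grad dir_x2; move: (z.2)^-1 => b; field.
Qed.

Lemma is_derive_Phi_t z : dom z -> is_derive z dir_t Phi (Phit z).
Proof.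
move=> dz; have [x0 t0] := dz; derive_all.
by rewrite /Phit dir_t2; move: (z.2)^-1 => b; ring.
Qed.

Lemma is_derive_Phix_x z i j : dom z -> is_derive z (dir_x j) (Phix i) (Phixx i j z).
Proof.
move=> dz; have [x0 t0] := dz; derive_all.
by rewrite /Phixx dir_xE dir_x2; move: (z.2)^-1 => b; ring.
Qed.

Lemma is_derive_Phix_t z i : dom z -> is_derive z dir_t (Phix i) (Phixt i z).
Proof.
move=> dz; have [x0 t0] := dz; derive_all.
by rewrite /Phixt dir_t1 dir_t2; move: (z.2)^-1 => b; ring.
Qed.

Lemma is_derive_Phit_x z i : dom z -> is_derive z (dir_x i) Phit (Phixt i z).
Proof.
move=> dz; have [x0 t0] := dz; derive_all.
by rewrite /Phixt /mono_grad dir_x2; move: (z.2)^-1 => b; field.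
Qed.

Lemma is_derive_Phit_t z : dom z -> is_derive z dir_t Phit (Phitt z).
Proof.
move=> dz; have [x0 t0] := dz; derive_all.
by rewrite /Phitt dir_t2; move: (z.2)^-1 => b; field.
Qed.

Lemma is_derive_Mf z i : dom z -> is_derive z (dir_x i) Mf (Mx i z).
Proof.
move=> dz; have [x0 t0] := dz; derive_all.
by rewrite /Mx /mono_grad dir_x2; move: (z.2)^-1 => b; ring.
Qed.

Lemma is_derive_Mx z i : dom z -> is_derive z (dir_x i) (Mx i) (Mxx i z).
Proof.
move=> dz; have [x0 t0] := dz; derive_all.
by rewrite /Mxx dir_x2; ring.
Qed.

Lemma PhixxC i j z : Phixx i j z = Phixx j i z.
Proof. by rewrite /Phixx mono_hessC kdeltaC. Qed.

Lemma mono_eval_multiplier x : mono_eval multiplier_monomials x =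
  2 * mono_eval (mono_dsq l) x - mono_eval (mono_lap l) x.
Proof.
by rewrite /multiplier_monomials (mono_eval_cat [seq _ | u <- _]) !mono_eval_scale mulN1r.
Qed.

Lemma Phixx_trace z : dom z -> \sum_i Phixx i i z + Mf z =
  2 * time_factor z.2 * mono_eval (mono_dsq l) z.1 - 2 * (z.2)^-1.
Proof.
case=> x0 t0; rewrite /Phixx big_split /= -mulr_sumr mono_hess_trace//.
under [X in _ + X + _]eq_bigr => i _ do rewrite kdeltaii.
rewrite sumr_const card_ord /Mf mono_eval_multiplier -[_ *+ n]mulr_natr.
move: (z.2)^-1 => b; ring.
Qed.

Variable u : V -> R.
Local Notation ux i := ('D_(dir_x i) u).
Local Notation ut := ('D_dir_t u).
Local Notation uxx i j := ('D_(dir_x j) ('D_(dir_x i) u)).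
Local Notation uxt i := ('D_dir_t ('D_(dir_x i) u)).

(** [v = e^Phi u]; its derivatives are written out because the symmetry of [vxx]
    and the two readings of [vxt], as [d_t d_i v] and as [d_i d_t v], enter the
    divergence identity. *)
Definition vf z : R := expR (Phi z) * u z.
Definition vx i z : R := expR (Phi z) * (ux i z + Phix i z * u z).
Definition vt z : R := expR (Phi z) * (ut z + Phit z * u z).
Definition vxx i j z : R := expR (Phi z) *
  (uxx i j z + Phix i z * ux j z + Phixx i j z * u z
   + Phix j z * (ux i z + Phix i z * u z)).
Definition vxt i z : R := expR (Phi z) *
  (uxt i z + Phix i z * ut z + Phixt i z * u z
   + Phit z * (ux i z + Phix i z * u z)).

Definition Tf z : R := \sum_j Phix j z * vx j z.
Definition Nf z : R := \sum_j vx j z * vx j z.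
Definition Tx i z : R := \sum_j (Phix j z * vxx j i z + vx j z * Phixx j i z).
Definition Nx i z : R := 2 * \sum_j vx j z * vxx j i z.
Definition Nt z : R := 2 * \sum_j vx j z * vxt j z.
Definition Gf z : R := \sum_j Phix j z * Phix j z + - Phit z.
Definition Gx i z : R := 2 * (\sum_j Phix j z * Phixx j i z) + - Phixt i z.
Definition Gt z : R := 2 * (\sum_j Phix j z * Phixt j z) + - Phitt z.

(** The flux whose divergence enters [divergence_identity]; [dspace_flux i] and
    [dtime_flux] are the terms of that divergence. *)
Definition space_flux i z : R :=
  2 * (vx i z * vt z) + - (4 * (vx i z * Tf z)) + 2 * (Phix i z * Nf z)
  + - (2 * (Gf z * (Phix i z * (vf z * vf z)))) + 2 * (Mf z * (vf z * vx i z))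
  + - (Mx i z * (vf z * vf z)).
Definition time_flux z : R := Gf z * (vf z * vf z) + - Nf z.

Definition dspace_flux i z : R :=
  2 * (vxx i i z * vt z + vx i z * vxt i z)
  - 4 * (vxx i i z * Tf z + vx i z * Tx i z)
  + 2 * (Phixx i i z * Nf z + Phix i z * Nx i z)
  - 2 * (Gx i z * Phix i z * vf z ^+ 2 + Gf z * Phixx i i z * vf z ^+ 2
         + 2 * Gf z * Phix i z * vf z * vx i z)
  + 2 * (Mx i z * vf z * vx i z + Mf z * vx i z * vx i z + Mf z * vf z * vxx i i z)
  - (Mxx i z * vf z ^+ 2 + 2 * Mx i z * vf z * vx i z).
Definition dtime_flux z : R := Gt z * vf z ^+ 2 + 2 * Gf z * vf z * vt z - Nt z.

Hypothesis smooth_u : Ck 3 u.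

Lemma Ck1 k (f : V -> R) : Ck k f -> continuous f.
Proof.
by case: k => [//|k] [df _] y; apply: differentiable_continuous.
Qed.

Lemma u_derive z e : is_derive z e u ('D_e u z).
Proof. by apply/derivableP/diff_derivable; case: smooth_u. Qed.

Lemma du_derive z e e' : is_derive z e' ('D_e u) ('D_e' ('D_e u) z).
Proof. by apply/derivableP/diff_derivable; case: smooth_u => _ /(_ e)[]. Qed.

Lemma u_continuous : continuous u. Proof. exact: Ck1 smooth_u. Qed.

Lemma du_continuous e : continuous ('D_e u).
Proof. by case: smooth_u => _ /(_ e) h; exact: (@Ck1 2). Qed.

Lemma d2u_continuous e e' : continuous ('D_e' ('D_e u)).
Proof. by case: smooth_u => _ /(_ e)[_ /(_ e') h]; exact: (@Ck1 1). Qed.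

Lemma du_commute e e' z : 'D_e' ('D_e u) z = 'D_e ('D_e' u) z.
Proof.
apply: derive_commute.
- by move=> y; case: (u_derive y e).
- by move=> y; case: (u_derive y e').
- by move=> y; case: (du_derive y e e').
- by move=> y; case: (du_derive y e' e).
- exact: d2u_continuous.
- exact: d2u_continuous.
Qed.

Lemma vxxC i j z : vxx i j z = vxx j i z.
Proof.
rewrite /vxx PhixxC; congr (_ * _).
have -> : uxx i j z = uxx j i z by exact: du_commute.
move: (ux i z) (ux j z) (uxx j i z) (Phix i z) (Phix j z) (Phixx j i z) (u z).
by move=> *; ring.
Qed.

Lemma is_derive_vf_x z i : dom z -> is_derive z (dir_x i) vf (vx i z).
Proof.
by move=> dz; apply: is_derive_weighted; [exact: is_derive_Phi_x|exact: u_derive].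
Qed.

Lemma is_derive_vf_t z : dom z -> is_derive z dir_t vf (vt z).
Proof.
by move=> dz; apply: is_derive_weighted; [exact: is_derive_Phi_t|exact: u_derive].
Qed.

Lemma is_derive_vx_x z i j : dom z -> is_derive z (dir_x j) (vx i) (vxx i j z).
Proof.
move=> dz; apply: (@is_derive_weighted _ _ Phi (fun y => ux i y + Phix i y * u y)).
  exact: is_derive_Phi_x.
apply: is_derive_twisted; [exact: du_derive|exact: is_derive_Phix_x|exact: u_derive].
Qed.

Lemma is_derive_vx_t z i : dom z -> is_derive z dir_t (vx i) (vxt i z).
Proof.
move=> dz; apply: (@is_derive_weighted _ _ Phi (fun y => ux i y + Phix i y * u y)).
  exact: is_derive_Phi_t.
apply: is_derive_twisted; [exact: du_derive|exact: is_derive_Phix_t|exact: u_derive].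
Qed.

Lemma is_derive_vt_x z i : dom z -> is_derive z (dir_x i) vt (vxt i z).
Proof.
move=> dz; apply: is_derive_eq.
  apply: (@is_derive_weighted _ _ Phi (fun y => ut y + Phit y * u y)).
    exact: is_derive_Phi_x.
  apply: is_derive_twisted; [exact: du_derive|exact: is_derive_Phit_x|exact: u_derive].
rewrite /vxt; congr (_ * _).
have -> : 'D_(dir_x i) ('D_dir_t u) z = uxt i z by exact: du_commute.
move: (ux i z) (ut z) (uxt i z) (Phix i z) (Phit z) (Phixt i z) (u z).
by move=> *; ring.
Qed.

Lemma is_derive_Tf z i : dom z -> is_derive z (dir_x i) Tf (Tx i z).
Proof.
move=> dz; apply: (@is_derive_bigsum _ _ _ _ (fun j y => Phix j y * vx j y)) => j.
by apply: is_derive_mul; [exact: is_derive_Phix_x|exact: is_derive_vx_x].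
Qed.

Lemma is_derive_Nf_x z i : dom z -> is_derive z (dir_x i) Nf (Nx i z).
Proof.
move=> dz; rewrite /Nx mulr_sumr.
apply: (@is_derive_bigsum _ _ _ _ (fun j y => vx j y * vx j y)) => j.
apply: is_derive_eq; first by apply: is_derive_mul; exact: is_derive_vx_x.
by ring.
Qed.

Lemma is_derive_Nf_t z : dom z -> is_derive z dir_t Nf (Nt z).
Proof.
move=> dz; rewrite /Nt mulr_sumr.
apply: (@is_derive_bigsum _ _ _ _ (fun j y => vx j y * vx j y)) => j.
apply: is_derive_eq; first by apply: is_derive_mul; exact: is_derive_vx_t.
by ring.
Qed.

Lemma is_derive_Gf_x z i : dom z -> is_derive z (dir_x i) Gf (Gx i z).
Proof.
move=> dz; rewrite /Gx mulr_sumr; apply: is_derive_add.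
  apply: (@is_derive_bigsum _ _ _ _ (fun j y => Phix j y * Phix j y)) => j.
  apply: is_derive_eq; first by apply: is_derive_mul; exact: is_derive_Phix_x.
  by ring.
by apply: is_derive_opp; exact: is_derive_Phit_x.
Qed.

Lemma is_derive_Gf_t z : dom z -> is_derive z dir_t Gf (Gt z).
Proof.
move=> dz; rewrite /Gt mulr_sumr; apply: is_derive_add.
  apply: (@is_derive_bigsum _ _ _ _ (fun j y => Phix j y * Phix j y)) => j.
  apply: is_derive_eq; first by apply: is_derive_mul; exact: is_derive_Phix_t.
  by ring.
by apply: is_derive_opp; exact: is_derive_Phit_t.
Qed.

Lemma is_derive_space_flux z i : dom z -> is_derive z (dir_x i) (space_flux i) (dspace_flux i z).
Proof.
move=> dz; apply: is_derive_flux_form_x.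
- exact: is_derive_vx_x.
- exact: is_derive_vt_x.
- exact: is_derive_Tf.
- exact: is_derive_Phix_x.
- exact: is_derive_Nf_x.
- exact: is_derive_Gf_x.
- exact: is_derive_vf_x.
- exact: is_derive_Mf.
- exact: is_derive_Mx.
Qed.

Lemma is_derive_time_flux z : dom z -> is_derive z dir_t time_flux (dtime_flux z).
Proof.
move=> dz; apply: is_derive_flux_form_t.
- exact: is_derive_Nf_t.
- exact: is_derive_Gf_t.
- exact: is_derive_vf_t.
Qed.

End phase.

(** * The angular inequality *)

Section angular.
Context {R : realType}.
Implicit Types (A m y tau k gamma eps c : R).

(** With [A = alpha^2], [y] and [tau] as in the introduction, this is
    [D^2 phi(grad phi, grad phi) + D |grad phi|^2] divided by
    [|x|^(3 alpha - 4) (x_1 / |x|)^(3m)]. *)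
Definition angular_form A m y tau : R :=
  (A * y - m) * (A * y ^+ 2 + 2 * m ^+ 2 * tau) + m ^+ 3 * (m - 1) * tau ^+ 2.

Lemma convex_powR_segment (p k x y : R) : 1 <= p -> 0 <= k <= 1 ->
  0 <= x -> 0 <= y ->
  (k * x + (1 - k) * y) `^ p <= k * x `^ p + (1 - k) * y `^ p.
Proof.
move=> p1 /andP[k0 k1] x0 y0.
have := @convex_powR R p p1 (Itv01 k0 k1) x y.
by rewrite !inE/= !in_itv/= !andbT; exact.
Qed.

(** On the chord from [(m / b, 0)] to [(0, 2 / (m - 1))] the form is a positive
    multiple of [1 - k] times a quadratic polynomial in [k], whose discriminant
    vanishes exactly by equation (i); here [b] is the factor occurring in
    equations (i) and (iii). *)
Lemma angular_form_chord gamma m k (b : R) :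
  1 / 2 < gamma <= 1 -> 236 / 100 <= m < 3 -> 0 <= k <= 1 ->
  b = 4 - gamma ^+ 2 * ((m - 1) / 4) ->
  4 * (2 * gamma - 1) = gamma ^+ 2 * b ->
  0 <= angular_form 4 m (m / b * (1 - k)) (2 * k / (m - 1)).
Proof.
move=> /andP[g0 g1] /andP[m2 m3] /andP[k0 k1] bE e1.
have b0 : 0 < b by rewrite bE; nra.
have m10 : m - 1 != 0 by rewrite gt_eqF//; lra.
have gb : gamma ^+ 2 * (m - 1) = 4 * (4 - b) by rewrite bE; field.
have bn0 : b != 0 by rewrite gt_eqF.
have -> : angular_form 4 m (m / b * (1 - k)) (2 * k / (m - 1)) =
  4 * m ^+ 3 / (b ^+ 3 * (m - 1)) * (1 - k) *
  ((4 - b - 4 * k) * (m - 1) * (1 - k) + (4 - b) * k * b ^+ 2).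
  by rewrite /angular_form; field; rewrite bn0 m10.
rewrite mulr_ge0//.
  rewrite mulr_ge0 ?subr_ge0// divr_ge0// ?mulr_ge0 ?exprn_ge0//; nra.
rewrite -(@pmulr_rge0 _ (gamma ^+ 2)); last by rewrite exprn_gt0; lra.
have -> : gamma ^+ 2 * ((4 - b - 4 * k) * (m - 1) * (1 - k) + (4 - b) * k * b ^+ 2)
  = (4 - b) * (4 * (4 - b - 4 * k) * (1 - k) + k * b * (gamma ^+ 2 * b)).
  transitivity (gamma ^+ 2 * (m - 1) * (4 - b - 4 * k) * (1 - k)
    + (4 - b) * k * b * (gamma ^+ 2 * b)); first by ring.
  by rewrite gb; ring.
have d0 : 0 <= 4 - b by nra.
rewrite mulr_ge0// -e1.
suff -> : 4 * (4 - b - 4 * k) * (1 - k) + k * b * (4 * (2 * gamma - 1)) =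
  (4 * k - 4 + b * gamma) ^+ 2 by exact: sqr_ge0.
apply/eqP; rewrite -subr_eq0.
have -> : 4 * (4 - b - 4 * k) * (1 - k) + k * b * (4 * (2 * gamma - 1)) -
  (4 * k - 4 + b * gamma) ^+ 2 = b * (4 * (2 * gamma - 1) - gamma ^+ 2 * b) by ring.
by rewrite e1 subrr mulr0.
Qed.

(** Where the form is nonnegative [tau] cannot be small unless [4 y > m]; the
    monotonicity of the form and the positivity in [angular_norm_gt0] both come
    from this bound. *)
Lemma angular_form_tau m y tau : 236 / 100 <= m < 3 -> 0 < tau ->
  0 <= angular_form 4 m y tau -> 0 <= m - 4 * y ->
  3 * (m - 4 * y) <= m ^+ 2 * tau.
Proof.
move=> /andP[m2 m3] t0 Q w0.
have h : (m - 4 * y) * (2 * m ^+ 2) <= m ^+ 3 * (m - 1) * tau.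
  rewrite -(ler_pM2r t0) -subr_ge0.
  have -> : m ^+ 3 * (m - 1) * tau * tau - (m - 4 * y) * (2 * m ^+ 2) * tau =
    angular_form 4 m y tau + (m - 4 * y) * (4 * y ^+ 2).
    by rewrite /angular_form; ring.
  by rewrite addr_ge0// mulr_ge0// mulr_ge0// sqr_ge0.
have {}h : 2 * (m - 4 * y) <= m * (m - 1) * tau.
  have m0 : 0 < m ^+ 2 by rewrite exprn_gt0//; lra.
  rewrite -(ler_pM2r m0); apply: le_trans (le_trans _ h) _; lra.
have : 3 * (m - 1) * (m - 4 * y) <= 2 * m * (m - 4 * y).
  by rewrite ler_wpM2r//; lra.
have m1 : 0 < m - 1 by lra.
rewrite -(ler_pM2r m1); nra.
Qed.

Lemma angular_form_increasing m y y' tau : 236 / 100 <= m < 3 -> 0 < tau ->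
  0 <= y < y' -> 0 <= angular_form 4 m y tau -> 0 < angular_form 4 m y' tau.
Proof.
move=> mb t0 /andP[y0 yy'] Q; have /andP[m2 m3] := mb.
have [w'0|w'0] := leP m (4 * y').
  rewrite /angular_form ltr_wpDl//.
    rewrite mulr_ge0 ?subr_ge0// addr_ge0// ?mulr_ge0//; nra.
  by rewrite !mulr_gt0// ?exprn_gt0//; lra.
have ht : 3 * (m - 4 * y) <= m ^+ 2 * tau by apply: angular_form_tau => //; lra.
apply: (le_lt_trans Q); rewrite -subr_gt0.
have -> : angular_form 4 m y' tau - angular_form 4 m y tau =
  (y' - y) * (16 * (y' ^+ 2 + y' * y + y ^+ 2) - 4 * m * (y + y')
              + 8 * (m ^+ 2 * tau)) by rewrite /angular_form; ring.
rewrite mulr_gt0 ?subr_gt0//.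
(* the divided difference, with m^2 tau replaced by its lower bound, is
   positive: complete squares in w = m - 4 y and w' = m - 4 y' *)
have : 0 < 16 * (y' ^+ 2 + y' * y + y ^+ 2) - 4 * m * (y + y')
  + 8 * (3 * (m - 4 * y)).
  pose w := m - 4 * y; pose w' := m - 4 * y'.
  have -> : 16 * (y' ^+ 2 + y' * y + y ^+ 2) - 4 * m * (y + y')
    + 8 * (3 * (m - 4 * y)) =
      (m - w') ^+ 2 + w ^+ 2 + w * w' + 2 * w * (12 - m) by rewrite /w /w'; ring.
  have wp : 0 < w by rewrite /w; lra.
  have wp' : 0 < w' by rewrite /w'; lra.
  rewrite ltr_wpDl//; last by rewrite !mulr_gt0//; lra.
  by rewrite !addr_ge0 ?sqr_ge0// mulr_ge0// ltW.
lra.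
Qed.

(** The normalized value of [|grad phi|^2 + D phi] at [alpha = 2]. *)
Lemma angular_norm_gt0 m y tau : 236 / 100 <= m < 3 -> 0 <= y -> 0 <= tau ->
  0 < angular_form 4 m y tau -> 0 < 6 * y ^+ 2 - m * y + m ^+ 2 * tau.
Proof.
move=> mb y0 t0 Q; have /andP[m2 m3] := mb.
have [w0|w0] := leP m (4 * y).
  have : 0 <= m ^+ 2 * tau by rewrite mulr_ge0// sqr_ge0.
  nra.
have tp : 0 < tau.
  rewrite lt_neqAle t0 andbT; apply/eqP => t00; move: Q; rewrite -t00.
  rewrite /angular_form !mulr0 expr0n !mulr0 !addr0.
  apply/negP; rewrite -leNgt; apply: mulr_le0_ge0; first by rewrite subr_le0 ltW.
  by rewrite mulr_ge0// sqr_ge0.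
have ht : 3 * (m - 4 * y) <= m ^+ 2 * tau.
  by apply: angular_form_tau => //; [exact: ltW|lra].
nra.
Qed.

(** Convexity of [s |-> s^(m/2)] puts the curve described by [(y, tau)] above the
    chord of [angular_form_chord]; for [eps < eps0] it is strictly above, and the
    form increases with [y]. *)
Lemma angular_form_gt0 gamma m eps0 eps c : cone_system gamma m eps0 ->
  0 < eps < eps0 -> eps <= c <= 1 ->
  0 < angular_form 4 m (1 - (eps / c) `^ m) (c ^- 2 - 1).
Proof.
move=> [[gb mb e00] [e1 e2 e3]] /andP[e0 ee0] /andP[ec c1].
have /andP[m2 m3] := mb; have /andP[g0 g1] := gb.
have c0 : 0 < c by lra.
have cn0 : c != 0 by rewrite gt_eqF.
set y := 1 - _; set tau := _ - 1.
have m0 : 0 < m by lra.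
have y0 : 0 <= y.
  rewrite subr_ge0; apply: (@le_trans _ _ (1 `^ m)); last by rewrite powR1.
  apply: ge0_ler_powR; [exact: ltW| |by rewrite nnegrE|].
  - by rewrite nnegrE divr_ge0 ?ltW.
  - by rewrite ler_pdivrMr// mul1r.
have t0 : 0 <= tau.
  by rewrite subr_ge0 -exprVn exprn_ege1// invf_ge1.
pose b := 4 - gamma ^+ 2 * ((m - 1) / 4).
have b0 : 7 / 2 < b < 4 by rewrite /b; nra.
have /andP[b1 b2] := b0.
have bn0 : b != 0 by rewrite gt_eqF; lra.
have E0 : 1 - eps0 `^ m = m / b.
  move: e3; rewrite -/b => e3.
  by rewrite -[LHS](mulfK bn0); congr (_ / b); lra.
have m1n0 : m - 1 != 0 by rewrite gt_eqF//; lra.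
have yy0 : 1 - (eps0 / c) `^ m < y.
  rewrite ltrD2l ltrN2 gt0_ltr_powR// ?nnegrE ?divr_ge0 ?ltW//.
  by rewrite ltr_pM2r// invr_gt0.
pose k := tau * (m - 1) / 2.
have k0 : 0 <= k by rewrite /k; nra.
have tE : tau = 2 * k / (m - 1) by rewrite /k; field.
have [k1|k1] := ltP 1 k.
  (* beyond the end of the chord the form is positive already at y = 0 *)
  have tp : 0 < tau by rewrite lt_neqAle t0 andbT; apply/eqP => h; move: k1; rewrite /k -h; lra.
  have Q0 : 0 < angular_form 4 m 0 tau.
    rewrite /angular_form.
    have -> : (4 * 0 - m) * (4 * 0 ^+ 2 + 2 * m ^+ 2 * tau) + m ^+ 3 * (m - 1) * tau ^+ 2
      = m ^+ 3 * tau * 2 * (k - 1) by rewrite tE; field.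
    by rewrite !mulr_gt0// ?exprn_gt0// subr_gt0.
  have [->//|yn0] := eqVneq y 0.
  by apply: (@angular_form_increasing m 0) => //;
    rewrite ?lexx ?ltW// lt_neqAle eq_sym yn0.
have eps0sq : eps0 ^+ 2 = (m - 1) / (m + 1) by lra.
have mp1 : m + 1 != 0 by rewrite gt_eqF//; lra.
have ychord : m / b * (1 - k) <= 1 - (eps0 / c) `^ m.
  have -> : (eps0 / c) `^ m = (k * 1 + (1 - k) * eps0 ^+ 2) `^ (m / 2).
    have -> : k * 1 + (1 - k) * eps0 ^+ 2 = (eps0 / c) ^+ 2.
      rewrite exprMn exprVn.
      have -> : c ^- 2 = 1 + tau by rewrite /tau; ring.
      rewrite eps0sq tE. by field; rewrite m1n0.
    by rewrite -powR_mulrn ?divr_ge0 ?ltW// -powRrM; congr (_ `^ _); field.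
  have p1 : 1 <= m / 2 by lra.
  have := @convex_powR_segment (m / 2) k 1 (eps0 ^+ 2) p1.
  rewrite k0 k1 ler01 sqr_ge0 => /(_ isT isT isT).
  have -> : (eps0 ^+ 2) `^ (m / 2) = eps0 `^ m.
    by rewrite -powR_mulrn ?ltW// -powRrM; congr (_ `^ _); field.
  rewrite powR1 -E0; lra.
have Qc : 0 <= angular_form 4 m (m / b * (1 - k)) tau.
  rewrite tE; apply: (@angular_form_chord gamma) => //.
  by rewrite k0.
have [k00|kn0] := eqVneq k 0.
  have y4 : m < 4 * y.
    have : m / 4 < m / b by rewrite ltr_pM2l// ltf_pV2 ?posrE//; lra.
    by move: ychord; rewrite k00 subr0 mulr1; lra.
  rewrite /angular_form ltr_pwDl//.
    apply: mulr_gt0; first by rewrite subr_gt0.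
    apply: ltr_pwDl; first by rewrite mulr_gt0// exprn_gt0//; lra.
    by rewrite mulr_ge0// mulr_ge0// sqr_ge0.
  rewrite !mulr_ge0// ?exprn_ge0//; lra.
have tp : 0 < tau by rewrite lt_neqAle t0 andbT; apply: contra kn0 => /eqP h; rewrite /k -h !mul0r.
apply: (@angular_form_increasing m (m / b * (1 - k))) => //.
apply/andP; split; last exact: le_lt_trans yy0.
by rewrite mulr_ge0 ?subr_ge0// divr_ge0 ?ltW//; lra.
Qed.

Lemma EVT_gt0 (f : R -> R) (a b : R) : a <= b -> {within `[a, b], continuous f} ->
  (forall c, a <= c <= b -> 0 < f c) ->
  exists2 e, 0 < e & forall c, a <= c <= b -> e <= f c.
Proof.
move=> ab cf fp; have [c cab fc] := EVT_min ab cf.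
exists (f c); first by apply: fp; move: cab; rewrite in_itv.
by move=> x xab; apply: fc; rewrite in_itv.
Qed.

End angular.

Section exponent.
Context {R : realType}.

Lemma continuous_angular_form (V : normedModType R) (f g : V -> R) m (c : V) :
  continuous_at c f -> continuous_at c g ->
  continuous_at c (fun c => angular_form 4 m (f c) (g c)).
Proof.
move=> h1 h2; rewrite /angular_form.
by continuity ltac:(first [exact: h1|exact: h2]).
Qed.

Lemma continuous_angular_norm (V : normedModType R) (f g : V -> R) m (c : V) :
  continuous_at c f -> continuous_at c g ->
  continuous_at c (fun c => 6 * f c ^+ 2 - m * f c + m ^+ 2 * g c).
Proof.
move=> h1 h2.
by continuity ltac:(first [exact: h1|exact: h2]).
Qed.

(** The values at [alpha = 2] are bounded below by compactness of [[eps, 1]], and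
    they depend on [alpha] in a Lipschitz way because [y] and [tau] are
    bounded. *)
Lemma exponent_choice (gamma m eps0 eps : R) : cone_system gamma m eps0 ->
  0 < eps < eps0 -> eps <= 1 ->
  exists alpha eta : R, [/\ 1 < alpha < 2, 0 < eta &
    forall c, eps <= c <= 1 ->
      0 <= angular_form (alpha ^+ 2) m (1 - (eps / c) `^ m) (c ^- 2 - 1) /\
      eta <= alpha ^+ 2 * (1 - (eps / c) `^ m) ^+ 2 + m ^+ 2 * (c ^- 2 - 1)
        + (1 - (eps / c) `^ m) * (alpha * (1 - (eps / c) `^ m) - m)].
Proof.
move=> sys ee0 e1; have /andP[e0 _] := ee0.
have [[_ mb _] _] := sys; have /andP[m2 m3] := mb.
pose y (c : R) := 1 - (eps / c) `^ m; pose tau (c : R) := c ^- 2 - 1.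
have yb c : eps <= c <= 1 -> 0 <= y c <= 1.
  move=> /andP[ec c1]; have c0 : 0 < c by exact: lt_le_trans ec.
  rewrite /y subr_ge0 gerBl powR_ge0 andbT.
  apply: (@le_trans _ _ (1 `^ m)); last by rewrite powR1.
  apply: ge0_ler_powR; rewrite ?nnegrE ?ler01//.
  - by lra.
  - by rewrite divr_ge0// ltW.
  - by rewrite ler_pdivrMr// mul1r.
have tb c : eps <= c <= 1 -> 0 <= tau c <= tau eps.
  move=> /andP[ec c1]; have c0 : 0 < c by exact: lt_le_trans ec.
  rewrite /tau subr_ge0 -!exprVn exprn_ege1 ?invf_ge1//= lerD2r.
  by rewrite lerXn2r ?nnegrE ?invr_ge0 ?(ltW c0) ?(ltW e0)// lef_pV2 ?posrE.
have cy (c : R) : 0 < c -> continuous_at c y.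
  move=> c0; apply: for_continuousD; first exact: for_continuous_cst.
  apply: for_continuousN; apply: for_continuous_powR; first exact: divr_gt0.
  apply: for_continuousM; first exact: for_continuous_cst.
  by apply: for_continuousV; [exact: lt0r_neq0|exact: cvg_id].
have ct (c : R) : 0 < c -> continuous_at c tau.
  move=> c0; apply: for_continuousD; last exact: for_continuous_cst.
  apply: for_continuousV; first by rewrite expf_neq0// lt0r_neq0.
  by apply: for_continuousX; exact: cvg_id.
pose f1 c := angular_form 4 m (y c) (tau c).
pose f2 c := 6 * y c ^+ 2 - m * y c + m ^+ 2 * tau c.
have within (f : R -> R) : (forall c : R, 0 < c -> continuous_at c f) ->
    {within `[eps, 1], continuous f}.
  move=> cf; apply: continuous_in_subspaceT => c; rewrite inE/= in_itv/= => /andP[ec _].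
  by apply: cf; exact: lt_le_trans ec.
have cf1 : {within `[eps, 1], continuous f1}.
  by apply: within => c c0; apply: continuous_angular_form; [exact: cy|exact: ct].
have cf2 : {within `[eps, 1], continuous f2}.
  by apply: within => c c0; apply: continuous_angular_norm; [exact: cy|exact: ct].
have f1p c : eps <= c <= 1 -> 0 < f1 c by exact: (angular_form_gt0 sys).
have f2p c : eps <= c <= 1 -> 0 < f2 c.
  move=> cb; have /andP[y0 _] := yb c cb; have /andP[t0 _] := tb c cb.
  by apply: angular_norm_gt0 => //; exact: f1p.
have [h1 h10 H1] := EVT_gt0 e1 cf1 f1p.
have [h2 h20 H2] := EVT_gt0 e1 cf2 f2p.
pose q := 8 + 18 * tau eps.
have te0 : 0 <= tau eps by have /andP[] := tb eps (introT andP (conj (lexx _) e1)).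
have q0 : 0 < q by rewrite /q ltr_pwDl// mulr_ge0.
pose D := Num.min (1 / 2) (Num.min (h2 / 10) (h1 / (4 * q))).
have D0 : 0 < D by rewrite !lt_min !divr_gt0// mulr_gt0.
have D1 : D <= 1 / 2 by rewrite /D ge_min lexx.
have D2 : D <= h2 / 10 by rewrite /D !ge_min lexx orbT.
have D3 : D * (4 * q) <= h1.
  by rewrite -ler_pdivlMr ?mulr_gt0// /D !ge_min lexx !orbT.
exists (2 - D), (h2 / 2); split; [by apply/andP; split; lra|by rewrite divr_gt0|].
move=> c cb; have /andP[y0 y1] := yb c cb; have /andP[t0 t1] := tb c cb.
have := H1 c cb; have := H2 c cb; rewrite /f1 /f2 -/(y c) -/(tau c).
move: (y c) (tau c) y0 y1 t0 t1 => Y T Y0 Y1 T0 T1 E2 E1.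
clear -E1 E2 Y0 Y1 T0 T1 D0 D1 D2 D3 m2 m3 h10 h20 q0 te0.
have [Y2 YY] : 0 <= Y ^+ 2 /\ Y ^+ 2 <= 1 by split; [exact: sqr_ge0|exact: exprn_ile1].
split.
  have -> : angular_form ((2 - D) ^+ 2) m Y T = angular_form 4 m Y T
    - (D * (4 - D)) * (Y * (4 * Y ^+ 2 + 2 * m ^+ 2 * T + ((2 - D) ^+ 2 * Y - m) * Y)).
    by rewrite /angular_form; ring.
  rewrite subr_ge0; apply: le_trans E1; apply: le_trans D3.
  have DD : 0 <= 4 - D <= 4 by apply/andP; split; lra.
  have /andP[DD0 DD1] := DD.
  rewrite -mulrA ler_wpM2l ?(ltW D0)//.
  apply: (@le_trans _ _ ((4 - D) * q)); last by rewrite ler_wpM2r ?(ltW q0).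
  rewrite ler_wpM2l//.
  apply: (@le_trans _ _ (4 * Y ^+ 2 + 2 * m ^+ 2 * T + 4 * Y ^+ 2)).
    have A4 : (2 - D) ^+ 2 <= 4 by nra.
    have A0 : 0 <= (2 - D) ^+ 2 by exact: sqr_ge0.
    have mT : 0 <= 2 * m ^+ 2 * T by rewrite mulr_ge0// mulr_ge0// sqr_ge0.
    have S : ((2 - D) ^+ 2 * Y - m) * Y <= 4 * Y ^+ 2.
      have : (2 - D) ^+ 2 * Y ^+ 2 <= 4 * Y ^+ 2 by rewrite ler_wpM2r.
      have : 0 <= m * Y by rewrite mulr_ge0//; lra.
      have -> : ((2 - D) ^+ 2 * Y - m) * Y = (2 - D) ^+ 2 * Y ^+ 2 - m * Y by ring.
      lra.
    have S2 : 0 <= 4 * Y ^+ 2 + 2 * m ^+ 2 * T + 4 * Y ^+ 2 by lra.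
    apply: (@le_trans _ _ (Y * (4 * Y ^+ 2 + 2 * m ^+ 2 * T + 4 * Y ^+ 2))).
      by rewrite ler_wpM2l// lerD2l.
    by rewrite ler_piMl.
  have m9 : m ^+ 2 <= 9 by nra.
  have : m ^+ 2 * T <= 9 * tau eps by apply: ler_pM => //; exact: sqr_ge0.
  by rewrite /q; lra.
have : (5 * D) * Y ^+ 2 <= 5 * D by rewrite ler_piMr// mulr_ge0// ltW.
have : (5 * D - D ^+ 2) * Y ^+ 2 <= (5 * D) * Y ^+ 2.
  by rewrite ler_wpM2r// gerBl sqr_ge0.
have -> : (2 - D) ^+ 2 * Y ^+ 2 + m ^+ 2 * T + Y * ((2 - D) * Y - m) =
  (6 * Y ^+ 2 - m * Y + m ^+ 2 * T) - (5 * D - D ^+ 2) * Y ^+ 2 by ring.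
lra.
Qed.

End exponent.

(** * The pointwise inequality *)

(** [Q] is the part of the Hessian form of [phi] left by the multiplier, [b] is
    [1 / t], [W] the zeroth order coefficient, [D] the divergence of the flux,
    [Z] the left-hand density.  The difference of both sides contains the squares
    of [A v] and of [S v - F v], where [S v] is here [S + G v]. *)
Lemma complete_the_square (R : realFieldType) (N v w T G S L P W D Z s b f Q : R) :
  0 <= Q -> 0 <= N -> 1 <= b -> 0 <= s ->
  2 * (S + G * v) * (w - 2 * T + (2 * s * f - 2 * b - L) * v) - D =
    4 * (s * (Q + f * N) - 1 / 8 * b * N) - 2 * (2 * s * f - 2 * b) * N +
    v ^+ 2 * (W + (2 * s * f - 2 * b) ^+ 2) ->
  1 + 2 * P <= W -> Z <= v ^+ 2 + 2 * N + 2 * v ^+ 2 * P ->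
  Z + D <= (S + G * v + (w - 2 * T - L * v)) ^+ 2.
Proof.
move=> Q0 N0 b1 s0 E hW hg.
pose A := w - 2 * T - L * v; pose F := 2 * s * f - 2 * b.
have -> : (S + G * v + (w - 2 * T - L * v)) ^+ 2 =
  2 * (S + G * v) * (w - 2 * T + (2 * s * f - 2 * b - L) * v) - D
  + D - v ^+ 2 * F ^+ 2 + A ^+ 2 + (S + G * v - F * v) ^+ 2.
  by rewrite /A /F; ring.
rewrite E -/F.
have hA : 0 <= A ^+ 2 by exact: sqr_ge0.
have hS : 0 <= (S + G * v - F * v) ^+ 2 by exact: sqr_ge0.
have hQ : 0 <= s * Q by exact: mulr_ge0.
have hN : N <= b * N by rewrite ler_peMl.
have hv : v ^+ 2 * (1 + 2 * P) <= v ^+ 2 * W by rewrite ler_wpM2l// sqr_ge0.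
apply: (@le_trans _ _ (v ^+ 2 + 2 * N + 2 * v ^+ 2 * P + D)); first by rewrite lerD2r.
rewrite -subr_ge0.
have -> : 4 * (s * (Q + f * N) - 1 / 8 * b * N) - 2 * F * N + v ^+ 2 * (W + F ^+ 2)
   + D - v ^+ 2 * F ^+ 2 + A ^+ 2 + (S + G * v - F * v) ^+ 2
   - (v ^+ 2 + 2 * N + 2 * v ^+ 2 * P + D) =
   4 * (s * Q) + (7 / 2 * (b * N) - 2 * N) + (v ^+ 2 * W - v ^+ 2 * (1 + 2 * P))
   + A ^+ 2 + (S + G * v - F * v) ^+ 2.
  by rewrite {1}/F; field.
apply: addr_ge0 hS; apply: addr_ge0 hA; apply: addr_ge0; last by rewrite subr_ge0.
apply: addr_ge0; first by rewrite mulr_ge0.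
by rewrite subr_ge0; clear -hN N0; lra.
Qed.

Section carleman_pointwise.
Context {R : realType} {d : nat}.
Local Notation n := d.+1.
Local Notation V := ('rV[R]_n * R)%type.
Local Notation kdelta := (@kdelta R d).
Local Notation dir_x := (@dir_x R d).
Local Notation dir_t := (@dir_t R d).
Local Notation mono_lap := (@mono_lap R d).
Variables (l : seq (R * R * R)) (a K : R) (u : V -> R).
Hypothesis smooth_u : Ck 3 u.
Implicit Types (z : V) (i j : 'I_n).

Local Notation Phi := (@Phi R d l a K).
Local Notation Phix := (@Phix R d l a K).
Local Notation Phit := (@Phit R d l a K).
Local Notation Phixx := (@Phixx R d l a K).
Local Notation Phixt := (@Phixt R d l a K).
Local Notation Phitt := (@Phitt R d l a K).
Local Notation Mf := (@Mf R d l a K).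
Local Notation Mx := (@Mx R d l a K).
Local Notation Mxx := (@Mxx R d l a K).
Local Notation vf := (vf l a K u).
Local Notation vx := (vx l a K u).
Local Notation vt := (vt l a K u).
Local Notation vxx := (vxx l a K u).
Local Notation Gf := (@Gf R d l a K).
Local Notation Gx := (@Gx R d l a K).
Local Notation Gt := (@Gt R d l a K).
Local Notation Tf := (Tf l a K u).
Local Notation Nf := (Nf l a K u).
Local Notation dspace_flux := (dspace_flux l a K u).
Local Notation dtime_flux := (dtime_flux l a K u).

(** [Ff] is the multiplier [F], and [zeroth_coef] the coefficient [W]. *)
Definition Ff z : R := \sum_i Phixx i i z + Mf z.

Definition zeroth_coef z : R :=
  2 * Gf z * Ff z + 2 * (\sum_i Gx i z * Phix i z) - Gt z + \sum_i Mxx i z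
  - Ff z ^+ 2.

Lemma divergence_of_flux z :
  2 * (\sum_i vxx i i z + Gf z * vf z) * (vt z - 2 * Tf z + Mf z * vf z)
  - (\sum_i dspace_flux i z + dtime_flux z)
  = 4 * (\sum_i \sum_j Phixx i j z * vx i z * vx j z) - 2 * Ff z * Nf z
    + vf z ^+ 2 * (zeroth_coef z + Ff z ^+ 2).
Proof.
rewrite [zeroth_coef z + _]subrK.
exact: (@divergence_identity R n (Phix^~ z) (vx^~ z) (vxt l a K u ^~ z) (Gx^~ z)
  (Mx^~ z) (Mxx^~ z) (fun i j => Phixx i j z) (fun i j => vxx i j z)
  (vf z) (vt z) (Gf z) (Gt z) (Mf z)
  (fun i j => PhixxC l a K i j z) (fun i j => vxxC l a K smooth_u i j z)).
Qed.

Lemma conjugated_operator z :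
  expR (Phi z) * ('D_dir_t u z + \sum_i 'D_(dir_x i) ('D_(dir_x i) u) z) =
  \sum_i vxx i i z + Gf z * vf z
  + (vt z - 2 * Tf z - (\sum_i Phixx i i z) * vf z).
Proof.
rewrite /vf /vt /Tf /Gf /vx /vxx.
move: (expR (Phi z)) (u z) ('D_dir_t u z) (Phit z) => w u0 ut pt.
have -> : \sum_i w * ('D_(dir_x i) ('D_(dir_x i) u) z + Phix i z * 'D_(dir_x i) u z
    + Phixx i i z * u0 + Phix i z * ('D_(dir_x i) u z + Phix i z * u0)) =
  w * (\sum_i 'D_(dir_x i) ('D_(dir_x i) u) z) + 2 * w * (\sum_i Phix i z * 'D_(dir_x i) u z)
  + w * u0 * (\sum_i Phixx i i z) + w * u0 * (\sum_i Phix i z * Phix i z).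
  rewrite !mulr_sumr -!big_split; apply: eq_bigr => i _ /=.
  by move: ('D_(dir_x i) ('D_(dir_x i) u) z) ('D_(dir_x i) u z) (Phix i z) (Phixx i i z);
    move=> *; ring.
have -> : \sum_i Phix i z * (w * ('D_(dir_x i) u z + Phix i z * u0)) =
  w * (\sum_i Phix i z * 'D_(dir_x i) u z) + w * u0 * (\sum_i Phix i z * Phix i z).
  rewrite !mulr_sumr -!big_split; apply: eq_bigr => i _ /=.
  by move: ('D_(dir_x i) u z) (Phix i z); move=> *; ring.
move: (\sum_i 'D_(dir_x i) ('D_(dir_x i) u) z) (\sum_i Phix i z * 'D_(dir_x i) u z)
  (\sum_i Phixx i i z) (\sum_i Phix i z * Phix i z) => *; ring.
Qed.

Lemma sum_Phixx z (F : 'I_n -> R) :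
  \sum_i \sum_j Phixx i j z * F i * F j =
  time_factor a K z.2 * (\sum_i \sum_j mono_hess l i j z.1 * F i * F j)
  - 1 / 8 * (z.2)^-1 * \sum_i F i * F i.
Proof.
rewrite !mulr_sumr -sumrB; apply: eq_bigr => i _.
have -> : F i * F i = F i * \sum_j kdelta i j * F j by rewrite sum_kdelta.
rewrite !mulr_sumr -sumrB.
by apply: eq_bigr => j _; rewrite /Phixx; move: (z.2)^-1 => b; ring.
Qed.

(** Returning from [v] to [u] uses
    [e^(2 Phi) |grad u|^2 <= 2 |grad v|^2 + 2 v^2 |grad Phi|^2], whence the bound
    required of the zeroth order coefficient. *)
Lemma carleman_pointwise z : dom z -> 0 <= time_factor a K z.2 -> 1 <= (z.2)^-1 ->
  (forall p q, 0 <= mono_eval (mono_dx1 (mono_dx1 l)) z.1 * p ^+ 2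
     + 2 * mono_eval (mono_dx1 (mono_dsq l)) z.1 * p * q
     + mono_eval (mono_dsq (mono_dsq l)) z.1 * q ^+ 2) ->
  1 + 2 * (\sum_i Phix i z * Phix i z) <= zeroth_coef z ->
  expR (Phi z) ^+ 2 * (u z ^+ 2 + \sum_i 'D_(dir_x i) u z ^+ 2)
    + (\sum_i dspace_flux i z + dtime_flux z)
  <= (expR (Phi z) * ('D_dir_t u z + \sum_i 'D_(dir_x i) ('D_(dir_x i) u) z)) ^+ 2.
Proof.
move=> dz s0 b1 quad hW; have [x0 _] := dz.
have hdiv := divergence_of_flux z.
rewrite conjugated_operator.
have hF : Ff z = 2 * time_factor a K z.2 * mono_eval (mono_dsq l) z.1 - 2 * (z.2)^-1.
  exact: Phixx_trace.
have hsum := sum_Phixx z (vx^~ z).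
have hh := sum_hess l z.1 (vx^~ z).
have hq := quad (vx ord0 z) (\sum_i z.1 ord0 i * vx i z).
have hgrad : expR (Phi z) ^+ 2 * (u z ^+ 2 + \sum_i 'D_(dir_x i) u z ^+ 2) <=
    vf z ^+ 2 + 2 * Nf z + 2 * vf z ^+ 2 * (\sum_i Phix i z * Phix i z).
  rewrite mulrDr -exprMn -addrA lerD2l /Nf !mulr_sumr -big_split.
  apply: ler_sum => i _ /=; rewrite -exprMn /vf /vx.
  move: (expR (Phi z)) ('D_(dir_x i) u z) (Phix i z) (u z) => w g p u0.
  rewrite -subr_ge0; suff -> : 2 * (w * (g + p * u0) * (w * (g + p * u0)))
     + 2 * (w * u0) ^+ 2 * (p * p) - (w * g) ^+ 2 = (w * (g + 2 * p * u0)) ^+ 2.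
    exact: sqr_ge0.
  by ring.
have N0 : 0 <= Nf z by apply: sumr_ge0 => i _; rewrite -expr2 sqr_ge0.
have hM : Mf z = Ff z - \sum_i Phixx i i z by rewrite /Ff addrC addKr.
move: hdiv hW hgrad; rewrite hsum hh -/(Nf z) hF hM hF.
move: hq N0 b1 s0.
move: (Nf z) (vf z) (vt z) (Tf z) (Gf z) (\sum_i vxx i i z) (\sum_i Phixx i i z)
  (\sum_i Phix i z * Phix i z) (zeroth_coef z) (\sum_i dspace_flux i z + dtime_flux z)
  (expR (Phi z) ^+ 2 * _) (time_factor a K z.2) ((z.2)^-1) (mono_eval (mono_dsq l) z.1)
  (mono_eval (mono_dx1 (mono_dx1 l)) z.1 * _ + _ + _).
move=> N v w T G S L P W D Z s b f Q Q0 N0 b1 s0 E1 hW hg.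
exact: (complete_the_square Q0 N0 b1 s0 E1 hW hg).
Qed.

End carleman_pointwise.

(** * The zeroth order coefficient *)

(** Expansion of the zeroth order coefficient by powers of the time factors
    [s], [s1], [s2].  The letters [f1 e_1 + fs x] and [A, B, C, fs] stand for the
    gradient and Hessian of [phi], and the hypotheses are Euler's relations for
    functions of degree [al], [al - 1] and [al - 2]. *)
Lemma zeroth_coef_algebra (R : realFieldType)
    (al s s1 s2 b X rho f0 f1 fs A B C ML K : R) :
  f1 * X + fs * rho = al * f0 ->
  A * X + B * rho = (al - 1) * f1 ->
  B * X + C * rho = (al - 2) * fs ->
  let P := s * f1 in let Q := s * fs - b / 8 in
  let p0 := P + X * Q in let px := X * P + rho * Q in
  let PP := P * p0 + Q * px in
  let F := 2 * s * fs - 2 * b in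
  let Pt := - (s1 * f0) + (rho + K) / 16 * (b * b) in
  let Ptt := s2 * f0 - (rho + K) / 8 * (b * b * b) in
  let qq := f1 ^+ 2 + 2 * f1 * fs * X + fs ^+ 2 * rho in
  let q1 := f1 + fs * X in let qx := al * f0 in
  2 * (PP - Pt) * F
  + 4 * (s * (A * p0 ^+ 2 + 2 * B * p0 * px + C * px ^+ 2 + fs * PP) - 1 / 8 * b * PP)
  - 4 * (- s1 * f1 * p0 + (- s1 * fs + b * b / 8) * px) + Ptt + s * ML - F ^+ 2 =
  4 * s ^+ 3 * (A * q1 ^+ 2 + 2 * B * q1 * qx + C * qx ^+ 2 + 2 * fs * qq)
  + 4 * s * s1 * (qq + fs * f0)
  - s ^+ 2 * b * ((al + 7 / 2) * qq + fs * (al * f0)) - 4 * s ^+ 2 * fs ^+ 2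
  + (s2 - s1 * b * (al / 2 + 4)) * f0
  + s * b ^+ 2 * ((al ^+ 2 / 16 + 9 / 16 * al) * f0 - fs * (3 * rho + 4 * K) / 16)
  + 8 * s * fs * b + s * ML + 15 / 128 * (rho * b ^+ 3) + K * b ^+ 3 / 8 - 4 * b ^+ 2.
Proof.
move=> E0 E1 E2 P Q p0 px PP F Pt Ptt qq q1 qx.
have h0 : p0 = s * q1 - b / 8 * X by rewrite /p0 /P /Q /q1; ring.
have hx : px = s * qx - b / 8 * rho.
  by rewrite /px /qx -E0 /P /Q; ring.
have hP : PP = s ^+ 2 * qq - s * b / 4 * qx + b ^+ 2 / 64 * rho.
  by rewrite /PP h0 hx /qx -E0 /P /Q /qq /q1; field.
have hA : A * p0 ^+ 2 + 2 * B * p0 * px + C * px ^+ 2 =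
    s ^+ 2 * (A * q1 ^+ 2 + 2 * B * q1 * qx + C * qx ^+ 2)
    - s * b / 4 * ((al - 1) * qq - fs * qx)
    + b ^+ 2 / 64 * (al * (al - 1) * f0 - fs * rho).
  have e1 : (al - 1) * qq - fs * qx = q1 * ((al - 1) * f1) + qx * ((al - 2) * fs).
    by rewrite /qq /q1 /qx -E0; ring.
  have e2 : al * (al - 1) * f0 - fs * rho = X * ((al - 1) * f1) + rho * ((al - 2) * fs).
    by rewrite [al * _ * _]mulrAC -E0; ring.
  by rewrite e1 e2 -E1 -E2 h0 hx; field.
rewrite hA.
have hT : - s1 * f1 * p0 + (- s1 * fs + b * b / 8) * px =
    - s1 * (s * qq - b / 8 * qx) + b ^+ 2 / 8 * px.
  by rewrite h0 hx /qq /q1 /qx -E0; field.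
rewrite hT hx hP /F /Pt /Ptt /qx.
by clearbody q1 qq; clear; field.
Qed.

Section zeroth_coef.
Context {R : realType} {d : nat}.
Local Notation n := d.+1.
Local Notation V := ('rV[R]_n * R)%type.
Local Notation mono_lap := (@mono_lap R d).
Local Notation kdelta := (@kdelta R d).
Variables (l : seq (R * R * R)) (a K al : R).
Implicit Types (z : V) (x : 'rV[R]_n).

Lemma euler_identity (D : R) l' x : 0 < x ord0 ord0 -> homog D l' ->
  x ord0 ord0 * mono_eval (mono_dx1 l') x + sqnorm x * mono_eval (mono_dsq l') x =
  D * mono_eval l' x.
Proof.
move=> x0; have r0 := sqnorm_gt0 x0.
elim: l' => [|[[c k] p] l' IH].
  by rewrite /mono_eval !big_nil !mulr0 addr0.
rewrite /homog /= => /andP[/eqP hD /IH {}IH].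
have cons_E (q : R * R * R) r : mono_eval (q :: r) x =
    q.1.1 * x ord0 ord0 `^ q.1.2 * sqnorm x `^ q.2 + mono_eval r x.
  by rewrite /mono_eval big_cons.
rewrite /mono_dx1 /mono_dsq /= !cons_E -/(mono_dx1 l') -/(mono_dsq l').
have hX : x ord0 ord0 * x ord0 ord0 `^ (k - 1) = x ord0 ord0 `^ k.
  rewrite -{1}(powRr1 (ltW x0)) -powRD; last by rewrite (lt0r_neq0 x0) implybT.
  by congr (_ `^ _); ring.
have hr : sqnorm x * sqnorm x `^ (p - 1) = sqnorm x `^ p.
  rewrite -{1}(powRr1 (ltW r0)) -powRD; last by rewrite (lt0r_neq0 r0) implybT.
  by congr (_ `^ _); ring.
rewrite /=; transitivity (c * k * (x ord0 ord0 * x ord0 ord0 `^ (k - 1)) * sqnorm x `^ p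
  + 2 * c * p * x ord0 ord0 `^ k * (sqnorm x * sqnorm x `^ (p - 1))
  + (x ord0 ord0 * mono_eval (mono_dx1 l') x + sqnorm x * mono_eval (mono_dsq l') x)).
  by ring.
by rewrite hX hr IH -hD; ring.
Qed.

Lemma zeroth_coefE z (P := time_factor a K z.2 * mono_eval (mono_dx1 l) z.1)
    (Q := time_factor a K z.2 * mono_eval (mono_dsq l) z.1 - (z.2)^-1 / 8)
    (p0 := P + z.1 ord0 ord0 * Q) (px := z.1 ord0 ord0 * P + sqnorm z.1 * Q)
    (PP := P * p0 + Q * px)
    (F := 2 * time_factor a K z.2 * mono_eval (mono_dsq l) z.1 - 2 * (z.2)^-1) :
  dom z ->
  \sum_i Phix l a K i z * Phix l a K i z = PP /\
  zeroth_coef l a K z = 2 * (PP - Phit l a K z) * F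
  + 4 * (time_factor a K z.2 * (mono_eval (mono_dx1 (mono_dx1 l)) z.1 * p0 ^+ 2
      + 2 * mono_eval (mono_dx1 (mono_dsq l)) z.1 * p0 * px
      + mono_eval (mono_dsq (mono_dsq l)) z.1 * px ^+ 2
      + mono_eval (mono_dsq l) z.1 * PP) - 1 / 8 * (z.2)^-1 * PP)
  - 4 * (- time_factor1 a K z.2 * mono_eval (mono_dx1 l) z.1 * p0
         + (- time_factor1 a K z.2 * mono_eval (mono_dsq l) z.1 + (z.2)^-1 * (z.2)^-1 / 8) * px)
  + Phitt l a K z + time_factor a K z.2 * mono_eval (mono_lap (@multiplier_monomials R d l)) z.1 - F ^+ 2.
Proof.
move=> dz; have [x0 t0] := dz.
have lin (p : 'I_n -> R) (c e : R) :
    (forall i, p i = kdelta ord0 i * c + z.1 ord0 i * e) ->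
    forall G : 'I_n -> R, \sum_i G i * p i = c * G ord0 + e * \sum_i z.1 ord0 i * G i.
  move=> pE G; rewrite -(sum_kdelta ord0 G) !mulr_sumr -big_split.
  by apply: eq_bigr => i _ /=; rewrite pE; ring.
have hp i : Phix l a K i z = kdelta ord0 i * P + z.1 ord0 i * Q.
  by rewrite /Phix /mono_grad /P /Q; move: (z.2)^-1 => b; field.
have hpt i : Phixt l a K i z = kdelta ord0 i * (- time_factor1 a K z.2 * mono_eval (mono_dx1 l) z.1)
    + z.1 ord0 i * (- time_factor1 a K z.2 * mono_eval (mono_dsq l) z.1 + (z.2)^-1 * (z.2)^-1 / 8).
  by rewrite /Phixt /mono_grad; move: (z.2)^-1 => b; field.
have e0 : Phix l a K ord0 z = p0 by rewrite hp kdeltaii mul1r.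
have epx : \sum_i z.1 ord0 i * Phix l a K i z = px.
  rewrite (lin _ _ _ hp) /px mulrC /sqnorm; congr (_ + _).
  by rewrite [RHS]mulrC; congr (_ * _); apply: eq_bigr => i _; rewrite expr2.
have eP : \sum_i Phix l a K i z * Phix l a K i z = PP.
  by rewrite (lin _ _ _ hp) e0 epx.
split=> //.
have eF : Ff l a K z = F by exact: Phixx_trace.
have eT : \sum_i Phix l a K i z * Phixt l a K i z =
    - time_factor1 a K z.2 * mono_eval (mono_dx1 l) z.1 * p0
    + (- time_factor1 a K z.2 * mono_eval (mono_dsq l) z.1 + (z.2)^-1 * (z.2)^-1 / 8) * px.
  by rewrite (lin _ _ _ hpt) e0 epx.
have eM : \sum_i Mxx l a K i z = time_factor a K z.2 * mono_eval (mono_lap (@multiplier_monomials R d l)) z.1.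
  by rewrite /Mxx -mulr_sumr mono_hess_trace.
have eG : \sum_i Gx l a K i z * Phix l a K i z =
    2 * (\sum_i \sum_j Phixx l a K i j z * Phix l a K i z * Phix l a K j z)
    - \sum_i Phix l a K i z * Phixt l a K i z.
  rewrite mulr_sumr -sumrB; apply: eq_bigr => i _; rewrite /Gx mulrDl.
  congr (_ + _); last by rewrite mulNr mulrC.
  rewrite -mulrA mulr_suml; congr (_ * _); apply: eq_bigr => j _.
  by rewrite PhixxC; move: (Phix l a K i z) (Phix l a K j z) => *; ring.
have eH := sum_Phixx l a K z (Phix l a K ^~ z).
have eHH := sum_hess l z.1 (Phix l a K ^~ z).
rewrite e0 epx eP in eHH; rewrite eHH eP in eH.
rewrite /zeroth_coef eM eF eG /Gt eT eH /Gf eP.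
move: (Phit l a K z) (Phitt l a K z) => pt ptt.
by clearbody PP p0 px F; ring.
Qed.

End zeroth_coef.

(** The terms without a sign are at most quadratic in [y = s w] and [v = r b].
    The term [s s1] contributes [4 c0 K b y^2], and the Gaussian part of the
    phase contributes [(15/128) b v^2]; together they absorb the others, and the
    threshold on [K] is the condition on the discriminant.  The letter [w] is
    [|x|^(al - 1)]. *)
Lemma zeroth_coef_lower (R : realFieldType)
    (al s s1 s2 b r w f0 fs ML K HB qq PP c0 c2 c3 c4 : R) :
  1 < al < 2 -> 0 <= s -> 1 <= b -> 1 <= r -> 0 < w -> 0 < c0 ->
  0 <= c2 -> 0 <= c3 -> 0 <= c4 ->
  40 + (15 / 2 * c2 + 4 * c3 ^+ 2 + 3 * (8 * c3 + c4) ^+ 2) / (4 * c0) <= K ->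
  K * s * b <= s1 -> s2 = s1 * ((K + 1) * b) ->
  0 <= f0 -> fs <= 0 -> - (c3 * w) <= fs -> - (c4 * (w * r)) <= ML ->
  0 <= qq -> qq <= c2 * w ^+ 2 -> c0 * w ^+ 2 <= qq + fs * f0 -> 0 <= HB ->
  PP = s ^+ 2 * qq - s * b / 4 * (al * f0) + b ^+ 2 / 64 * r ^+ 2 ->
  1 + 2 * PP <=
  4 * s ^+ 3 * HB + 4 * s * s1 * (qq + fs * f0)
  - s ^+ 2 * b * ((al + 7 / 2) * qq + fs * (al * f0)) - 4 * s ^+ 2 * fs ^+ 2
  + (s2 - s1 * b * (al / 2 + 4)) * f0
  + s * b ^+ 2 * ((al ^+ 2 / 16 + 9 / 16 * al) * f0 - fs * (3 * r ^+ 2 + 4 * K) / 16)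
  + 8 * s * fs * b + s * ML + 15 / 128 * (r ^+ 2 * b ^+ 3) + K * b ^+ 3 / 8 - 4 * b ^+ 2.
Proof.
move=> /andP[al1 al2] s0 b1 r1 w0 c00 c20 c30 c40 hK hs1 -> f00 fs0 hfs hML qq0 hqq hc HB0 ->.
have b0 : 0 <= b by apply: le_trans b1.
have r0 : 0 <= r by apply: le_trans r1.
have al0 : 0 <= al by apply: ltW; apply: lt_trans al1.
pose c5 := 15 / 2 * c2 + 4 * c3 ^+ 2; pose c6 := 8 * c3 + c4.
have c50 : 0 <= c5 by rewrite addr_ge0// mulr_ge0// exprn_ge0.
have c60 : 0 <= c6 by rewrite addr_ge0// mulr_ge0.
have K40 : 40 <= K.
  apply: le_trans hK; rewrite lerDl divr_ge0//; last by rewrite mulr_ge0// ltW.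
  by rewrite addr_ge0// mulr_ge0// sqr_ge0.
have K0 : 0 <= K by apply: le_trans K40.
have hK' : c5 + 3 * c6 ^+ 2 <= 4 * c0 * K.
  have c4p : 0 < 4 * c0 by rewrite mulr_gt0.
  rewrite [leRHS]mulrC -ler_pdivrMr//; apply: le_trans hK; rewrite lerDr//; exact: ltW.
have s10 : 0 <= s1 by apply: le_trans hs1; rewrite !mulr_ge0.
pose y := s * w; have y0 : 0 <= y by rewrite mulr_ge0// ltW.
pose v := r * b; have v0 : 0 <= v by rewrite mulr_ge0.
have bb : 1 <= b ^+ 2 by rewrite exprn_ege1.
have bbb : b ^+ 2 <= b ^+ 3 by rewrite [leRHS]exprS ler_peMl// sqr_ge0.
have b3 : 1 <= b ^+ 3 by rewrite exprn_ege1.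
have ss0 : 0 <= s ^+ 2 by exact: sqr_ge0.
(* terms with the right sign, which are dropped *)
have t1 : 0 <= 4 * s ^+ 3 * HB by rewrite !mulr_ge0// exprn_ge0.
have t2 : s ^+ 2 * b * (fs * (al * f0)) <= 0.
  by rewrite mulr_ge0_le0 ?mulr_ge0// mulr_le0_ge0// mulr_ge0.
have t3 : 0 <= (s1 * ((K + 1) * b) - s1 * b * (al / 2 + 4)) * f0.
  have -> : s1 * ((K + 1) * b) - s1 * b * (al / 2 + 4) = s1 * b * (K - 3 - al / 2) by ring.
  rewrite !mulr_ge0//; clear -K40 al2; lra.
have t4 : 0 <= s * b ^+ 2 *
    ((al ^+ 2 / 16 + 9 / 16 * al) * f0 - fs * (3 * r ^+ 2 + 4 * K) / 16).
  apply: mulr_ge0; first by rewrite mulr_ge0// sqr_ge0.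
  rewrite -!mulNr; apply: addr_ge0; first by rewrite mulr_ge0// addr_ge0 ?divr_ge0 ?sqr_ge0// mulr_ge0// divr_ge0.
  by rewrite divr_ge0// mulr_ge0 ?oppr_ge0// addr_ge0// mulr_ge0// sqr_ge0.
have t5 : 0 <= s * b / 4 * (al * f0) by rewrite !mulr_ge0.
(* terms compared with y^2, y v and v^2 *)
have u1 : 4 * c0 * K * (b * y ^+ 2) <= 4 * s * s1 * (qq + fs * f0).
  have -> : 4 * c0 * K * (b * y ^+ 2) = 4 * s * (K * s * b) * (c0 * w ^+ 2).
    by rewrite /y; ring.
  apply: ler_pM => //; first by rewrite !mulr_ge0.
    by rewrite mulr_ge0 ?sqr_ge0// ltW.
  by rewrite ler_wpM2l// mulr_ge0.
have u2 : s ^+ 2 * b * ((al + 7 / 2) * qq) + 2 * (s ^+ 2 * qq)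
    <= 15 / 2 * c2 * (b * y ^+ 2).
  have -> : 15 / 2 * c2 * (b * y ^+ 2) = 15 / 2 * (s ^+ 2 * b * (c2 * w ^+ 2)).
    by rewrite /y; ring.
  have h : s ^+ 2 * b * qq <= s ^+ 2 * b * (c2 * w ^+ 2) by rewrite ler_wpM2l// mulr_ge0.
  have h1 : s ^+ 2 * qq <= s ^+ 2 * b * qq.
    by rewrite [leRHS]mulrAC ler_peMr// mulr_ge0.
  have h2 : (al + 7 / 2) * (s ^+ 2 * b * qq) <= 11 / 2 * (s ^+ 2 * b * qq).
    by rewrite ler_wpM2r ?mulr_ge0//; clear -al2; lra.
  have -> : s ^+ 2 * b * ((al + 7 / 2) * qq) = (al + 7 / 2) * (s ^+ 2 * b * qq) by ring.
  by clear -h h1 h2; lra.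
have fsq : fs ^+ 2 <= (c3 * w) ^+ 2.
  by rewrite -sqrrN lerXn2r ?nnegrE ?oppr_ge0// ?mulr_ge0 ?(ltW w0)// lerNl.
have u3 : 4 * s ^+ 2 * fs ^+ 2 <= 4 * c3 ^+ 2 * (b * y ^+ 2).
  have -> : 4 * c3 ^+ 2 * (b * y ^+ 2) = b * (4 * s ^+ 2 * (c3 * w) ^+ 2).
    by rewrite /y; ring.
  apply: (@le_trans _ _ (4 * s ^+ 2 * (c3 * w) ^+ 2)); first by rewrite ler_wpM2l// mulr_ge0.
  by rewrite ler_peMl// mulr_ge0 ?sqr_ge0// mulr_ge0.
have bw : 1 <= r * b by rewrite mulr_ege1.
have u4 : - (8 * c3 * (b * (y * v))) <= 8 * s * fs * b.
  have h : - (8 * s * b * (c3 * w)) <= 8 * s * fs * b.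
    rewrite -mulrN [leRHS]mulrAC ler_wpM2l// !mulr_ge0//.
  apply: le_trans h; rewrite lerN2.
  have -> : 8 * c3 * (b * (y * v)) = 8 * s * b * (c3 * w) * (r * b) by rewrite /y /v; ring.
  by rewrite ler_peMr// !mulr_ge0// ltW.
have u5 : - (c4 * (b * (y * v))) <= s * ML.
  have h : - (s * (c4 * (w * r))) <= s * ML by rewrite -mulrN ler_wpM2l.
  apply: le_trans h; rewrite lerN2.
  have -> : c4 * (b * (y * v)) = s * (c4 * (w * r)) * b ^+ 2 by rewrite /y /v; ring.
  by rewrite ler_peMr// !mulr_ge0// ltW.
have u6 : r ^+ 2 * b ^+ 3 = b * v ^+ 2 by rewrite /v; ring.
have u7 : b ^+ 2 * r ^+ 2 <= b * v ^+ 2.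
  have -> : b * v ^+ 2 = b * (b ^+ 2 * r ^+ 2) by rewrite /v; ring.
  by rewrite ler_peMl// mulr_ge0// sqr_ge0.
have u8 : 0 <= b * ((c5 + 3 * c6 ^+ 2) * y ^+ 2 - c5 * y ^+ 2 - c6 * (y * v)
    + 11 / 128 * v ^+ 2).
  rewrite mulr_ge0//.
  have -> : (c5 + 3 * c6 ^+ 2) * y ^+ 2 - c5 * y ^+ 2 - c6 * (y * v) + 11 / 128 * v ^+ 2
    = 11 / 128 * (v - 64 / 11 * c6 * y) ^+ 2 + 1 / 11 * (c6 * y) ^+ 2 by field.
  by rewrite addr_ge0// mulr_ge0// ?sqr_ge0// divr_ge0.
have u9 : (c5 + 3 * c6 ^+ 2) * (b * y ^+ 2) <= 4 * c0 * K * (b * y ^+ 2).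
  by rewrite ler_wpM2r// mulr_ge0// sqr_ge0.
have u10 : 40 * b ^+ 3 <= K * b ^+ 3 by rewrite ler_wpM2r// exprn_ge0.
have e5 : c5 * (b * y ^+ 2) = 15 / 2 * c2 * (b * y ^+ 2) + 4 * c3 ^+ 2 * (b * y ^+ 2).
  by rewrite /c5; ring.
have e6 : c6 * (b * (y * v)) = 8 * c3 * (b * (y * v)) + c4 * (b * (y * v)).
  by rewrite /c6; ring.
have e8 : b * ((c5 + 3 * c6 ^+ 2) * y ^+ 2 - c5 * y ^+ 2 - c6 * (y * v)
    + 11 / 128 * v ^+ 2) = (c5 + 3 * c6 ^+ 2) * (b * y ^+ 2) - c5 * (b * y ^+ 2)
   - c6 * (b * (y * v)) + 11 / 128 * (b * v ^+ 2) by ring.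
rewrite e8 in u8.
rewrite u6 (mulrDr (s ^+ 2 * b)) [b ^+ 2 / 64 * _]mulrAC.
move: t1 t2 t3 t4 t5 u1 u2 u3 u4 u5 u7 u8 u9 u10 e5 e6 bbb b3.
move: (s ^+ 2 * b * ((al + 7 / 2) * qq)) (s ^+ 2 * b * (fs * (al * f0)))
  (4 * s ^+ 3 * HB) (4 * s * s1 * (qq + fs * f0)) (4 * s ^+ 2 * fs ^+ 2)
  ((s1 * ((K + 1) * b) - s1 * b * (al / 2 + 4)) * f0)
  (s * b ^+ 2 * ((al ^+ 2 / 16 + 9 / 16 * al) * f0 - fs * (3 * r ^+ 2 + 4 * K) / 16))
  (8 * s * fs * b) (s * ML) (s * b / 4 * (al * f0)) (s ^+ 2 * qq)
  (4 * c0 * K * (b * y ^+ 2)) ((c5 + 3 * c6 ^+ 2) * (b * y ^+ 2))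
  (15 / 2 * c2 * (b * y ^+ 2)) (4 * c3 ^+ 2 * (b * y ^+ 2)) (c5 * (b * y ^+ 2))
  (8 * c3 * (b * (y * v))) (c4 * (b * (y * v))) (c6 * (b * (y * v)))
  (b * v ^+ 2) (b ^+ 2 * r ^+ 2) (K * b ^+ 3) (b ^+ 3) (b ^+ 2).
clear; move=> *; lra.
Qed.

(** * The phase of the cone *)

Section cone_phase.
Context {R : realType} {d : nat}.
Local Notation n := d.+1.
Local Notation V := ('rV[R]_n * R)%type.
Local Notation mono_lap := (@mono_lap R d).
Variables (m al E : R).
Implicit Types (z : V) (x : 'rV[R]_n).

(** The function [phi], with [E = eps^m]; see [phi_mono_eval]. *)
Definition phi_monomials : seq (R * R * R) :=
  [:: (1, m, (al - m) / 2); (- E, 0, al / 2)].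

Lemma homog_phi_monomials : homog al phi_monomials.
Proof.
by rewrite /homog /= andbT; apply/andP; split; apply/eqP; field.
Qed.

Lemma mono_value x (k p : R) : 0 < x ord0 ord0 ->
  x ord0 ord0 `^ k * sqnorm x `^ p =
  (x ord0 ord0 / enorm x) `^ k * enorm x `^ (k + 2 * p).
Proof.
move=> x0; have r0 : 0 < enorm x by apply: lt_le_trans x0 (le_enorm x ord0).
rewrite sqnormE -powR_mulrn ?enorm_ge0// -powRrM.
have {1}-> : x ord0 ord0 = (x ord0 ord0 / enorm x) * enorm x by rewrite divfK ?gt_eqF.
rewrite powRM ?(ltW r0) ?(ltW (divr_gt0 x0 r0))// -mulrA -powRD//.
by rewrite (lt0r_neq0 r0) implybT.
Qed.

Lemma phi_mono_eval x : 0 < x ord0 ord0 ->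
  enorm x `^ al * ((x ord0 ord0 / enorm x) `^ m - E) = mono_eval phi_monomials x.
Proof.
move=> x0; rewrite /mono_eval /phi_monomials !big_cons big_nil /= mul1r addr0.
rewrite mono_value// powRr0 mulr1.
have r0 : 0 < enorm x by apply: lt_le_trans x0 (le_enorm x ord0).
rewrite sqnormE -powR_mulrn ?enorm_ge0// -powRrM.
have -> : m + 2 * ((al - m) / 2) = al by field.
have -> : 2%:R * (al / 2) = al by field.
by ring.
Qed.

Lemma phi_monomials_values x (r := enorm x) (c := x ord0 ord0 / r) (w := r `^ (al - 1))
    (z := c `^ m) : 0 < x ord0 ord0 ->
  [/\ mono_eval phi_monomials x = w * r * (z - E),
      mono_eval (mono_dx1 phi_monomials) x = w * m * z / c &
      mono_eval (mono_dsq phi_monomials) x = w / r * ((al - m) * z - al * E)] /\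
  [/\ mono_eval (mono_dx1 (mono_dx1 phi_monomials)) x = w / r * m * (m - 1) * z / c ^+ 2,
      mono_eval (mono_dx1 (mono_dsq phi_monomials)) x = w / r ^+ 2 * m * (al - m) * z / c &
      mono_eval (mono_dsq (mono_dsq phi_monomials)) x =
        w / r ^+ 3 * ((al - m) * (al - m - 2) * z - al * (al - 2) * E)].
Proof.
move=> x0; have r0 : 0 < r by apply: lt_le_trans x0 (le_enorm x ord0).
have c0 : 0 < c by rewrite divr_gt0.
have cn k : c `^ (k - 1) = c `^ k / c.
  by rewrite powRD ?(lt0r_neq0 c0) ?implybT// powR_inv1 ?ltW.
have rn k : r `^ (k - 1) = r `^ k / r.
  by rewrite powRD ?(lt0r_neq0 r0) ?implybT// powR_inv1 ?ltW.
have rp : r `^ al = w * r by rewrite /w rn divfK// lt0r_neq0.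
have cE k : c `^ (k - 1 - 1) = c `^ k / c / c by rewrite !cn.
have r1 : r `^ (al - 1) = w by [].
have r2 : r `^ (al - 2) = w / r.
  have -> : al - 2 = al - 1 - 1 by ring.
  by rewrite rn.
have r3 : r `^ (al - 3) = w / r / r.
  have -> : al - 3 = al - 2 - 1 by ring.
  by rewrite rn r2.
have r4 : r `^ (al - 4) = w / r / r / r.
  have -> : al - 4 = al - 3 - 1 by ring.
  by rewrite rn r3.
have rn0 := lt0r_neq0 r0; have cn0 := lt0r_neq0 c0.
have val c1 k1 p1 c2 k2 p2 :
    mono_eval [:: (c1, k1, p1); (c2, k2, p2)] x =
    c1 * (c `^ k1 * r `^ (k1 + 2 * p1)) + c2 * (c `^ k2 * r `^ (k2 + 2 * p2)).
  by rewrite /mono_eval !big_cons big_nil /= addr0 -!mulrA !mono_value.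
rewrite /mono_dx1 /mono_dsq /phi_monomials /= !val !cE !cn.
rewrite -/z !powRr0.
have -> : m + 2 * ((al - m) / 2) = al by field.
have -> : 0 + 2 * (al / 2) = al by field.
have -> : m - 1 + 2 * ((al - m) / 2) = al - 1 by field.
have -> : m + 2 * ((al - m) / 2 - 1) = al - 2 by field.
have -> : 0 + 2 * (al / 2 - 1) = al - 2 by field.
have -> : m - 1 - 1 + 2 * ((al - m) / 2) = al - 2 by field.
have -> : m - 1 + 2 * ((al - m) / 2 - 1) = al - 3 by field.
have -> : m + 2 * ((al - m) / 2 - 1 - 1) = al - 4 by field.
have -> : 0 + 2 * (al / 2 - 1 - 1) = al - 4 by field.
rewrite rp r1 r2 r3 r4 !mulr0 !mul0r !addr0.
clearbody w z c r; clear -rn0 cn0.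
by split; split; field; rewrite ?rn0 ?cn0.
Qed.

(** The Hessian of [phi] minus its transversal eigenvalue, as a form in
    [p = xi_1] and [q = x . xi]: completing the square leaves [q^2] with a
    coefficient that combines [(m - al) (m + al - 2)] and [al (2 - al) E]. *)
Lemma phase_hessian_psd (w r c z : R) (p q : R) :
  0 < w -> 0 < r -> 0 < c -> 0 < z -> 0 <= E -> 1 < al < 2 -> 2 < m ->
  0 <= w / r * m * (m - 1) * z / c ^+ 2 * p ^+ 2
    + 2 * (w / r ^+ 2 * m * (al - m) * z / c) * p * q
    + w / r ^+ 3 * ((al - m) * (al - m - 2) * z - al * (al - 2) * E) * q ^+ 2.
Proof.
move=> w0 r0 c0 z0 E0 /andP[al1 al2] m2.
have rn0 := lt0r_neq0 r0; have cn0 := lt0r_neq0 c0.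
have m1 : 0 < m - 1 by lra.
have -> : w / r * m * (m - 1) * z / c ^+ 2 * p ^+ 2
    + 2 * (w / r ^+ 2 * m * (al - m) * z / c) * p * q
    + w / r ^+ 3 * ((al - m) * (al - m - 2) * z - al * (al - 2) * E) * q ^+ 2 =
  w / r * (m / (m - 1) * z * ((m - 1) * p / c - (m - al) * q / r) ^+ 2
    + z * (m - al) * (m + al - 2) / (m - 1) * (q / r) ^+ 2
    + al * (2 - al) * E * (q / r) ^+ 2).
  by field; rewrite rn0 cn0 (lt0r_neq0 m1).
have h1 : 0 <= m / (m - 1) by rewrite divr_ge0//; lra.
have h2 : 0 <= (m - al) by lra.
have h3 : 0 <= m + al - 2 by lra.
have h4 : 0 <= al * (2 - al) by rewrite mulr_ge0//; lra.
rewrite mulr_ge0 ?divr_ge0 ?(ltW w0) ?(ltW r0)//.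
apply: addr_ge0; last by rewrite mulr_ge0 ?sqr_ge0// mulr_ge0.
apply: addr_ge0; first by rewrite mulr_ge0 ?sqr_ge0// mulr_ge0 ?(ltW z0).
by rewrite mulr_ge0 ?sqr_ge0// divr_ge0 ?(ltW m1)// !mulr_ge0 ?(ltW z0).
Qed.

Lemma phase_principal (w r c z y : R) (X := c * r) (rho := r ^+ 2)
    (tau := c ^- 2 - 1) (f0 := w * r * (z - E)) (f1 := w * m * z / c)
    (fs := w / r * ((al - m) * z - al * E))
    (qq := f1 ^+ 2 + 2 * f1 * fs * X + fs ^+ 2 * rho)
    (q1 := f1 + fs * X) (qx := al * f0) : r != 0 -> c != 0 -> E = z * (1 - y) ->
  [/\ w / r * m * (m - 1) * z / c ^+ 2 * q1 ^+ 2
      + 2 * (w / r ^+ 2 * m * (al - m) * z / c) * q1 * qx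
      + w / r ^+ 3 * ((al - m) * (al - m - 2) * z - al * (al - 2) * E) * qx ^+ 2
      + 2 * fs * qq = w ^+ 3 * z ^+ 3 / r * angular_form (al ^+ 2) m y tau,
   qq = w ^+ 2 * z ^+ 2 * (m ^+ 2 * tau + al ^+ 2 * y ^+ 2) &
   qq + fs * f0 = w ^+ 2 * z ^+ 2 *
     (al ^+ 2 * y ^+ 2 + m ^+ 2 * tau + y * (al * y - m))].
Proof.
move=> rn0 cn0 EE.
rewrite /qq /q1 /qx /f0 /f1 /fs /X /rho /tau /angular_form EE.
by split; field; rewrite ?rn0 ?cn0.
Qed.

End cone_phase.

Section phase_estimates.
Context {R : realType} {d : nat}.
Local Notation n := d.+1.
Local Notation V := ('rV[R]_n * R)%type.
Local Notation mono_lap := (@mono_lap R d).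
Implicit Types (z : V) (x : 'rV[R]_n).

Lemma time_weights (a K t : R) : 0 < a -> 0 < K -> 0 < t < 1 ->
  [/\ 0 <= time_factor a K t, 1 <= t^-1, K * time_factor a K t * t^-1 <= time_factor1 a K t &
      time_factor2 a K t = time_factor1 a K t * ((K + 1) * t^-1)].
Proof.
move=> a0 K0 /andP[t0 t1].
have tn0 := lt0r_neq0 t0.
have h1 : 1 <= t `^ (- K).
  rewrite powRN invf_ge1 ?powR_gt0//.
  apply: (@le_trans _ _ (1 `^ K)); last by rewrite powR1.
  by apply: ge0_ler_powR; rewrite ?nnegrE ?(ltW K0) ?(ltW t0) ?(ltW t1).
have e1 : t `^ (- K - 1) = t `^ (- K) * t^-1.
  by rewrite powRD ?tn0 ?implybT// powR_inv1 ?ltW.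
have e2 : t `^ (- K - 2) = t `^ (- K - 1) * t^-1.
  have -> : - K - 2 = - K - 1 - 1 by ring.
  by rewrite powRD ?tn0 ?implybT// powR_inv1 ?ltW.
split.
- by rewrite /time_factor mulr_ge0 ?(ltW a0)// subr_ge0.
- by rewrite invf_ge1 ?(ltW t1).
- rewrite /time_factor /time_factor1 e1 [leRHS]mulrA ler_wpM2r ?invr_ge0 ?(ltW t0)//.
  rewrite [a * K]mulrC -mulrA ler_wpM2l ?(ltW K0)// ler_wpM2l ?(ltW a0)//.
  by rewrite lerBlDr lerDl.
- by rewrite /time_factor2 /time_factor1 e2; ring.
Qed.

(** None of the constants of [zeroth_coef_lower] involves [a] or [K], so that [K]
    can be chosen before [a].  The number [5] bounds [(m - al) g + al E], where
    [m < 3], [al < 2] and [g], [E] are at most [1]. *)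
Lemma phase_estimates (gamma m eps0 eps : R) : cone_system gamma m eps0 ->
  0 < eps < eps0 -> eps <= 1 ->
  exists al K : R, [/\ 1 < al < 2, 0 < K &
    forall (a : R) z (l := phi_monomials m al (eps `^ m)), 0 < a -> 1 < z.1 ord0 ord0 ->
      eps * enorm z.1 <= z.1 ord0 ord0 -> 0 < z.2 < 1 ->
      (forall p q, 0 <= mono_eval (mono_dx1 (mono_dx1 l)) z.1 * p ^+ 2
         + 2 * mono_eval (mono_dx1 (mono_dsq l)) z.1 * p * q
         + mono_eval (mono_dsq (mono_dsq l)) z.1 * q ^+ 2) /\
      1 + 2 * (\sum_i Phix l a K i z * Phix l a K i z) <= zeroth_coef l a K z].
Proof.
move=> sys ee0 e1; have /andP[e0 _] := ee0.
have [[_ /andP[m2 m3] _] _] := sys.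
have m0 : 0 < m by lra.
have m2' : 2 < m by lra.
have [al [eta [alb eta0 H]]] := exponent_choice sys ee0 e1.
have /andP[al1 al2] := alb.
pose E := eps `^ m; have E0 : 0 < E by exact: powR_gt0.
pose l := phi_monomials m al E.
have hl : homog al l by exact: homog_phi_monomials.
have hlM : homog (al - 4) (mono_lap (@multiplier_monomials R d l)).
  have -> : al - 4 = al - 2 - 2 by ring.
  apply: homog_lap; apply: homog_cat; apply: homog_scale.
    exact: homog_dsq.
  exact: homog_lap.
have [c4 c40 Hc4] := @mono_eval_bound R d _ eps _ (introT andP (conj e0 e1)) hlM.
pose c0 := E ^+ 2 * eta.
have c00 : 0 < c0 by rewrite mulr_gt0// exprn_gt0.
pose c2 := m ^+ 2 * (eps ^- 2 - 1) + 4.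
have t00 : 0 <= eps ^- 2 - 1 by rewrite subr_ge0 -exprVn exprn_ege1// invf_ge1.
have c20 : 0 <= c2 by rewrite addr_ge0// mulr_ge0// sqr_ge0.
pose K0 := 40 + (15 / 2 * c2 + 4 * 5 ^+ 2 + 3 * (8 * 5 + c4) ^+ 2) / (4 * c0).
have K0p : 0 < K0.
  rewrite ltr_pwDl// divr_ge0//; last by rewrite mulr_ge0// ltW.
  by rewrite addr_ge0// ?mulr_ge0 ?sqr_ge0// addr_ge0// mulr_ge0.
exists al, K0; split => //.
move=> a z l' a0 x1 xcone t01; rewrite {}/l' -/E -/l.
have /andP[t0 t1] := t01.
have x0 : 0 < z.1 ord0 ord0 by exact: lt_trans x1.
have dz : dom z by [].
pose r := enorm z.1; have r1 : 1 <= r.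
  by apply: ltW; apply: lt_le_trans x1 (le_enorm z.1 ord0).
have r0 : 0 < r by exact: lt_le_trans r1.
have rn0 := lt0r_neq0 r0.
pose c := z.1 ord0 ord0 / r.
have cb : eps <= c <= 1.
  by rewrite /c ler_pdivlMr// ler_pdivrMr// mul1r xcone le_enorm.
have /andP[ec c1] := cb; have cp : 0 < c by exact: lt_le_trans ec.
have cn0 := lt0r_neq0 cp.
pose w := r `^ (al - 1); have w0 : 0 < w by exact: powR_gt0.
pose g := c `^ m; have g0 : 0 < g by exact: powR_gt0.
have Eg : E <= g by apply: ge0_ler_powR; rewrite ?nnegrE ?(ltW m0) ?(ltW e0) ?(ltW cp).
have g1 : g <= 1.
  apply: (@le_trans _ _ (1 `^ m)); last by rewrite powR1.
  by apply: ge0_ler_powR; rewrite ?nnegrE ?(ltW m0) ?(ltW cp).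
pose y := 1 - (eps / c) `^ m.
have EE : E = g * (1 - y).
  have ec0 : 0 <= eps / c by rewrite ltW// divr_gt0.
  by rewrite /y subKr /g -(powRM m (ltW cp) ec0) [c * _]mulrC divfK.
have [HP HC] := H c cb; rewrite -/y in HP HC.
have [[v0 v1 vs] [vA vB vC]] := phi_monomials_values m al E x0.
rewrite -/r -/c -/w -/g -/l in v0 v1 vs vA vB vC.
split.
  by move=> p q; rewrite vA vB vC; apply: phase_hessian_psd => //; exact: ltW.
have [s0 b1 hs1 hs2] := time_weights a0 K0p t01.
have [eP ->] := zeroth_coefE l a K0 dz.
have Xr : z.1 ord0 ord0 = c * r by rewrite /c divfK.
have eu0 := euler_identity x0 hl.
have eu1 := euler_identity x0 (homog_dx1 hl).
have eu2 := euler_identity x0 (homog_dsq hl).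
have e0' : mono_eval (mono_dx1 l) z.1 * z.1 ord0 ord0 + mono_eval (mono_dsq l) z.1 * sqnorm z.1
  = al * mono_eval l z.1 by rewrite -eu0; ring.
have e1' : mono_eval (mono_dx1 (mono_dx1 l)) z.1 * z.1 ord0 ord0
   + mono_eval (mono_dx1 (mono_dsq l)) z.1 * sqnorm z.1 = (al - 1) * mono_eval (mono_dx1 l) z.1.
  by rewrite -eu1 mono_dC; ring.
have e2' : mono_eval (mono_dx1 (mono_dsq l)) z.1 * z.1 ord0 ord0
   + mono_eval (mono_dsq (mono_dsq l)) z.1 * sqnorm z.1 = (al - 2) * mono_eval (mono_dsq l) z.1.
  by rewrite -eu2; ring.
have [pB pq pC] := phase_principal m al w rn0 cn0 EE.
have sq : sqnorm z.1 = r ^+ 2 by exact: sqnormE.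
have := @zeroth_coef_algebra R al (time_factor a K0 z.2) (time_factor1 a K0 z.2) (time_factor2 a K0 z.2) (z.2)^-1
  (z.1 ord0 ord0) (sqnorm z.1) (mono_eval l z.1) (mono_eval (mono_dx1 l) z.1)
  (mono_eval (mono_dsq l) z.1) (mono_eval (mono_dx1 (mono_dx1 l)) z.1)
  (mono_eval (mono_dx1 (mono_dsq l)) z.1) (mono_eval (mono_dsq (mono_dsq l)) z.1)
  (mono_eval (mono_lap (@multiplier_monomials R d l)) z.1) K0 e0' e1' e2'.
rewrite /= /Phit /Phitt => ->.
rewrite eP vA vB vC v0 v1 vs sq Xr.
have rc : r * c != 0 by rewrite mulf_neq0.
apply: (@zeroth_coef_lower R al _ (time_factor1 a K0 z.2) _ _ r w _ _ _ K0 _ _ _ c0 c2 5 c4) => //.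
- by rewrite !mulr_ge0 ?(ltW w0) ?(ltW r0)// subr_ge0.
- rewrite mulr_ge0_le0 ?divr_ge0 ?(ltW w0) ?(ltW r0)//.
  have : (al - m) * g <= 0 by rewrite mulr_le0_ge0 ?(ltW g0)//; clear -al2 m2'; lra.
  have : 0 <= al * E by rewrite mulr_ge0 ?(ltW E0)//; clear -al1; lra.
  by clear; lra.
- have h5 : - ((al - m) * g - al * E) <= 5.
    have : (m - al) * g <= 3 * 1.
      by apply: ler_pM; rewrite ?(ltW g0)//; clear -al1 al2 m3 m2'; lra.
    have : al * E <= 2 * 1.
      by apply: ler_pM; rewrite ?(ltW E0) ?(le_trans Eg g1)//; clear -al1 al2; lra.
    by clear; lra.
  apply: (@le_trans _ _ (w / r * - 5)).
    rewrite mulrN lerN2 [5 * w]mulrC ler_wpM2r// ler_pdivrMr// ler_peMr//.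
    exact: ltW.
  by rewrite ler_wpM2l ?divr_ge0 ?(ltW w0) ?(ltW r0)// lerNl.
- have := Hc4 z.1 x0 xcone; rewrite -/r ler_norml => /andP[h _]; apply: le_trans h.
  rewrite lerN2 ler_wpM2l//.
  have -> : al - 4 = al - 1 - 3 by ring.
  rewrite powRD ?rn0 ?implybT// -/w ler_wpM2l ?(ltW w0)//.
  apply: (@le_trans _ _ 1) => //; rewrite powRN invf_le1 ?powR_gt0//.
  apply: (@le_trans _ _ (1 `^ 3)); first by rewrite powR1.
  by apply: ge0_ler_powR; rewrite ?nnegrE ?(ltW r0).
- rewrite pq; apply: mulr_ge0; first by rewrite mulr_ge0// sqr_ge0.
  by rewrite addr_ge0// mulr_ge0 ?sqr_ge0// subr_ge0 -exprVn exprn_ege1// invf_ge1.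
- rewrite pq [c2 * _]mulrC -mulrA ler_wpM2l ?sqr_ge0//.
  have y1 : y <= 1 by rewrite /y gerBl powR_ge0.
  have y0 : 0 <= y.
    by rewrite -(pmulr_rge0 _ g0); move: Eg; rewrite EE; clear; lra.
  have tau0 : 0 <= c ^- 2 - 1 by rewrite subr_ge0 -exprVn exprn_ege1// invf_ge1.
  rewrite -[leRHS]mul1r; apply: ler_pM.
  - exact: sqr_ge0.
  - by rewrite addr_ge0// mulr_ge0// sqr_ge0.
  - by rewrite exprn_ile1// ltW.
  - rewrite lerD//.
      rewrite ler_wpM2l ?sqr_ge0// lerD2r -!exprVn.
      by rewrite lerXn2r ?nnegrE ?invr_ge0 ?(ltW cp) ?(ltW e0)// lef_pV2 ?posrE.
    rewrite -exprMn; have -> : (4 : R) = 2 ^+ 2 by ring.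
    rewrite lerXn2r ?nnegrE ?mulr_ge0 ?(le_trans ler01 (ltW al1))//.
    by rewrite -[leRHS]mulr1 ler_pM ?(le_trans ler01 (ltW al1))// ltW.
- rewrite pC /c0 [leLHS]mulrC -mulrA ler_wpM2l ?sqr_ge0// ler_pM ?sqr_ge0 ?(ltW eta0)//.
  by rewrite lerXn2r ?nnegrE ?(ltW E0) ?(ltW g0).
- rewrite pB mulr_ge0// divr_ge0 ?(ltW r0)// mulr_ge0// exprn_ge0// ltW//.
- by move: (z.2)^-1 => b; field; rewrite ?rn0 ?cn0.
Qed.

End phase_estimates.

(** * Integration of the pointwise inequality *)

Section flux_integral.
Context {R : realType} {d : nat}.
Local Notation n := d.+1.
Local Notation V := ('rV[R]_n * R)%type.
Local Notation kdelta := (@kdelta R d).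
Local Notation dir_x := (@dir_x R d).
Local Notation dir_t := (@dir_t R d).
Variables (l : seq (R * R * R)) (a K : R) (u : V -> R).
Hypothesis smooth_u : Ck 3 u.
Implicit Types (z e : V) (i j : 'I_n).

Local Notation Phi := (@Phi R d l a K).
Local Notation Phix := (@Phix R d l a K).
Local Notation Phit := (@Phit R d l a K).
Local Notation Phixx := (@Phixx R d l a K).
Local Notation Phixt := (@Phixt R d l a K).
Local Notation Phitt := (@Phitt R d l a K).
Local Notation Mf := (@Mf R d l a K).
Local Notation Mx := (@Mx R d l a K).
Local Notation Mxx := (@Mxx R d l a K).
Local Notation vf := (vf l a K u).
Local Notation vx := (vx l a K u).
Local Notation vt := (vt l a K u).
Local Notation vxx := (vxx l a K u).
Local Notation vxt := (vxt l a K u).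
Local Notation Gf := (@Gf R d l a K).
Local Notation Gx := (@Gx R d l a K).
Local Notation Gt := (@Gt R d l a K).
Local Notation Tf := (Tf l a K u).
Local Notation Nf := (Nf l a K u).
Local Notation Tx := (Tx l a K u).
Local Notation Nx := (Nx l a K u).
Local Notation Nt := (Nt l a K u).
Local Notation space_flux := (space_flux l a K u).
Local Notation time_flux := (time_flux l a K u).
Local Notation dspace_flux := (dspace_flux l a K u).
Local Notation dtime_flux := (dtime_flux l a K u).

Section continuity.
Variable z : V.
Hypothesis dz : dom z.

Let x0 : 0 < z.1 ord0 ord0. Proof. by case: dz. Qed.
Let t0 : 0 < z.2. Proof. by case: dz. Qed.

Lemma continuous_tinv : continuous_at z (fun y => (y.2)^-1).
Proof. by apply: for_continuousV; [exact: lt0r_neq0|exact: continuous_time]. Qed.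

Lemma continuous_tpow (p : R) : continuous_at z (fun y => y.2 `^ p).
Proof. by apply: for_continuous_powR => //; exact: continuous_time. Qed.

Lemma continuous_time_factor : continuous_at z (fun y => time_factor a K y.2).
Proof. rewrite /time_factor; continuity ltac:(exact: continuous_tpow). Qed.

Lemma continuous_time_factor1 : continuous_at z (fun y => time_factor1 a K y.2).
Proof. rewrite /time_factor1; continuity ltac:(exact: continuous_tpow). Qed.

Lemma continuous_time_factor2 : continuous_at z (fun y => time_factor2 a K y.2).
Proof. rewrite /time_factor2; continuity ltac:(exact: continuous_tpow). Qed.

Lemma continuous_mono_grad l' i : continuous_at z (fun y => mono_grad l' i y.1).
Proof.
rewrite /mono_grad.
continuity ltac:(first [exact: continuous_mono_eval | exact: continuous_coord]).
Qed.

Lemma continuous_mono_hess l' i j :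
  continuous_at z (fun y => mono_hess l' i j y.1).
Proof.
rewrite /mono_hess.
continuity ltac:(first [exact: continuous_mono_eval | exact: continuous_coord]).
Qed.

Ltac phase_leaf := idtac; lazymatch goal with
  | |- continuous_at _ (fun y => time_factor _ _ _) => exact: continuous_time_factor
  | |- continuous_at _ (fun y => time_factor1 _ _ _) => exact: continuous_time_factor1
  | |- continuous_at _ (fun y => time_factor2 _ _ _) => exact: continuous_time_factor2
  | |- continuous_at _ (fun y => (_)^-1) => exact: continuous_tinv
  | |- continuous_at _ (fun y => mono_grad _ _ _) => exact: continuous_mono_grad
  | |- continuous_at _ (fun y => mono_hess _ _ _ _) => exact: continuous_mono_hess
  | |- continuous_at _ (fun y => mono_eval _ _) => exact: continuous_mono_eval
  | |- continuous_at _ (fun y => sqnorm _) => exact: continuous_sqnorm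
  | |- continuous_at _ (fun y => fun_of_matrix _ _ _) => exact: continuous_coord
  end.

Lemma continuous_Phi : continuous_at z Phi.
Proof. rewrite /Phi; continuity phase_leaf. Qed.
Lemma continuous_Phix i : continuous_at z (Phix i).
Proof. rewrite /Phix; continuity phase_leaf. Qed.
Lemma continuous_Phit : continuous_at z Phit.
Proof. rewrite /Phit; continuity phase_leaf. Qed.
Lemma continuous_Phixx i j : continuous_at z (Phixx i j).
Proof. rewrite /Phixx; continuity phase_leaf. Qed.
Lemma continuous_Phixt i : continuous_at z (Phixt i).
Proof. rewrite /Phixt; continuity phase_leaf. Qed.
Lemma continuous_Phitt : continuous_at z Phitt.
Proof. rewrite /Phitt; continuity phase_leaf. Qed.
Lemma continuous_Mf : continuous_at z Mf.
Proof. rewrite /Mf; continuity phase_leaf. Qed.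
Lemma continuous_Mx i : continuous_at z (Mx i).
Proof. rewrite /Mx; continuity phase_leaf. Qed.
Lemma continuous_Mxx i : continuous_at z (Mxx i).
Proof. rewrite /Mxx; continuity phase_leaf. Qed.

Lemma continuous_weight : continuous_at z (fun y => expR (Phi y)).
Proof. by apply: for_continuous_expR; exact: continuous_Phi. Qed.

Ltac weighted_leaf := idtac; lazymatch goal with
  | |- continuous_at _ (fun y => expR _) => exact: continuous_weight
  | |- continuous_at _ (fun y => Phix _ y) => exact: continuous_Phix
  | |- continuous_at _ (Phix _) => exact: continuous_Phix
  | |- continuous_at _ (fun y => Phit y) => exact: continuous_Phit
  | |- continuous_at _ (Phit) => exact: continuous_Phit
  | |- continuous_at _ (fun y => Phixx _ _ y) => exact: continuous_Phixx
  | |- continuous_at _ (Phixx _ _) => exact: continuous_Phixx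
  | |- continuous_at _ (fun y => Phixt _ y) => exact: continuous_Phixt
  | |- continuous_at _ (Phixt _) => exact: continuous_Phixt
  | |- continuous_at _ (fun y => 'D__ ('D__ u) y) => exact: (d2u_continuous smooth_u)
  | |- continuous_at _ ('D__ ('D__ u)) => exact: (d2u_continuous smooth_u)
  | |- continuous_at _ (fun y => 'D__ u y) => exact: (du_continuous smooth_u)
  | |- continuous_at _ ('D__ u) => exact: (du_continuous smooth_u)
  | |- continuous_at _ (fun y => u y) => exact: (u_continuous smooth_u)
  | |- continuous_at _ (u) => exact: (u_continuous smooth_u)
  end.

Lemma continuous_vf : continuous_at z vf.
Proof. rewrite /vf; continuity weighted_leaf. Qed.
Lemma continuous_vx i : continuous_at z (vx i).
Proof. rewrite /vx; continuity weighted_leaf. Qed.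
Lemma continuous_vt : continuous_at z vt.
Proof. rewrite /vt; continuity weighted_leaf. Qed.
Lemma continuous_vxx i j : continuous_at z (vxx i j).
Proof. rewrite /vxx; continuity weighted_leaf. Qed.
Lemma continuous_vxt i : continuous_at z (vxt i).
Proof. rewrite /vxt; continuity weighted_leaf. Qed.

Ltac sum_leaf := idtac; lazymatch goal with
  | |- continuous_at _ (fun y => vx _ y) => exact: continuous_vx
  | |- continuous_at _ (vx _) => exact: continuous_vx
  | |- continuous_at _ (fun y => vxx _ _ y) => exact: continuous_vxx
  | |- continuous_at _ (vxx _ _) => exact: continuous_vxx
  | |- continuous_at _ (fun y => vxt _ y) => exact: continuous_vxt
  | |- continuous_at _ (vxt _) => exact: continuous_vxt
  | |- continuous_at _ (fun y => Phix _ y) => exact: continuous_Phix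
  | |- continuous_at _ (Phix _) => exact: continuous_Phix
  | |- continuous_at _ (fun y => Phixx _ _ y) => exact: continuous_Phixx
  | |- continuous_at _ (Phixx _ _) => exact: continuous_Phixx
  | |- continuous_at _ (fun y => Phixt _ y) => exact: continuous_Phixt
  | |- continuous_at _ (Phixt _) => exact: continuous_Phixt
  | |- continuous_at _ (fun y => Phit y) => exact: continuous_Phit
  | |- continuous_at _ (Phit) => exact: continuous_Phit
  | |- continuous_at _ (fun y => Phitt y) => exact: continuous_Phitt
  | |- continuous_at _ (Phitt) => exact: continuous_Phitt
  end.

Lemma continuous_Tf : continuous_at z Tf.
Proof.
apply: (@for_continuous_sum _ _ _ _ (fun j y => Phix j y * vx j y)) => j.
continuity sum_leaf.
Qed.
Lemma continuous_Nf : continuous_at z Nf.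
Proof.
apply: (@for_continuous_sum _ _ _ _ (fun j y => vx j y * vx j y)) => j.
continuity sum_leaf.
Qed.
Lemma continuous_Tx i : continuous_at z (Tx i).
Proof.
apply: (@for_continuous_sum _ _ _ _
  (fun j y => Phix j y * vxx j i y + vx j y * Phixx j i y)) => j.
continuity sum_leaf.
Qed.
Lemma continuous_Nx i : continuous_at z (Nx i).
Proof.
apply: for_continuousM; first exact: for_continuous_cst.
apply: (@for_continuous_sum _ _ _ _ (fun j y => vx j y * vxx j i y)) => j.
continuity sum_leaf.
Qed.
Lemma continuous_Nt : continuous_at z Nt.
Proof.
apply: for_continuousM; first exact: for_continuous_cst.
apply: (@for_continuous_sum _ _ _ _ (fun j y => vx j y * vxt j y)) => j.
continuity sum_leaf.
Qed.
Lemma continuous_Gf : continuous_at z Gf.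
Proof.
apply: for_continuousD; last by apply: for_continuousN; exact: continuous_Phit.
apply: (@for_continuous_sum _ _ _ _ (fun j y => Phix j y * Phix j y)) => j.
continuity sum_leaf.
Qed.
Lemma continuous_Gx i : continuous_at z (Gx i).
Proof.
apply: for_continuousD; last by apply: for_continuousN; exact: continuous_Phixt.
apply: for_continuousM; first exact: for_continuous_cst.
apply: (@for_continuous_sum _ _ _ _ (fun j y => Phix j y * Phixx j i y)) => j.
continuity sum_leaf.
Qed.
Lemma continuous_Gt : continuous_at z Gt.
Proof.
apply: for_continuousD; last by apply: for_continuousN; exact: continuous_Phitt.
apply: for_continuousM; first exact: for_continuous_cst.
apply: (@for_continuous_sum _ _ _ _ (fun j y => Phix j y * Phixt j y)) => j.
continuity sum_leaf.
Qed.

Ltac flux_leaf := idtac; lazymatch goal with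
  | |- continuous_at _ (fun y => vf y) => exact: continuous_vf
  | |- continuous_at _ (vf) => exact: continuous_vf
  | |- continuous_at _ (fun y => vt y) => exact: continuous_vt
  | |- continuous_at _ (vt) => exact: continuous_vt
  | |- continuous_at _ (fun y => vx _ y) => exact: continuous_vx
  | |- continuous_at _ (vx _) => exact: continuous_vx
  | |- continuous_at _ (fun y => vxx _ _ y) => exact: continuous_vxx
  | |- continuous_at _ (vxx _ _) => exact: continuous_vxx
  | |- continuous_at _ (fun y => vxt _ y) => exact: continuous_vxt
  | |- continuous_at _ (vxt _) => exact: continuous_vxt
  | |- continuous_at _ (fun y => Phix _ y) => exact: continuous_Phix
  | |- continuous_at _ (Phix _) => exact: continuous_Phix
  | |- continuous_at _ (fun y => Phixx _ _ y) => exact: continuous_Phixx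
  | |- continuous_at _ (Phixx _ _) => exact: continuous_Phixx
  | |- continuous_at _ (fun y => Tf y) => exact: continuous_Tf
  | |- continuous_at _ (Tf) => exact: continuous_Tf
  | |- continuous_at _ (fun y => Nf y) => exact: continuous_Nf
  | |- continuous_at _ (Nf) => exact: continuous_Nf
  | |- continuous_at _ (fun y => Tx _ y) => exact: continuous_Tx
  | |- continuous_at _ (Tx _) => exact: continuous_Tx
  | |- continuous_at _ (fun y => Nx _ y) => exact: continuous_Nx
  | |- continuous_at _ (Nx _) => exact: continuous_Nx
  | |- continuous_at _ (fun y => Nt y) => exact: continuous_Nt
  | |- continuous_at _ (Nt) => exact: continuous_Nt
  | |- continuous_at _ (fun y => Gf y) => exact: continuous_Gf
  | |- continuous_at _ (Gf) => exact: continuous_Gf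
  | |- continuous_at _ (fun y => Gx _ y) => exact: continuous_Gx
  | |- continuous_at _ (Gx _) => exact: continuous_Gx
  | |- continuous_at _ (fun y => Gt y) => exact: continuous_Gt
  | |- continuous_at _ (Gt) => exact: continuous_Gt
  | |- continuous_at _ (fun y => Mf y) => exact: continuous_Mf
  | |- continuous_at _ (Mf) => exact: continuous_Mf
  | |- continuous_at _ (fun y => Mx _ y) => exact: continuous_Mx
  | |- continuous_at _ (Mx _) => exact: continuous_Mx
  | |- continuous_at _ (fun y => Mxx _ y) => exact: continuous_Mxx
  | |- continuous_at _ (Mxx _) => exact: continuous_Mxx
  end.

Lemma continuous_dspace_flux i : continuous_at z (dspace_flux i).
Proof. rewrite /dspace_flux; continuity flux_leaf. Qed.

Lemma continuous_dtime_flux : continuous_at z dtime_flux.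
Proof. rewrite /dtime_flux; continuity flux_leaf. Qed.

End continuity.

Section support.
Variable S : set V.
Hypotheses (closedS : closed S) (compactS : compact S)
  (domS : forall z, S z -> dom z) (uS : forall z, ~ S z -> u z = 0).

Lemma derive_zero_off (f : V -> R) e : (forall z, ~ S z -> f z = 0) ->
  forall z, ~ S z -> 'D_e f z = 0.
Proof.
move=> fS z Sz.
have nS : nbhs z (~` S) by apply: open_nbhs_nbhs; split => //; exact: closed_openC.
have h : is_derive z e f 0.
  by apply: near_eq_is_derive (is_derive_const 0 z e); apply: filterS nS => y /fS ->.
by case: h.
Qed.

Lemma vf_off z : ~ S z -> vf z = 0.
Proof. by move=> Sz; rewrite /vf uS// mulr0. Qed.

Lemma vx_off i z : ~ S z -> vx i z = 0.
Proof.
by move=> Sz; rewrite /vx uS// (derive_zero_off _ uS)// mulr0 addr0 mulr0.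
Qed.

Lemma vxx_off i j z : ~ S z -> vxx i j z = 0.
Proof.
move=> Sz; rewrite /vxx uS// !(derive_zero_off _ uS)// !(mulr0, addr0).
by rewrite (derive_zero_off _ (derive_zero_off _ uS))// mulr0.
Qed.

Lemma space_flux_off i z : ~ S z -> space_flux i z = 0.
Proof.
move=> Sz; rewrite /space_flux vf_off// vx_off// !(mul0r, mulr0, oppr0, addr0, add0r).
rewrite /Nf big1 ?mulr0// => j _; by rewrite vx_off// mul0r.
Qed.

Lemma time_flux_off z : ~ S z -> time_flux z = 0.
Proof.
move=> Sz; rewrite /time_flux vf_off// !mulr0 add0r /Nf big1 ?oppr0// => j _.
by rewrite vx_off// mul0r.
Qed.

Lemma dspace_flux_off i z : ~ S z -> dspace_flux i z = 0.
Proof.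
move=> Sz; rewrite /dspace_flux vf_off// vx_off// vxx_off//.
have -> : Nf z = 0 by rewrite /Nf big1// => j _; rewrite vx_off// mul0r.
have -> : Nx i z = 0 by rewrite /Nx big1 ?mulr0// => j _; rewrite vx_off// mul0r.
by rewrite expr0n/= !(mul0r, mulr0, addr0, subr0).
Qed.

Lemma dtime_flux_off z : ~ S z -> dtime_flux z = 0.
Proof.
move=> Sz; rewrite /dtime_flux vf_off//.
have -> : Nt z = 0 by rewrite /Nt big1 ?mulr0// => j _; rewrite vx_off// mul0r.
by rewrite expr0n/= !(mul0r, mulr0, addr0, subr0).
Qed.

Lemma integrable_zero_off (h : V -> R) : (forall z, ~ S z -> h z = 0) ->
  (forall z, S z -> continuous_at z h) ->
  (@lebesgue_spacetime R n).-integrable setT (EFin \o h).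
Proof.
move=> hS ch; have [M M0 HM] := compact_spacetime_supported compactS.
by apply: (@integrable_spacetime _ _ M); [exact: continuous_zero_off ch|exact: HM].
Qed.

Lemma integral_dspace_flux i : (\int[lebesgue_spacetime]_z (dspace_flux i z)%:E = 0)%E.
Proof.
have [M M0 HM] := compact_spacetime_supported compactS.
apply: (@integral_derive_x _ _ i (space_flux i) _ M) => //.
- apply: (continuous_zero_off closedS); first exact: dspace_flux_off.
  by move=> z Sz; apply: continuous_dspace_flux; exact: domS.
- apply: (is_derive_zero_off closedS); [exact: space_flux_off|exact: dspace_flux_off|].
  by move=> z Sz; apply: is_derive_space_flux => //; exact: domS.
- by apply: HM; exact: space_flux_off.
- by apply: HM; exact: dspace_flux_off.
Qed.

Lemma integral_dtime_flux : (\int[lebesgue_spacetime]_z (dtime_flux z)%:E = 0)%E.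
Proof.
have [M M0 HM] := compact_spacetime_supported compactS.
apply: (@integral_derive_t _ _ time_flux _ M) => //.
- apply: (continuous_zero_off closedS); first exact: dtime_flux_off.
  by move=> z Sz; apply: continuous_dtime_flux; exact: domS.
- apply: (is_derive_zero_off closedS); [exact: time_flux_off|exact: dtime_flux_off|].
  by move=> z Sz; apply: is_derive_time_flux => //; exact: domS.
- by apply: HM; exact: time_flux_off.
- by apply: HM; exact: dtime_flux_off.
Qed.

Lemma integral_divergence :
  (@lebesgue_spacetime R n).-integrable setT
     (fun z => (\sum_i dspace_flux i z + dtime_flux z)%:E) /\
  (\int[lebesgue_spacetime]_z (\sum_i dspace_flux i z + dtime_flux z)%:E = 0)%E.
Proof.
have iX i : (@lebesgue_spacetime R n).-integrable setT (fun z => (dspace_flux i z)%:E).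
  apply: integrable_zero_off; first exact: dspace_flux_off.
  by move=> z Sz; apply: continuous_dspace_flux; exact: domS.
have iY : (@lebesgue_spacetime R n).-integrable setT (fun z => (dtime_flux z)%:E).
  apply: integrable_zero_off; first exact: dtime_flux_off.
  by move=> z Sz; apply: continuous_dtime_flux; exact: domS.
have E : (fun z => (\sum_i dspace_flux i z + dtime_flux z)%:E) =
    (fun z => (\sum_i (dspace_flux i z)%:E) + (dtime_flux z)%:E)%E.
  by apply/funext => z; rewrite EFinD -sumEFin.
have iS : (@lebesgue_spacetime R n).-integrable setT
    (fun z => (\sum_i (dspace_flux i z)%:E)%E) by exact: integrable_sum.
split; first by rewrite E; exact: integrableD.
rewrite E integralD// integral_sum// integral_dtime_flux adde0 big1// => i _.
exact: integral_dspace_flux.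
Qed.

Definition lower_density z : R :=
  expR (Phi z) ^+ 2 * (u z ^+ 2 + \sum_i 'D_(dir_x i) u z ^+ 2).
Definition upper_density z : R :=
  (expR (Phi z) * ('D_dir_t u z + \sum_i 'D_(dir_x i) ('D_(dir_x i) u) z)) ^+ 2.

Lemma lower_density_off z : ~ S z -> lower_density z = 0.
Proof.
move=> Sz; rewrite /lower_density uS// expr0n/= big1 ?addr0 ?mulr0// => i _.
by rewrite (derive_zero_off _ uS)// expr0n.
Qed.

Lemma upper_density_off z : ~ S z -> upper_density z = 0.
Proof.
move=> Sz; rewrite /upper_density (derive_zero_off _ uS)// big1 => [|i _].
  by rewrite addr0 mulr0 expr0n.
by rewrite (derive_zero_off _ (derive_zero_off _ uS)).
Qed.

Lemma carleman_integral :
  (forall z, S z -> lower_density z + (\sum_i dspace_flux i z + dtime_flux z) <= upper_density z) ->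
  (\int[lebesgue_spacetime]_z (lower_density z)%:E <=
   \int[lebesgue_spacetime]_z (upper_density z)%:E)%E.
Proof.
move=> hS; have [iD D0] := integral_divergence.
have iL : (@lebesgue_spacetime R n).-integrable setT (fun z => (lower_density z)%:E).
  apply: integrable_zero_off; first exact: lower_density_off.
  move=> z Sz; have dz := domS Sz; rewrite /lower_density.
  apply: for_continuousM; first by apply: for_continuousX; exact: continuous_weight.
  apply: for_continuousD; first by apply: for_continuousX; exact: u_continuous.
  apply: (@for_continuous_sum _ _ _ _ (fun i y => 'D_(dir_x i) u y ^+ 2)) => i.
  by apply: for_continuousX; exact: du_continuous.
have iU : (@lebesgue_spacetime R n).-integrable setT (fun z => (upper_density z)%:E).
  apply: integrable_zero_off; first exact: upper_density_off.
  move=> z Sz; have dz := domS Sz; rewrite /upper_density.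
  apply: for_continuousX; apply: for_continuousM; first exact: continuous_weight.
  apply: for_continuousD; first exact: du_continuous.
  apply: (@for_continuous_sum _ _ _ _ (fun i y => 'D_(dir_x i) ('D_(dir_x i) u) y)) => i.
  exact: d2u_continuous.
rewrite -[leLHS]adde0 -D0 -integralD//; apply: le_integral => //.
  exact: integrableD.
move=> z _; rewrite -EFinD lee_fin; have [/hS//|Sz] := pselect (S z).
rewrite lower_density_off// upper_density_off// dtime_flux_off// big1 ?addr0// => i _.
exact: dspace_flux_off.
Qed.

End support.
End flux_integral.

Lemma weightE (R : realType) (d : nat) (m eps alpha K a : R)
    (z : 'rV[R]_d.+1 * R) : 0 < z.1 ord0 ord0 ->
  weight m eps alpha K a z = expR (Phi (phi_monomials m alpha (eps `^ m)) a K z) ^+ 2.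
Proof.
move=> x0; rewrite -expRM_natl /weight; congr expR.
rewrite /phi phi_mono_eval// /Phi /time_factor -sqnormE invfM.
by move: (z.2)^-1 => b; field.
Qed.

Unset Implicit Arguments.

Theorem proposition1p2 (R : realType) (d : nat) (m eps0 : R)
    (hm : cone_constants m eps0) (eps theta : R)
    (heps : 0 < eps < eps0) (htheta : 0 < theta < pi)
    (heps_theta : eps = cos (theta / 2)) :
  exists alpha K : R, [/\ 1 < alpha < 2, 0 < K &
    forall u : 'rV[R]_d.+1 * R -> R, test_function (cylinder theta) u ->
    forall a : R, 0 < a ->
    (\int[lebesgue_spacetime]_(z in cylinder theta)
       (weight m eps alpha K a z
        * (`|u z| ^+ 2 + enorm (gradient u z) ^+ 2))%:E
     <= \int[lebesgue_spacetime]_(z in cylinder theta)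
       (weight m eps alpha K a z
        * `|dt u z + laplacian u z| ^+ 2)%:E)%E].
Proof.
have [[gamma sys] _] := hm.
have e1 : eps <= 1 by rewrite heps_theta cos_le1.
have [al [K [alb K0 H]]] := @phase_estimates R d gamma m eps0 eps sys heps e1.
exists al, K; split => // u [smooth_u compactS SQ] a a0.
set S := closure _ in compactS SQ.
have closedS : closed S by exact: closed_closure.
have uS z : ~ S z -> u z = 0.
  move=> Sz; apply/eqP/negP => uz; apply: Sz; apply: subset_closure => /=.
  exact/negP.
have x0Q (z : 'rV[R]_d.+1 * R) : cylinder theta z -> 0 < z.1 ord0 ord0.
  by case=> _ x1 _; exact: lt_trans x1.
have domS z : S z -> dom z.
  move=> Sz; split; first by apply: x0Q; exact: SQ.
  by have [_ _ /andP[]] := SQ z Sz.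
pose l := phi_monomials m al (eps `^ m).
have smooth3 : Ck 3 u by exact: smooth_u.
have main : (\int[lebesgue_spacetime]_z (lower_density l a K u z)%:E <=
    \int[lebesgue_spacetime]_z (upper_density l a K u z)%:E)%E.
  apply: (carleman_integral smooth3 closedS compactS domS uS) => z Sz.
  have dz := domS z Sz; have [Cz x1 t01] := SQ z Sz.
  have xcone : eps * enorm z.1 <= z.1 ord0 ord0 by rewrite mulrC heps_theta ltW.
  have [psd coef] := H a z a0 x1 xcone t01.
  have [s0 b1 _ _] := time_weights a0 K0 t01.
  exact: carleman_pointwise.
rewrite [leLHS]integral_mkcond [leRHS]integral_mkcond.
rewrite [leLHS](_ : _ = \int[lebesgue_spacetime]_z (lower_density l a K u z)%:E)%E.
  rewrite [leRHS](_ : _ = \int[lebesgue_spacetime]_z (upper_density l a K u z)%:E)%E//.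
  apply: eq_integral => z _; rewrite patchE; case: ifPn => [|/negP].
    rewrite inE => Qz; congr EFin; rewrite (weightE _ _ _ _ _ (x0Q z Qz)).
    by rewrite /upper_density exprMn -normrX ger0_norm ?sqr_ge0.
  rewrite inE => Qz; rewrite (upper_density_off _ _ _ closedS uS)//.
  by move=> /SQ.
apply: eq_integral => z _; rewrite patchE; case: ifPn => [|/negP].
  rewrite inE => Qz; congr EFin; rewrite (weightE _ _ _ _ _ (x0Q z Qz)).
  rewrite /lower_density -normrX ger0_norm ?sqr_ge0// -sqnormE.
  by congr (_ * (_ + _)); apply: eq_bigr => i _; rewrite mxE.
rewrite inE => Qz; rewrite (lower_density_off _ _ _ closedS uS)//.
by move=> /SQ.
Qed.
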